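(* Let $\tau,\theta$ be stopping times with $0\le\tau<\infty$ and $\tau\le\theta\le\infty$. The following are equivalent: (1) $\phi$ is a mapping defined on $\mathcal R^\infty_{\tau,\theta}$ that can be represented as $$\phi(X)=\operatorname{ess\,inf}_{a\in\mathcal Q}\langle X,a\rangle_{\tau,\theta},\qquad X\in\mathcal R^\infty_{\tau,\theta},\qquad( * )$$ for a non-empty subset $\mathcal Q$ of $\mathcal D_{\tau,\theta}$. (2) $\phi$ is a coherent utility functional on $\mathcal R^\infty_{\tau,\theta}$ whose acceptance set $\mathcal C_\phi$ is $\sigma(\mathcal R^\infty,\mathcal A^1)$-closed. (3) $\phi$ is a coherent utility functional on $\mathcal R^\infty_{\tau,\theta}$ that is continuous for bounded decreasing sequences. Moreover, if (1)--(3) are satisfied, then the set $$\mathcal Q^0_\phi:=\{a\in\mathcal D_{\tau,\theta}:\phi^{\#}(a)=0\}$$ is equal to the smallest $\sigma(\mathcal A^1,\mathcal R^\infty)$-closed, $\mathcal F_\tau$-convex subset of $\mathcal D_{\tau,\theta}$ that contains $\mathcal Q$, and the representation $( * )$ also holds with $\mathcal Q^0_\phi$ instead of $\mathcal Q$.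
   Context: Setup. $\mathbb N=\{0,1,2,\dots\}$; $(\Omega,\mathcal F,(\mathcal F_t)_{t\in\mathbb N},P)$ is a filtered probability space with $\mathcal F_0=\{\emptyset,\Omega\}$; stopping times are $(\mathcal F_t)$-stopping times. All equalities and inequalities between random variables or processes (for processes: simultaneously for all $t$) and all equalities and inclusions between events are understood $P$-almost surely. $\mathcal R^0$ is the space of real-valued adapted processes $(X_t)_{t\in\mathbb N}$ (a.s. equal processes are identified); $\mathcal R^\infty$ is the subspace of those with $\sup_{t}|X_t|\le m$ for some $m\in\mathbb R$. For stopping times $0\le\tau<\infty$, $\tau\le\theta\le\infty$, put $\pi_{\tau,\theta}(X)_t:=1_{\{\tau\le t\}}X_{t\wedge\theta}$ and $\mathcal R^\infty_{\tau,\theta}:=\pi_{\tau,\theta}\mathcal R^\infty$. $1_{[\tau,\infty)}$ is the process $t\mapsto 1_{\{\tau\le t\}}$. Dual space. For $a\in\mathcal R^0$ put $a_{-1}:=0$, $\Delta a_t:=a_t-a_{t-1}$, $\|a\|_{\mathcal A^1}:=E[\sum_{t\in\mathbb N}|\Delta a_t|]$. $\mathcal A^1:=\{a\in\mathcal R^0:\|a\|_{\mathcal A^1}<\infty\}$, $\mathcal A^1_+:=\{a\in\mathcal A^1:\Delta a_t\ge0\ \forall t\}$. $\langle X,a\rangle:=E[\sum_{t\in\mathbb N}X_t\Delta a_t]$ for $X\in\mathcal R^\infty$, $a\in\mathcal A^1$; $\sigma(\mathcal R^\infty,\mathcal A^1)$ and $\sigma(\mathcal A^1,\mathcal R^\infty)$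 are the corresponding weak topologies on $\mathcal R^\infty$ and on $\mathcal A^1$ (coarsest topologies making all functionals $\langle\cdot,a\rangle$, respectively $\langle X,\cdot\rangle$, continuous). $\langle X,a\rangle_{\tau,\theta}:=E[\sum_{t\in[\tau,\theta]\cap\mathbb N}X_t\Delta a_t\mid\mathcal F_\tau]$. $\mathcal A^1_{\tau,\theta}:=\pi_{\tau,\theta}\mathcal A^1$, $(\mathcal A^1_{\tau,\theta})_+:=\pi_{\tau,\theta}\mathcal A^1_+$, $\mathcal D_{\tau,\theta}:=\{a\in(\mathcal A^1_{\tau,\theta})_+:\langle1,a\rangle_{\tau,\theta}=1\}$. A set $\mathcal Q$ of processes is $\mathcal F_\tau$-convex if $\lambda a+(1-\lambda)b\in\mathcal Q$ for all $a,b\in\mathcal Q$ and $\lambda\in L^\infty(\mathcal F_\tau)$ with $0\le\lambda\le1$. Functionals. A monetary utility functional on $\mathcal R^\infty_{\tau,\theta}$ is a map $\phi:\mathcal R^\infty_{\tau,\theta}\to L^\infty(\mathcal F_\tau)$ with: (0) $\phi(1_AX)=1_A\phi(X)$ for all $X$ and $A\in\mathcal F_\tau$; (1) $\phi(X)\le\phi(Y)$ whenever $X\le Y$; (2) $\phi(X+m1_{[\tau,\infty)})=\phi(X)+m$ for all $X\in\mathcal R^\infty_{\tau,\theta}$, $m\in L^\infty(\mathcal F_\tau)$. It is concave if (3) $\phi(\lambda X+(1-\lambda)Y)\ge\lambda\phi(X)+(1-\lambda)\phi(Y)$ for all $X,Y$ and $\lambda\in L^\infty(\mathcal F_\tau)$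 with $0\le\lambda\le1$. A coherent utility functional is a concave one with (4) $\phi(\lambda X)=\lambda\phi(X)$ for all $X$ and all $\lambda\in L^\infty(\mathcal F_\tau)$, $\lambda\ge0$. The acceptance set is $\mathcal C_\phi:=\{X\in\mathcal R^\infty_{\tau,\theta}:\phi(X)\ge0\}$. $\phi$ is continuous for bounded decreasing sequences if $\lim_n\phi(X^n)=\phi(X)$ a.s. for every decreasing sequence $(X^n)$ in $\mathcal R^\infty_{\tau,\theta}$ and $X\in\mathcal R^\infty_{\tau,\theta}$ with $X^n_t\to X_t$ a.s. for all $t\in\mathbb N$. For $a\in\mathcal A^1_{\tau,\theta}$, $\phi^{\#}(a):=\operatorname{ess\,inf}_{X\in\mathcal C_\phi}\langle X,a\rangle_{\tau,\theta}$. *)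

(* Defs.v *)
From HB Require Import structures.
From mathcomp Require Import all_boot all_order all_algebra.
From mathcomp Require Import all_classical all_reals all_analysis.
From mathcomp Require Import measurable_realfun.

Set Implicit Arguments.
Unset Strict Implicit.
Unset Printing Implicit Defensive.
Import Order.TTheory GRing.Theory Num.Theory.
Import numFieldNormedType.Exports.
Local Open Scope classical_set_scope.
Local Open Scope ring_scope.

(* Random variables and processes are represented by functions; almost surely
   equal functions represent the same object.  No null sets are added to the
   filtration, so "G-measurable" for a class means that some representative is
   G-measurable (see [L0]).  All the spaces below are thereby closed under
   almost sure equality of (measurable) representatives. *)

(* Times in {0, 1, 2, ...} with oo, where [None] stands for oo. *)
Definition etime := option nat.

Definition le_etime (x y : etime) : bool :=
  match x, y with
  | _, None => true
  | None, Some _ => false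
  | Some m, Some n => (m <= n)%N
  end.

Definition min_etime (t : nat) (x : etime) : nat :=
  if x is Some n then minn t n else t.

Section filtered_space.
Context {d : measure_display} {T : measurableType d} {R : realType}.
Variables (P : probability T R) (F : nat -> set (set T)).

Definition process := nat -> T -> R.

Definition is_filtration : Prop :=
  [/\ forall t, sigma_algebra [set: T] (F t),
      forall t, F t `<=` measurable
    & forall s t, (s <= t)%N -> F s `<=` F t].

Definition stopping_time (tau : T -> etime) : Prop :=
  forall t, F t [set w | le_etime (tau w) (Some t)].

Definition sigma_at (tau : T -> etime) : set (set T) :=
  [set A | measurable A /\
     forall t, F t (A `&` [set w | le_etime (tau w) (Some t)])].

Definition measurable_wrt (G : set (set T)) (f : T -> R) : Prop :=
  forall B : set R, measurable B -> G (f @^-1` B).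

Definition L0 (G : set (set T)) : set (T -> R) :=
  [set f | measurable_fun [set: T] f /\
     exists2 g, measurable_wrt G g & \forall w \ae P, f w = g w].

Definition Linf (G : set (set T)) : set (T -> R) :=
  [set f | L0 G f /\ exists m : R, \forall w \ae P, `|f w| <= m].

Definition eq_process (X Y : process) : Prop :=
  \forall w \ae P, forall t, X t w = Y t w.

Definition le_process (X Y : process) : Prop :=
  \forall w \ae P, forall t, X t w <= Y t w.

Definition adapted : set process := [set X | forall t, L0 (F t) (X t)].

Definition Rinf : set process :=
  [set X | adapted X /\
     exists m : R, \forall w \ae P, forall t, `|X t w| <= m].

Definition incr (a : process) : process :=
  fun t w => a t w - (if t is s.+1 then a s w else 0).

Definition A1 : set process :=
  [set a | adapted a /\
     (\int[P]_w \sum_(0 <= t <oo) `|incr a t w|%:E < +oo)%E].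

Definition A1pos : set process :=
  [set a | A1 a /\ \forall w \ae P, forall t, 0 <= incr a t w].

(* For X in Rinf and a in A1 the sum converges absolutely almost surely and
   the expectation is finite. *)
Definition pairing (X a : process) : R :=
  fine (\int[P]_w \sum_(0 <= t <oo) (X t w * incr a t w)%:E)%E.

Definition Rinf_weak : topologicalType :=
  initial_topology
    ((fun (X : Rinf) (a : A1) => pairing (\val X) (\val a))
       : Rinf -> {ptws A1 -> R}).

Definition A1_weak : topologicalType :=
  initial_topology
    ((fun (a : A1) (X : Rinf) => pairing (\val X) (\val a))
       : A1 -> {ptws Rinf -> R}).

Definition Rinf_closed (C : set process) : Prop :=
  closed ([set X : Rinf | C (\val X)] : set Rinf_weak).

Definition A1_closed (K : set process) : Prop :=
  closed ([set a : A1 | K (\val a)] : set A1_weak).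

Definition is_condexp (G : set (set T)) (Y : T -> \bar R) (Z : T -> R) : Prop :=
  [/\ measurable_wrt G Z, P.-integrable [set: T] (EFin \o Z)
    & forall A, G A -> (\int[P]_(w in A) (Z w)%:E = \int[P]_(w in A) Y w)%E].

Definition condexp (G : set (set T)) (Y : T -> \bar R) : T -> R :=
  xget (cst 0) [set Z | is_condexp G Y Z].

Definition is_ess_inf (S : set (T -> R)) (Z : T -> \bar R) : Prop :=
  [/\ measurable_fun [set: T] Z,
      forall f, S f -> \forall w \ae P, (Z w <= (f w)%:E)%E
    & forall W : T -> \bar R, measurable_fun [set: T] W ->
        (forall f, S f -> \forall w \ae P, (W w <= (f w)%:E)%E) ->
        \forall w \ae P, (W w <= Z w)%E].

Definition ess_inf (S : set (T -> R)) : T -> \bar R :=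
  xget (cst +oo%E) [set Z | is_ess_inf S Z].

Section interval.
Variables tau theta : T -> etime.

Definition proj_process (X : process) : process :=
  fun t w => if le_etime (tau w) (Some t) then X (min_etime t (theta w)) w
             else 0.

(* The image of a set of processes under the projection, up to almost sure
   equality. *)
Definition proj_image (S : set process) : set process :=
  [set X | adapted X /\ exists2 Y, S Y & eq_process X (proj_process Y)].

Definition Rinf_on : set process := proj_image Rinf.

Definition A1pos_on : set process := proj_image A1pos.

Definition cpairing (X a : process) : T -> R :=
  condexp (sigma_at tau)
    (fun w => \sum_(0 <= t <oo | le_etime (tau w) (Some t) &&
                                 le_etime (Some t) (theta w))
                (X t w * incr a t w)%:E)%E.

Definition densities : set process :=
  [set a | A1pos_on a /\
     \forall w \ae P, cpairing (fun _ _ => 1) a w = 1].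

Definition mix (l : T -> R) (X Y : process) : process :=
  fun t w => l w * X t w + (1 - l w) * Y t w.

Definition weight (l : T -> R) : Prop :=
  Linf (sigma_at tau) l /\ \forall w \ae P, 0 <= l w <= 1.

Definition F_convex (K : set process) : Prop :=
  forall a b l, K a -> K b -> weight l -> K (mix l a b).

(* [phi] induces a map from Rinf_on modulo almost sure equality to random
   variables modulo almost sure equality; its values outside Rinf_on are
   irrelevant. *)
Definition functional_on (phi : process -> T -> R) : Prop :=
  (forall X, Rinf_on X -> measurable_fun [set: T] (phi X)) /\
  (forall X Y, Rinf_on X -> Rinf_on Y -> eq_process X Y ->
     \forall w \ae P, phi X w = phi Y w).

Definition monetary_utility (phi : process -> T -> R) : Prop :=
  [/\ forall X, Rinf_on X -> Linf (sigma_at tau) (phi X),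
      forall X A, Rinf_on X -> sigma_at tau A ->
        \forall w \ae P,
          phi (fun t v => \1_A v * X t v) w = \1_A w * phi X w,
      forall X Y, Rinf_on X -> Rinf_on Y -> le_process X Y ->
        \forall w \ae P, phi X w <= phi Y w
    & forall X m, Rinf_on X -> Linf (sigma_at tau) m ->
        \forall w \ae P,
          phi (fun t v => X t v + m v * (le_etime (tau v) (Some t))%:R) w
          = phi X w + m w].

Definition concave_utility (phi : process -> T -> R) : Prop :=
  monetary_utility phi /\
  forall X Y l, Rinf_on X -> Rinf_on Y -> weight l ->
    \forall w \ae P,
      l w * phi X w + (1 - l w) * phi Y w <= phi (mix l X Y) w.

Definition coherent_utility (phi : process -> T -> R) : Prop :=
  concave_utility phi /\
  forall X l, Rinf_on X -> Linf (sigma_at tau) l ->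
    (\forall w \ae P, 0 <= l w) ->
    \forall w \ae P, phi (fun t v => l v * X t v) w = l w * phi X w.

Definition acceptance (phi : process -> T -> R) : set process :=
  [set X | Rinf_on X /\ \forall w \ae P, 0 <= phi X w].

Definition continuous_decreasing (phi : process -> T -> R) : Prop :=
  forall (Xn : nat -> process) (X : process),
    (forall n, Rinf_on (Xn n)) -> Rinf_on X ->
    (forall n, le_process (Xn n.+1) (Xn n)) ->
    (forall t, \forall w \ae P, Xn n t w @[n --> \oo] --> X t w) ->
    \forall w \ae P, phi (Xn n) w @[n --> \oo] --> phi X w.

Definition conjugate (phi : process -> T -> R) (a : process) : T -> \bar R :=
  ess_inf [set cpairing X a | X in acceptance phi].

Definition represents (Q : set process) (phi : process -> T -> R) : Prop :=
  [/\ Q !=set0, Q `<=` densities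
    & forall X, Rinf_on X ->
        \forall w \ae P,
          (phi X w)%:E = ess_inf [set cpairing X a | a in Q] w].

Definition null_densities (phi : process -> T -> R) : set process :=
  [set a | densities a /\ \forall w \ae P, conjugate phi a w = 0%E].

Definition closed_convex_densities (K : set process) : Prop :=
  [/\ K `<=` densities, A1_closed K & F_convex K].

End interval.
End filtered_space.

Arguments process {d} T R.

Definition is_smallest (U : Type) (C : set U -> Prop) (G A : set U) : Prop :=
  [/\ C A, G `<=` A & forall K, C K -> G `<=` K -> A `<=` K].

(* Main.v *)
Require Import Defs.
From HB Require Import structures.
From mathcomp Require Import all_boot all_order all_algebra.
From mathcomp Require Import all_classical all_reals all_analysis.
From mathcomp Require Import measurable_realfun lra ring.
Import Order.TTheory GRing.Theory Num.Theory.
Import numFieldNormedType.Exports.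
Local Open Scope classical_set_scope.
Local Open Scope ring_scope.

(** The functional [phi] is concave and positively homogeneous, so a representation
    by densities is a bipolar theorem.  What has to be explained is why essential
    infima behave like infima, and why continuity along decreasing sequences makes
    the separating linear functionals pairings with processes of integrable
    variation.

    A representation gives coherence and closedness.  An essential infimum over
    [Q] is the limit of a decreasing sequence of finite minima
    ([finite_min_approx]), and the properties of coherent functionals that are
    not mere inequalities, such as homogeneity, pass through finite minima
    ([represents_homogeneous]).  The acceptance set is an intersection of weakly
    closed half-spaces: those of the densities in [Q] localised on events known
    at [tau] ([pairing_cumul_locf]), and those which characterise the processes
    that live on the stochastic interval ([Ron_bipolar]).

    A closed acceptance set gives continuity ([closed_continuous]).  Let [Xn]
    decrease to [X], and let [z] be the limit of [phi Xn].  Each [Xn - z] is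
    accepted and these processes converge weakly ([pairing_dominated]), so that
    [X - z] is accepted, that is [z <= phi X].

    Continuity gives a representation.  Bounded adapted processes are bounded
    measurable functions on the product of the sample space with time, for the
    optional sigma-algebra and a finite measure.  There
    [u X = E (phi X)] is superlinear, monotone and continuous from above.  If
    [u x0 < 0], then [separating_density] gives an integrable [h >= 0] whose
    integral functional dominates [u] and is nonpositive at [x0].  For this, a
    linear majorant of [u] is obtained from Hahn-Banach; it is an integral
    as soon as it is small on indicators of small sets, and this is enforced by
    bounding it below on a set [young_ball] which contains large multiples of
    such indicators.  That set must not reach, from [x0], the cone where [u] is
    nonnegative: it is the unit ball of an Orlicz norm whose Young function is
    constructed level by level, the next level being found by a selection
    argument in L2 that replaces weak compactness ([penalty_extend],
    [decreasing_convex_selection]).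

    The function [h] is turned into a process [a] with
    [E (phi Y) <= <Y, a>] for all [Y] ([density_exists]); localising on
    events known at [tau], [a] is a density and [phi Y] is below the conditional
    pairing of [Y] and [a] ([dominating_density]).  Such an [a] is called dominating.
    For [x0 = X - E (phi X) - e] one gets [<X, a> <= E (phi X) + e], so the essential
    infimum over dominating densities is [phi] ([dominating_represents]).

    By translation, the densities with zero conjugate are the dominating ones
    ([null_densitiesE]); they form a closed conditionally convex set which
    contains [Q].  It is the smallest one ([dominating_densities_least]): if a
    closed conditionally convex set [K] containing [Q] misses a dominating [a0], a
    finite-dimensional separation ([finite_separation]) yields [Z] and
    [del > 0] with [<Z, a0> + del <= <Z, a>] for [a] in [K].  As [K] is
    conditionally convex, finite minima of conditional pairings with elements of
    [K] are again such pairings ([finite_min_realized]); hence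
    [<Z, a0> + del <= E (phi Z)], although [a0] is dominating. *)

(** * Hahn-Banach for superlinear functionals *)

Section HahnBanach.
Context {R : realType} {V : lmodType R}.
Implicit Types (w : V -> R).

Definition superlinear w : Prop :=
  (forall x y, w x + w y <= w (x + y)) /\
  (forall c x, 0 <= c -> w (c *: x) = c * w x).

Lemma superlinear0 w : superlinear w -> w 0 = 0.
Proof. by move=> [_ h]; rewrite -(scale0r 0) h// mul0r. Qed.

Lemma superlinear_opp w x : superlinear w -> w x <= - w (- x).
Proof.
move=> sw; rewrite lerNr; have [h _] := sw.
by have := h x (- x); rewrite subrr superlinear0//; lra.
Qed.

(** The upper bound in each clause of superlinearity is a statement on the sets
    [E z]; homogeneity needs only one inclusion between [c * E z] and [E (c *: z)],
    the other one being the same inclusion for [c^-1]. *)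
Lemma superlinear_sup (E : V -> set R) : (forall z, has_ubound (E z)) -> E 0 0 ->
  (forall z, E z !=set0) -> (forall r, E 0 r -> r <= 0) ->
  (forall x y r s, E x r -> E y s -> exists2 q, E (x + y) q & r + s <= q) ->
  (forall c z r, 0 < c -> E z r -> E (c *: z) (c * r)) ->
  superlinear (fun z => sup (E z)).
Proof.
move=> Eub E00 Ene E0 ED EZ; split=> [x y|c x c0].
- rewrite -lerBrDr; apply: ge_sup => // r Er.
  rewrite lerBrDr addrC -lerBrDr; apply: ge_sup => // s Es.
  have [q Eq rsq] := ED _ _ _ _ Er Es; rewrite lerBrDr addrC; apply: le_trans rsq _.
  exact: ub_le_sup.
- have [->|cN0] := eqVneq c 0.
    rewrite scale0r mul0r; apply/eqP; rewrite eq_le; apply/andP; split; last exact: ub_le_sup.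
    by apply: ge_sup => //; exists 0.
  have cp : 0 < c by rewrite lt_def cN0.
  have key e z : 0 < e -> e * sup (E z) <= sup (E (e *: z)).
    move=> e0; rewrite -ler_pdivlMl//; apply: ge_sup => // r Er.
    by rewrite ler_pdivlMl//; apply: ub_le_sup => //; exact: EZ.
  apply/eqP; rewrite eq_le key// andbT.
  have := key c^-1 (c *: x); rewrite scalerA mulVf// scale1r invr_gt0 => /(_ cp).
  by rewrite ler_pdivrMl.
Qed.

(** For fixed [y], the supremum over [t >= 0] of [w (z + t *: y) - t * w y] is
    superlinear in [z] and at least [w z].  By maximality it is [w], and [t = 1]
    gives the missing inequality. *)
Lemma maximal_superlinear_additive w : superlinear w ->
  (forall w', superlinear w' -> (forall x, w x <= w' x) -> w' = w) ->
  forall x y, w (x + y) = w x + w y.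
Proof.
move=> sw wmax x y; have [wD wZ] := sw.
pose E z := [set r | exists2 t, 0 <= t & r = w (z + t *: y) - t * w y].
have Ene z : E z !=set0 by exists (w z), 0; rewrite ?scale0r ?addr0 ?mul0r ?subr0.
have Eub z : ubound (E z) (- w (- z)).
  move=> r [t t0 ->]; have := wD (z + t *: y) (- z).
  by rewrite addrAC subrr add0r wZ//; lra.
have Ehub z : has_ubound (E z) by exists (- w (- z)); exact: Eub.
have wE z t : 0 <= t -> w (z + t *: y) - t * w y <= sup (E z).
  by move=> t0; apply: ub_le_sup => //; exists t.
suff : (fun z => sup (E z)) = w.
  move=> /(congr1 (fun f => f x)) /= h.
  have := wE x 1 ler01; rewrite h scale1r mul1r => h1.
  by have := wD x y; lra.
apply: wmax; last by move=> z; have := wE z 0 (lexx _); rewrite scale0r addr0 mul0r subr0.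
apply: superlinear_sup => //.
- by exists 0; rewrite // scale0r addr0 superlinear0// mul0r subr0.
- by move=> r /Eub; rewrite oppr0 superlinear0// oppr0.
- move=> a b _ _ [t t0 ->] [s s0 ->]; eexists; first by exists (t + s); rewrite ?addr_ge0.
  by have := wD (a + t *: y) (b + s *: y); rewrite addrACA -scalerDl; lra.
- move=> c z _ c0 [t t0 ->]; exists (c * t); first exact: mulr_ge0 (ltW c0) t0.
  by rewrite -scalerA -scalerDr wZ ?(ltW c0)//; ring.
Qed.

(** Hahn-Banach: by Zorn's lemma there is a maximal superlinear majorant, and a
    maximal one is additive. *)
Theorem superlinear_dominated p : superlinear p ->
  exists f : V -> R, [/\ forall x, p x <= f x,
    forall x y, f (x + y) = f x + f y & forall c x, f (c *: x) = c * f x].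
Proof.
move=> sp.
pose S := {w : V -> R | superlinear w /\ forall x, p x <= w x}.
pose le (v w : S) := `[< forall x, sval v x <= sval w x >].
have [||||m mmax] := @Zorn S le.
- by move=> t; apply/asboolP => x.
- by move=> r s t /asboolP h1 /asboolP h2; apply/asboolP => x; exact: le_trans (h2 x).
- move=> [s ps] [t pt] /asboolP /= h1 /asboolP /= h2; apply: eq_exist => /=.
  by apply/funext => x; apply/eqP; rewrite eq_le h1 h2.
- move=> A Atot.
  have [[w0 Aw0]|A0] := pselect (A !=set0); last first.
    by exists (exist _ p (conj sp (fun x => lexx _))) => s As; case: A0; exists s.
  pose E z := [set sval w z | w in A].
  have Ene z : E z !=set0 by exists (sval w0 z), w0.
  have Eub z : ubound (E z) (- p (- z)).
    move=> _ [[w [sw pw]] Aw <-] /=; apply: le_trans (superlinear_opp w z sw) _.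
    by rewrite lerN2.
  have Ehub z : has_ubound (E z) by exists (- p (- z)); exact: Eub.
  have wE (w : S) z : A w -> sval w z <= sup (E z).
    by move=> Aw; apply: ub_le_sup => //; exists w.
  have sE : superlinear (fun z => sup (E z)).
    apply: superlinear_sup => //.
    - by exists w0 => //; rewrite superlinear0//; case: (svalP w0).
    - by move=> r /Eub; rewrite oppr0 superlinear0// oppr0.
    - move=> x y _ _ [v Av <-] [w Aw <-].
      have [/asboolP vw|/asboolP wv] := Atot v w Av Aw.
      + exists (sval w (x + y)); first by exists w.
        by have [[h _] _] := svalP w; apply: le_trans (h _ _); rewrite lerD.
      + exists (sval v (x + y)); first by exists v.
        by have [[h _] _] := svalP v; apply: le_trans (h _ _); rewrite lerD.
    - by move=> c z _ c0 [v Av <-]; exists v => //; have [[_ h] _] := svalP v; rewrite h ?ltW.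
  have pE x : p x <= sup (E x).
    by apply: le_trans (wE w0 x Aw0); case: (svalP w0).
  by exists (exist _ (fun z => sup (E z)) (conj sE pE)) => s As; apply/asboolP => x; exact: wE.
case: m mmax => f [sf pf] fmax.
have fD : forall x y, f (x + y) = f x + f y.
  apply: maximal_superlinear_additive => // w' sw' ww'.
  have pw' x : p x <= w' x by exact: le_trans (pf x) (ww' x).
  have := fmax (exist _ w' (conj sw' pw')); rewrite /le /=.
  by move=> /(_ (introT (asboolP _) ww')) /(congr1 sval).
exists f; split => // c x.
have [c0|c0] := leP 0 c; first by have [_ ->] := sf.
have f0 := superlinear0 _ sf.
have fN z : f (- z) = - f z by apply/eqP; rewrite -addr_eq0 -fD addNr f0.
have [_ fZ] := sf; rewrite -[c in LHS]opprK scaleNr fN fZ; last by lra.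
by rewrite mulNr opprK.
Qed.

End HahnBanach.

(** * Bounded measurable functions *)

Section bounded_measurable.
Context {d : measure_display} {O : measurableType d} {R : realType}.
Implicit Types f g : O -> R.

Definition bm f : Prop :=
  measurable_fun [set: O] f /\ exists M, forall w, `|f w| <= M.

Lemma bm_cst c : bm (fun=> c).
Proof. by split; [exact: measurable_cst|exists `|c|]. Qed.

Lemma bmD f g : bm f -> bm g -> bm (fun w => f w + g w).
Proof.
move=> [mf [M hM]] [mg [N hN]]; split; first exact: measurable_funD.
exists (M + N) => w; apply: le_trans (ler_normD _ _) _; exact: lerD.
Qed.

Lemma bmM f g : bm f -> bm g -> bm (fun w => f w * g w).
Proof.
move=> [mf [M hM]] [mg [N hN]]; split; first exact: measurable_funM.
by exists (M * N) => w; rewrite normrM; apply: ler_pM.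
Qed.

Lemma bmZ c f : bm f -> bm (fun w => c * f w).
Proof. exact: (bmM _ _ (bm_cst c)). Qed.

Lemma bmN f : bm f -> bm (fun w => - f w).
Proof.
move=> [mf [M hM]]; split; first exact: measurableT_comp.
by exists M => w; rewrite normrN.
Qed.

Lemma bmB f g : bm f -> bm g -> bm (fun w => f w - g w).
Proof. by move=> bf bg; apply: bmD => //; exact: bmN. Qed.

Lemma bm_sum (I : Type) (s : seq I) (F : I -> O -> R) : (forall i, bm (F i)) ->
  bm (fun w => \sum_(i <- s) F i w).
Proof.
move=> bF; elim: s => [|i s IH].
  by rewrite (_ : (fun _ => _) = fun=> 0); [exact: bm_cst|apply/funext=> w; rewrite big_nil].
rewrite (_ : (fun _ => _) = fun w => F i w + \sum_(j <- s) F j w); first exact: bmD.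
by apply/funext=> w; rewrite big_cons.
Qed.

Lemma bm_norm f : bm f -> bm (fun w => `|f w|).
Proof.
move=> [mf [M hM]]; split; first exact: measurableT_comp.
by exists M => w; rewrite normr_id.
Qed.

Lemma bm_indic (A : set O) : measurable A -> bm (\1_A : O -> R).
Proof.
move=> mA; split; first exact: measurable_indic.
by exists 1 => w; rewrite indicE; case: (_ \in _); rewrite ?normr1 ?normr0.
Qed.

Lemma bm_max f g : bm f -> bm g -> bm (fun w => Num.max (f w) (g w)).
Proof.
move=> [mf [M hM]] [mg [N hN]]; split; first exact: measurable_maxr.
exists (Num.max M N) => w; rewrite le_max.
by case: (leP (f w) (g w)) => _; rewrite ?hM ?hN ?orbT.
Qed.

Lemma bm_min f g : bm f -> bm g -> bm (fun w => Num.min (f w) (g w)).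
Proof.
move=> [mf [M hM]] [mg [N hN]]; split; first exact: measurable_minr.
exists (Num.max M N) => w; rewrite le_max.
by case: (leP (f w) (g w)) => _; rewrite ?hM ?hN ?orbT.
Qed.

Variable mu : {finite_measure set O -> \bar R}.
Local Notation I := (Rintegral mu [set: O]).

Lemma bm_integrable f : bm f -> mu.-integrable [set: O] (EFin \o f).
Proof.
move=> [mf [M hM]]; apply: measurable_bounded_integrable => //.
  exact: fin_num_fun_lty.
by exists M; split; [exact: num_real|move=> x Mx w _; apply: le_trans (ltW Mx)].
Qed.

Lemma le_bm_integral f g : bm f -> bm g -> (forall w, f w <= g w) -> I f <= I g.
Proof. by move=> bf bg fg; apply: le_Rintegral => //; exact: bm_integrable. Qed.

Lemma bm_integralD f g : bm f -> bm g -> I (fun w => f w + g w) = I f + I g.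
Proof. by move=> bf bg; rewrite RintegralD//; exact: bm_integrable. Qed.

Lemma bm_integralZ c f : bm f -> I (fun w => c * f w) = c * I f.
Proof. by move=> bf; rewrite RintegralZl//; exact: bm_integrable. Qed.

Lemma bm_integralB f g : bm f -> bm g -> I (fun w => f w - g w) = I f - I g.
Proof. by move=> bf bg; rewrite RintegralB//; exact: bm_integrable. Qed.

Lemma bm_integral_cst c : I (fun=> c) = c * fine (mu [set: O]).
Proof. by rewrite Rintegral_cst. Qed.

Lemma bm_integral_ge0 f : (forall w, 0 <= f w) -> 0 <= I f.
Proof. by move=> f0; apply: Rintegral_ge0. Qed.

Lemma bm_integralE f : bm f -> (I f)%:E = (\int[mu]_w (f w)%:E)%E.
Proof. by move=> bf; rewrite fineK//; apply: integrable_fin_num => //; exact: bm_integrable. Qed.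

Lemma Rintegral_dominated_convergence (fs : nat -> O -> R) f (g : O -> R) :
  (forall n, measurable_fun [set: O] (fs n)) -> measurable_fun [set: O] f ->
  mu.-integrable [set: O] (EFin \o g) -> (\forall w \ae mu, forall n, `|fs n w| <= g w) ->
  (\forall w \ae mu, fs n w @[n --> \oo] --> f w) ->
  I (fs n) @[n --> \oo] --> I f.
Proof.
move=> mfs mf ig fg cv.
have [|||||fi _ ] := @dominated_convergence _ _ _ mu _ measurableT
  (fun n w => (fs n w)%:E) (fun w => (f w)%:E) (EFin \o g).
- by move=> n; apply/measurable_EFinP.
- by apply/measurable_EFinP.
- by apply: filterS cv => w h _; apply: cvg_EFin => //; exact: nearW.
- exact: ig.
- by apply: filterS fg => w h n _; rewrite /= lee_fin.
rewrite -[X in _ --> X -> _](fineK (integrable_fin_num _ fi))//.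
by move=> /fine_cvgP [_]; apply: cvg_trans; apply: near_eq_cvg; apply: nearW.
Qed.

Lemma bm_bounded_convergence (fs : nat -> O -> R) f (M : R) :
  (forall n, measurable_fun [set: O] (fs n)) -> bm f ->
  (forall n w, `|fs n w| <= M) ->
  (\forall w \ae mu, fs n w @[n --> \oo] --> f w) ->
  I (fs n) @[n --> \oo] --> I f.
Proof.
move=> mfs [mf _] fM; apply: (Rintegral_dominated_convergence _ _ (fun=> M)) => //.
  by apply: bm_integrable; exact: bm_cst.
by apply: aeW => w n.
Qed.

Lemma integrableMbm f g : bm f -> mu.-integrable [set: O] (EFin \o g) ->
  mu.-integrable [set: O] (EFin \o (fun w => f w * g w)).
Proof.
move=> [mf [M fM]] ig.
have mg : measurable_fun [set: O] g by apply/measurable_EFinP; exact: measurable_int ig.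
apply: (@le_integrable _ _ _ mu _ measurableT _ (fun w => (M * g w)%:E)).
- by apply/measurable_EFinP; exact: measurable_funM.
- move=> w _ /=; rewrite lee_fin !normrM ler_wpM2r//.
  by rewrite (le_trans (fM w)) ?ler_norm.
- under eq_fun do rewrite EFinM.
  exact: integrableZl.
Qed.

End bounded_measurable.
Arguments integrableMbm {d O R mu} f g.

(** * Limits, and integrals of almost surely equal functions *)

Lemma cvg_ge {R : realType} (u : nat -> R) (l x : R) :
  (forall n, x <= u n) -> u n @[n --> \oo] --> l -> x <= l.
Proof.
move=> h cv; rewrite -(cvg_lim _ cv)//; apply: limr_ge; last exact: nearW.
by apply/cvg_ex; exists l.
Qed.

Lemma cvg_le {R : realType} (u : nat -> R) (l x : R) :
  (forall n, u n <= x) -> u n @[n --> \oo] --> l -> l <= x.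
Proof.
move=> h cv; rewrite -(cvg_lim _ cv)//; apply: limr_le; last exact: nearW.
by apply/cvg_ex; exists l.
Qed.

(** Dominated convergence for the counting measure. *)
Lemma dominated_series {R : realType} (f : nat -> nat -> R) (g b : nat -> R) :
  (forall n t, `|f n t| <= b t) -> (\sum_(0 <= t <oo) (b t)%:E < +oo)%E ->
  (forall t, f n t @[n --> \oo] --> g t) ->
  (\sum_(0 <= t <oo) (f n t)%:E)%E @[n --> \oo] --> (\sum_(0 <= t <oo) (g t)%:E)%E.
Proof.
move=> fb bfin fg.
have gb t : `|g t| <= b t by apply: cvg_le (cvg_norm (fg t)) => n; exact: fb.
have b0 t : 0 <= b t := le_trans (normr_ge0 _) (gb t).
have sum u : (forall t, `|u t| <= b t) -> summable [set: nat] (EFin \o u).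
  move=> ub; rewrite /summable -nneseries_esumT; last by move=> t; rewrite lee_fin.
  by apply: le_lt_trans bfin; apply: lee_nneseries => t _ //; rewrite lee_fin.
have [|||||_ _ ] := @dominated_convergence _ nat R (@counting _ R) [set: nat] measurableT
  (fun n t => (f n t)%:E) (EFin \o g) (EFin \o b).
- by [].
- by [].
- by apply: aeW => t _; apply: cvg_EFin; [exact: nearW|exact: fg].
- apply/integrableP; split => //; rewrite ge0_integral_count//.
  by under eq_eseriesr do rewrite /= ger0_norm//.
- by apply: aeW => t n _; rewrite lee_fin.
rewrite integral_count; last exact: sum.
apply: cvg_trans; apply: near_eq_cvg; apply: nearW => n /=.
by rewrite (integral_count (sum _ (fb n))).
Qed.

Lemma ae_eq0_of_Rintegral {d : measure_display} {O : measurableType d} {R : realType}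
    (mu : {measure set O -> \bar R}) (f : O -> R) :
  mu.-integrable [set: O] (EFin \o f) -> (forall w, 0 <= f w) ->
  Rintegral mu [set: O] f <= 0 -> \forall w \ae mu, f w = 0.
Proof.
move=> fi f0 Ef.
have {}Ef : Rintegral mu [set: O] f = 0.
  by apply/eqP; rewrite eq_le Ef; apply: Rintegral_ge0.
have : (\int[mu]_w `|(f w)%:E| = 0)%E.
  under eq_integral do rewrite gee0_abs ?lee_fin//.
  by rewrite -[LHS]fineK ?[fine _]Ef//; apply: integrable_fin_num.
move/ae_eq_integral_abs => /(_ measurableT (measurable_int _ fi)).
by apply: filterS => w /(_ Logic.I) [].
Qed.

Lemma indic01 {T : Type} (R : realType) (A : set T) w : (\1_A w : R) = 0 \/ (\1_A w : R) = 1.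
Proof. by rewrite indicE; case: (w \in A); [right|left]. Qed.

Section ae_integration.
Context {d : measure_display} {T : measurableType d} {R : realType}.
Context {P : probability T R}.
Local Notation E := (Rintegral P [set: T]).
Local Notation integrable f := (P.-integrable [set: T] (EFin \o f)).
Implicit Types f g : T -> R.

Lemma ae_exists (p : T -> Prop) : (\forall w \ae P, p w) -> exists w, p w.
Proof.
move=> [A [mA PA h]]; apply: contrapT => np.
have AT : A = [set: T] by apply/seteqP; split => // w _; apply: h => pw; apply: np; exists w.
by move: PA; rewrite AT probability_setT => /eqP; rewrite onee_eq0.
Qed.

Lemma E_cst (c : R) : E (fun=> c) = c.
Proof. by rewrite Rintegral_cst//= probability_setT mulr1. Qed.

Lemma E_mul0 f : E (fun w => f w * 0) = 0.
Proof. by under eq_Rintegral do rewrite mulr0; exact: E_cst. Qed.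

Lemma integrable_measurable f : integrable f -> measurable_fun [set: T] f.
Proof. by move=> fi; apply/measurable_EFinP; exact: measurable_int fi. Qed.

Lemma integrable_scale (c : R) f : integrable f -> integrable (fun w => c * f w).
Proof.
move=> fi; rewrite (_ : _ \o _ = fun w => (c%:E * (EFin \o f) w)%E)//.
exact: integrableZl.
Qed.

Lemma integrable_sub f g : integrable f -> integrable g -> integrable (fun w => f w - g w).
Proof.
move=> fi gi; rewrite (_ : _ \o _ = (EFin \o f) \- (EFin \o g))%E//; exact: integrableB.
Qed.

Lemma ae_Rintegral_eq (f g : T -> R) : measurable_fun [set: T] f ->
  measurable_fun [set: T] g -> (\forall w \ae P, f w = g w) -> E f = E g.
Proof.
move=> mf mg fg; rewrite /Rintegral; congr fine; apply: ae_eq_integral => //.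
- exact/measurable_EFinP.
- exact/measurable_EFinP.
- by apply: filterS fg => w /= -> _.
Qed.

Lemma ae_Rintegral_ge0 (f : T -> R) : measurable_fun [set: T] f ->
  (\forall w \ae P, 0 <= f w) -> 0 <= E f.
Proof.
move=> mf f0; rewrite (@ae_Rintegral_eq f (fun w => `|f w|))//.
- exact: Rintegral_ge0.
- exact: measurableT_comp.
- by apply: filterS f0 => w h; rewrite ger0_norm.
Qed.

Lemma ae_le_Rintegral (f g : T -> R) : integrable f -> integrable g ->
  (\forall w \ae P, f w <= g w) -> E f <= E g.
Proof.
move=> fi gi fg; rewrite -subr_ge0 -RintegralB//; apply: ae_Rintegral_ge0.
  by apply: measurable_funB; exact: integrable_measurable.
by apply: filterS fg => w; rewrite subr_ge0.
Qed.

Lemma ae_bounded_integrable (f : T -> R) (m : R) : measurable_fun [set: T] f ->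
  (\forall w \ae P, `|f w| <= m) -> integrable f.
Proof.
move=> mf fm; apply/integrableP; split; first exact/measurable_EFinP.
apply: (@le_lt_trans _ _ (\int[P]_w (`|m|%:E))%E); last first.
  by rewrite integral_cst//= probability_setT mule1 ltry.
apply: ae_ge0_le_integral => //.
- by apply/measurable_EFinP; exact: measurableT_comp.
- by apply: filterS fm => w h _; rewrite lee_fin (le_trans h)// ler_norm.
Qed.

Lemma ae_integrable (f g : T -> R) : measurable_fun [set: T] g ->
  (\forall w \ae P, f w = g w) -> integrable f -> integrable g.
Proof.
move=> mg fg /integrableP[mf fi]; apply/integrableP; split; first exact/measurable_EFinP.
apply: le_lt_trans fi; apply: ae_ge0_le_integral => //.
- by apply: measurableT_comp => //; exact/measurable_EFinP.
- exact: measurableT_comp.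
- by apply: filterS fg => w /= -> _.
Qed.

Lemma ae_bounded_convergence (fs : nat -> T -> R) (f : T -> R) m :
  (forall n, measurable_fun [set: T] (fs n)) -> measurable_fun [set: T] f ->
  (\forall w \ae P, forall n, `|fs n w| <= m) ->
  (\forall w \ae P, fs n w @[n --> \oo] --> f w) -> E (fs n) @[n --> \oo] --> E f.
Proof.
move=> mfs mf fm; apply: (Rintegral_dominated_convergence _ _ _ (fun=> m)) => //.
by apply: bm_integrable; exact: bm_cst.
Qed.

Lemma ae_eq_of_Rintegral_le f g : integrable f -> integrable g ->
  (\forall w \ae P, f w <= g w) -> E g <= E f -> \forall w \ae P, f w = g w.
Proof.
move=> fi gi fg Egf.
have di : integrable (fun w => `|g w - f w|) by apply: integrable_norm; exact: integrable_sub.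
have : \forall w \ae P, `|g w - f w| = 0.
  apply: (ae_eq0_of_Rintegral P) => //.
  rewrite (ae_Rintegral_eq _ (fun w => g w - f w)).
  - by rewrite RintegralB// subr_le0.
  - exact: integrable_measurable.
  - by apply: integrable_measurable; exact: integrable_sub.
  - by apply: filterS fg => w h; rewrite ger0_norm// subr_ge0.
by apply: filterS => w /normr0_eq0/eqP; rewrite subr_eq0 => /eqP.
Qed.

End ae_integration.

Arguments E_cst {d T R} P c.

(** * Almost sure convergence of near-minimisers *)

Section functional.
Context {d : measure_display} {O : measurableType d} {R : realType}.
Variable mu : {finite_measure set O -> \bar R}.
Local Notation I := (Rintegral mu [set: O]).
Local Notation bm := (@bm d O R).

(** The limit superior comes with the sequence of running suprema, which decreases
    to it and dominates [fs]: it is to these suprema that continuity along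
    decreasing sequences applies. *)
Lemma cvg_limn_sup_ae (fs : nat -> O -> R) (M : R) :
  (forall n, measurable_fun [set: O] (fs n)) ->
  (forall n w, `|fs n w| <= M) ->
  exists (f : O -> R) (zs : nat -> O -> R), [/\ measurable_fun [set: O] f /\ (forall w, `|f w| <= M),
   forall n, measurable_fun [set: O] (zs n) /\ (forall w, `|zs n w| <= M),
   forall n w, zs n.+1 w <= zs n w /\ fs n w <= zs n w,
   forall w, zs n w @[n --> \oo] --> f w &
   forall w l, fs n w @[n --> \oo] --> l -> f w = l].
Proof.
move=> mf hM.
have ub w : has_ubound (range (fs^~ w)).
  by exists M => _ [n _ <-]; apply: le_trans (ler_norm _) (hM _ _).
have lb w : has_lbound (range (fs^~ w)).
  by exists (- M) => _ [n _ <-]; have := hM n w; rewrite ler_norml => /andP[].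
pose zs n w : R := sups (fs^~ w) n.
have zM n w : `|zs n w| <= M.
  rewrite ler_norml; apply/andP; split.
    apply: (@le_trans _ _ (fs n w)).
      by have := hM n w; rewrite ler_norml => /andP[].
    apply: ub_le_sup; last by exists n => /=.
    by exists M => _ [k _ <-]; apply: le_trans (ler_norm _) (hM _ _).
  apply: ge_sup; first by exists (fs n w), n => /=.
  by move=> _ [k _ <-]; apply: le_trans (ler_norm _) (hM _ _).
have zcv w : zs n w @[n --> \oo] --> limn_sup (fs^~ w).
  by have := @cvg_sups_inf _ _ (ub w) (lb w) => h; rewrite /limn_sup (cvg_lim _ h).
exists (fun w => limn_sup (fs^~ w)), zs; split => //.
- split; first exact: measurable_fun_limn_sup.
  move=> w; have h : (fun n => `|zs n w|) @ \oo --> `|limn_sup (fs^~ w)|.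
    by apply: cvg_norm; exact: zcv.
  rewrite -(cvg_lim _ h)//.
  apply: limr_le; first by apply/cvg_ex; eexists; exact: h.
  by apply: nearW => n.
- by move=> n; split => //; exact: measurable_fun_sups.
- move=> n w; split; first by apply: nonincreasing_sups.
  apply: ub_le_sup; last by exists n => /=.
  by exists M => _ [k _ <-]; apply: le_trans (ler_norm _) (hM _ _).
- by move=> w l /cvg_limn_inf_sup [].
Qed.

(** The sum of the absolute increments is integrable, hence finite almost surely. *)
Lemma ae_cvg_of_summable (ys : nat -> O -> R) (M c : R) :
  (forall n, measurable_fun [set: O] (ys n)) -> (forall n w, `|ys n w| <= M) ->
  (forall n, I (fun w => `|ys n.+1 w - ys n w|) <= c * 2^-1 ^+ n) ->
  \forall w \ae mu, cvgn (fun n => ys n w).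
Proof.
move=> my yM hI.
have bys n : bm (ys n) by split=> //; exists M.
pose D n w : R := `|ys n.+1 w - ys n w|.
have bD n : bm (D n) by apply: bm_norm; apply: bmB.
have fin : (\int[mu]_w (\sum_(0 <= n <oo) (D n w)%:E) < +oo)%E.
  rewrite integral_nneseries//; last 2 first.
  - by move=> n; apply/measurable_EFinP; case: (bD n).
  - by move=> n w _; rewrite lee_fin normr_ge0.
  apply: (@le_lt_trans _ _ (\sum_(0 <= n <oo) (c * 2^-1 ^+ n)%:E)%E).
    apply: lee_nneseries => [n _ _|n _]; last first.
      by have := hI n; rewrite -lee_fin (bm_integralE mu (D n) (bD n)).
    by apply: integral_ge0 => w _; rewrite lee_fin normr_ge0.
  apply: (@le_lt_trans _ _ (c / (1 - 2^-1))%:E); last exact: ltry.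
  have := @cvg_geometric_series R c 2^-1.
  rewrite ger0_norm ?invf_lt1 ?ltr1n// ?invr_ge0// => /(_ isT) h.
  rewrite [leLHS](_ : _ = (c / (1 - 2^-1))%:E)//.
  apply/cvg_lim => //; apply/fine_cvgP; split.
    by apply: nearW => n; rewrite sumEFin.
  by apply: cvg_trans h; apply: near_eq_cvg; apply: nearW => n /=; rewrite sumEFin.
have mS : measurable_fun [set: O] (fun w => (\sum_(0 <= n <oo) (D n w)%:E)%E).
  apply: ge0_emeasurable_sum => [n w _ _|n _]; first by rewrite lee_fin normr_ge0.
  by apply/measurable_EFinP; case: (bD n).
have Sint : mu.-integrable [set: O] (fun w => (\sum_(0 <= n <oo) (D n w)%:E)%E).
  apply/integrableP; split => //; apply: le_lt_trans fin.
  apply: ge0_le_integral => //.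
  - exact: measurableT_comp.
  - by move=> w _; rewrite gee0_abs//; apply: nneseries_ge0 => n _ _; rewrite lee_fin normr_ge0.
have := integrable_ae measurableT Sint; apply: filterS => w /(_ Logic.I).
rewrite fin_numElt => /andP[_ h].
have : cvgn [normed series (telescope (ys^~ w))].
  by apply: nnseries_is_cvg => // n; exact: normr_ge0.
move=> /normed_cvg; rewrite telescopeK => /cvg_ex [l hl].
apply/cvg_ex; exists (l + ys 0%N w).
rewrite [X in X @ _ --> _](_ : _ = (fun n => (ys n w - ys 0%N w) + ys 0%N w)).
  by apply: cvgD => //; exact: cvg_cst.
by apply/funext => n; rewrite subrK.
Qed.

(** By the parallelogram identity, functions in [K j] that nearly minimise the
    square norm are close to each other in L2, once the minimal square norm of [K j] is
    close to its limit.  A fast subsequence converges almost surely; the bound [M]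
    keeps the minimal norms bounded. *)
Lemma decreasing_convex_selection (K : nat -> set (O -> R)) (M : R) :
  (forall j, K j.+1 `<=` K j) ->
  (forall j y, K j y -> measurable_fun [set: O] y /\ forall w, `|y w| <= M) ->
  (forall j y z, K j y -> K j z -> K j (fun w => (y w + z w) / 2)) ->
  (forall j, K j !=set0) ->
  exists ys : nat -> O -> R, (forall j, K j (ys j)) /\
    \forall w \ae mu, cvgn (fun n => ys n w).
Proof.
move=> Kdec Kb Kmid Kne.
have Kle i j : (i <= j)%N -> K j `<=` K i.
  move=> /subnKC <-; elim: (j - i)%N => [|n IH]; first by rewrite addn0.
  by rewrite addnS; apply: subset_trans IH; exact: Kdec.
have Kbm j y : K j y -> bm y by move=> /Kb [my yM]; split => //; exists M.
pose N2 (y : O -> R) := I (fun w => y w * y w).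
pose E j := [set N2 y | y in K j].
have Ene j : E j !=set0 by have [y Ky] := Kne j; exists (N2 y), y.
have Elb j : has_lbound (E j).
  by exists 0 => _ [y Ky <-]; apply: bm_integral_ge0 => w; rewrite -expr2 sqr_ge0.
pose al j := inf (E j).
have alle j y : K j y -> al j <= N2 y by move=> Ky; apply: ge_inf => //; exists y.
pose B := M * M * fine (mu [set: O]).
have alB j : al j <= B.
  have [y Ky] := Kne j; apply: le_trans (alle _ _ Ky) _.
  rewrite /B -(bm_integral_cst mu); apply: le_bm_integral.
  - by apply: bmM; exact: Kbm Ky.
  - exact: bm_cst.
  - move=> w; have [_ /(_ w) h] := Kb _ _ Ky.
    by apply: le_trans (ler_norm _) _; rewrite normrM ler_pM.
have alhub : has_ubound (range al) by exists B => _ [j _ <-].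
pose a := sup (range al).
have ala j : al j <= a by apply: ub_le_sup => //; exists j.
(* Square distances will be at most [8 * de k], that is [4^-k], hence distances at most
   [2^-k], which is summable. *)
pose de k : R := 8^-1 * (4^-1) ^+ k.
have de0 k : 0 < de k by rewrite mulr_gt0// ?exprn_gt0// invr_gt0.
have /choice [m0 hm0] : forall k, exists j, a - de k < al j.
  move=> k; have [|_ [j _ <-] h] := @sup_adherent _ (range al) (de k) (de0 k).
    by split=> //; exists (al 0%N), 0%N.
  by exists j.
have al_nd i j : (i <= j)%N -> al i <= al j.
  move=> ij; apply: lb_le_inf => // _ [y Ky <-]; apply: alle; exact: Kle Ky.
(* Past [m k] the minimal square norm is within [de k] of its limit; the sum makes
   [m] nondecreasing, and [k] makes [ys k] an element of [K k]. *)
pose m k := (\sum_(i < k.+1) m0 i + k)%N.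
have m_nd k : (m k <= m k.+1)%N.
  rewrite /m [in leqRHS]big_ord_recr /= -addnA leq_add2l.
  exact: leq_trans (leqnSn k) (leq_addl _ _).
have hm k : a - de k <= al (m k).
  apply: le_trans (ltW (hm0 k)) _; apply: al_nd.
  by rewrite /m big_ord_recr /= -addnA addnCA leq_addr.
have /choice [ys hys] : forall k, exists y, K (m k) y /\ N2 y <= al (m k) + de k.
  move=> k; have [|_ [y Ky <-] h] := @inf_adherent _ (E (m k)) (de k) (de0 k).
    by split.
  by exists y; split => //; exact: ltW.
exists ys; split; first by move=> k; apply: (Kle k (m k)); [exact: leq_addl|case: (hys k)].
apply: (@ae_cvg_of_summable ys M (fine (mu [set: O]) + 1)).
- by move=> n; have [/Kb []] := hys n.
- by move=> n w; have [/Kb [_ ]] := hys n.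
move=> k.
set y := ys k; set z := ys k.+1.
have [Ky hy] := hys k; have [Kz' hz] := hys k.+1.
have Kz := Kle _ _ (m_nd k) _ Kz'.
have := alle _ _ (Kmid _ _ _ Ky Kz).
have by_ := Kbm _ _ Ky; have bz := Kbm _ _ Kz.
have byy := bmM _ _ by_ by_; have bzz := bmM _ _ bz bz.
have bd := bmB _ _ bz by_; have bdd := bmM _ _ bd bd.
have -> : N2 (fun w => (y w + z w) / 2) = 2^-1 * N2 y + 2^-1 * N2 z - 4^-1 * N2 (fun w => z w - y w).
  rewrite /N2 -!bm_integralZ// -bm_integralD//; [|exact: bmZ|exact: bmZ].
  rewrite -bm_integralB//; [|by apply: bmD; exact: bmZ|exact: bmZ].
  by apply: eq_Rintegral => w _; field.
move=> mid.
have d2 : N2 (fun w => z w - y w) <= (4^-1) ^+ k.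
  have := hm k; have := ala (m k.+1); have := ala (m k).
  have : de k.+1 <= de k by rewrite /de exprS mulrCA ler_piMl ?(ltW (de0 k))// invf_le1// ler1n.
  have : 8 * de k = 4^-1 ^+ k by rewrite /de mulrA mulfV ?mul1r// pnatr_eq0.
  by move: mid hy hz; rewrite -/y -/z; lra.
have -> : (fine (mu [set: O]) + 1) * 2^-1 ^+ k =
    2^-1 ^+ k * fine (mu [set: O]) + 2 ^+ k * (4^-1) ^+ k.
  rewrite mulrDl mul1r mulrC; congr (_ + _).
  by rewrite -exprMn; congr (_ ^+ _); field.
apply: (@le_trans _ _ (2^-1 ^+ k * fine (mu [set: O]) + 2 ^+ k * N2 (fun w => z w - y w))); last first.
  by rewrite lerD2l ler_pM2l// exprn_gt0.
rewrite -(bm_integral_cst mu) -bm_integralZ// -bm_integralD//; [|exact: bm_cst|exact: bmZ].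
apply: le_bm_integral.
- exact: bm_norm.
- by apply: bmD; [exact: bm_cst|exact: bmZ].
move=> w; set t := z w - y w.
have p0 : 0 < 2 ^+ k :> R by rewrite exprn_gt0.
rewrite exprVn -(ler_pM2l p0) mulrDr mulfV ?gt_eqF// mulrA.
have -> : 2 ^+ k * (2 ^+ k * t * t) = (2 ^+ k * `|t|) ^+ 2.
  by rewrite exprMn real_normK ?num_real// !expr2; ring.
by have := sqr_ge0 (2 ^+ k * `|t| - 1); have := mulr_ge0 (ltW p0) (normr_ge0 t); nra.
Qed.

End functional.

(** * Separation from a cone by a functional small on small sets *)

Section bmfun.
Context {d : measure_display} {O : measurableType d} {R : realType}.

Definition bm_pred : {pred O -> R} := [pred f | `[< bm f >]].

Lemma bm_submod_closed : submod_closed bm_pred.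
Proof.
split; first by rewrite inE; exact: (@bm_cst _ _ _ 0).
move=> c f g /[!inE] bf bg; exact: (bmD _ _ (bmZ c f bf) bg).
Qed.

HB.instance Definition _ := GRing.isSubmodClosed.Build R (O -> R) bm_pred
  bm_submod_closed.

Record bmfun := BM { bmval :> O -> R ; bmvalP : bmval \in bm_pred }.
HB.instance Definition _ := [isSub for bmval].
HB.instance Definition _ := [Choice of bmfun by <:].
HB.instance Definition _ := [SubChoice_isSubLmodule of bmfun by <:].

Lemma bmfunP (f : bmfun) : bm f.
Proof. by case: f => f hf /=; have := hf; rewrite inE. Qed.

Definition mkbm f (bf : bm f) : bmfun := @BM f (introT (asboolP _) bf).

End bmfun.
Arguments bmfun {d} O R.

Section penalty.
Context {R : realType}.
Implicit Types (p : R -> R).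

(** Written with the norm, from which it inherits convexity and continuity. *)
Definition positive_part (r : R) : R := (`|r| + r) / 2.

Lemma positive_part_ge0 r : 0 <= positive_part r.
Proof. by rewrite /positive_part; have := ler_norm (- r); rewrite normrN; lra. Qed.

Lemma positive_part_eq0 r : r <= 0 -> positive_part r = 0.
Proof. by move=> r0; rewrite /positive_part ler0_norm// addNr mul0r. Qed.

Lemma positive_part_le r s : r <= s -> positive_part r <= positive_part s.
Proof.
move=> rs; rewrite /positive_part.
have := ler_norm s; have := ler_norm (- s); rewrite normrN.
by case: (ger0P r); case: (ger0P s); lra.
Qed.

Lemma positive_part_convex (a b t : R) : 0 <= t <= 1 ->
  positive_part (t * a + (1 - t) * b) <= t * positive_part a + (1 - t) * positive_part b.
Proof.
move=> /andP[t0 t1]; rewrite /positive_part.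
have := ler_normD (t * a) ((1 - t) * b).
rewrite !normrM (ger0_norm t0) [`|1 - t|]ger0_norm ?subr_ge0//.
rewrite -subr_ge0 => h; rewrite -subr_ge0; apply: le_trans (mulr_ge0 h (_ : 0 <= 2^-1)) _; first lra.
by rewrite le_eqVlt; apply/orP; left; apply/eqP; field.
Qed.

Lemma positive_part_continuous (c : R) : continuous (fun r : R => positive_part (r - c)).
Proof.
move=> x; rewrite /positive_part; apply: cvgM; last exact: cvg_cst.
by apply: cvgD; [apply: cvg_norm|]; apply: cvgB => //; exact: cvg_cst.
Qed.

(** These functions [p] measure the size of [y] by the integral of [p `|y|], as in
    an Orlicz space. *)
Definition penalty p : Prop := [/\ continuous p, p 0 = 0,
  {homo p : x y / x <= y} &
  forall (a b t : R), 0 <= t <= 1 -> p (t * a + (1 - t) * b) <= t * p a + (1 - t) * p b].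

Lemma penalty_step p (j m : nat) : penalty p ->
  penalty (fun r => p r + j%:R * positive_part (r - m%:R)).
Proof.
move=> [pc p0 pm pv]; split.
- move=> x; apply: cvgD; first exact: pc.
  by apply: cvgM; [exact: cvg_cst|exact: positive_part_continuous].
- by rewrite p0 positive_part_eq0 ?mulr0 ?addr0// sub0r oppr_le0.
- by move=> x y xy; rewrite lerD ?pm// ler_wpM2l// positive_part_le// lerB.
- move=> a b t t01; have h1 := pv a b t t01.
  have h2 := positive_part_convex (a - m%:R) (b - m%:R) t t01.
  have -> : t * a + (1 - t) * b - m%:R = t * (a - m%:R) + (1 - t) * (b - m%:R) by ring.
  have := ler_wpM2l (ler0n R j) h2.
  rewrite -subr_ge0 => h3; move: h1; rewrite -subr_ge0 => h1; rewrite -subr_ge0.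
  by apply: le_trans (addr_ge0 h1 h3) _; rewrite le_eqVlt; apply/orP; left; apply/eqP; ring.
Qed.

Lemma penalty_positive_part (m : nat) : penalty (fun r : R => positive_part (r - m%:R)).
Proof.
rewrite (_ : (fun _ => _) = fun r : R => 0 + 1%:R * positive_part (r - m%:R)).
  apply: (@penalty_step (fun=> 0)); split => //; first by move=> x; exact: cvg_cst.
  by move=> a b t _; rewrite !mulr0 addr0.
by apply/funext => r; rewrite add0r mul1r.
Qed.

End penalty.

Section separation.
Context {d : measure_display} {O : measurableType d} {R : realType}.
Variable mu : {finite_measure set O -> \bar R}.
Local Notation I := (Rintegral mu [set: O]).
Local Notation bm := (@bm d O R).

Lemma bm_penalty (p : R -> R) (y : O -> R) : penalty p -> bm y ->
  bm (fun w => p `|y w|).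
Proof.
move=> [pc p0 pm _] [my [M yM]]; split.
  apply: (measurableT_comp (continuous_measurable_fun _)) => //.
  exact: measurableT_comp.
exists (p M) => w; rewrite ger0_norm ?pm//.
by rewrite -p0 pm.
Qed.

Variables (u : (O -> R) -> R) (x0 : O -> R).
Hypothesis uD : forall f g, bm f -> bm g -> u f + u g <= u (fun w => f w + g w).
Hypothesis uZ : forall (c : R) f, 0 <= c -> bm f -> u (fun w => c * f w) = c * u f.
Hypothesis u_le : forall f g, bm f -> bm g ->
  (\forall w \ae mu, f w <= g w) -> u f <= u g.
Hypothesis u_cont : forall (zs : nat -> O -> R) (z : O -> R) (M : R),
  (forall n, measurable_fun [set: O] (zs n)) -> bm z ->
  (forall n w, `|zs n w| <= M) -> (forall n w, zs n.+1 w <= zs n w) ->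
  (forall w, zs n w @[n --> \oo] --> z w) ->
  u (zs n) @[n --> \oo] --> u z.
Hypothesis bx0 : bm x0.
Hypothesis ux0 : u x0 < 0.

(** The function [f] is the limit of the running suprema of the sequence, on which
    [u] is nonnegative by monotonicity. *)
Lemma fatou_closed (fs : nat -> O -> R) (f : O -> R) (M : R) :
  (forall n, measurable_fun [set: O] (fs n)) -> bm f ->
  (forall n w, `|fs n w| <= M) ->
  (\forall w \ae mu, fs n w @[n --> \oo] --> f w) ->
  (forall n, 0 <= u (fs n)) -> 0 <= u f.
Proof.
move=> mfs bf fM cv ufs.
have [z [zs [[mz zM] hzs zdec zcv zl]]] := cvg_limn_sup_ae fs M mfs fM.
have bz : bm z by split => //; exists M.
have : 0 <= u z.
  have h : u (zs n) @[n --> \oo] --> u z.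
    apply: (u_cont _ _ M) => //.
    - by move=> n; case: (hzs n).
    - by move=> n w; case: (hzs n) => _ ->.
    - by move=> n w; case: (zdec n w).
  apply: cvg_ge h => n; apply: le_trans (ufs n) _.
  apply: u_le; [by split=> //; exists M| |by apply: aeW => w; case: (zdec n w)].
  by have [mzn zMn] := hzs n; split => //; exists M.
move=> h; apply: le_trans h _; apply: u_le => //.
by apply: filterS cv => w /zl ->.
Qed.

(** The configuration that a penalty has to exclude up to level [n]: a perturbation
    of penalty at most one that moves [x0] into the cone where [u] is nonnegative. *)
Definition reaches (n : nat) (p : R -> R) (y : O -> R) : Prop :=
  [/\ measurable_fun [set: O] y, forall w, `|y w| <= n%:R,
      0 <= u (fun w => x0 w - y w) & I (fun w => p `|y w|) <= 1].

(** If no slope [j] beyond [n] were steep enough, the sets of counterexamples for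
    the slopes [j] would be convex and decreasing, and some selection from them
    would converge almost surely.  The steeper the slope, the less mass lies above
    [n], so the limit is bounded by [n] and reaches the cone with penalty [p]. *)
Lemma penalty_extend (n : nat) (p : R -> R) : penalty p ->
  (forall y, ~ reaches n p y) ->
  exists j : nat, forall y, ~ reaches n.+1 (fun r => p r + j%:R * positive_part (r - n%:R)) y.
Proof.
move=> pp noreach; apply: contrapT => /forallNP h.
pose pj (j : nat) r := p r + j%:R * positive_part (r - n%:R).
have ppj j : penalty (pj j) by exact: penalty_step.
pose K j : set (O -> R) := reaches n.+1 (pj j).
have Kbm j y : K j y -> bm y by move=> [my yM _ _]; split => //; exists n.+1%:R.
have [||||ys [Kys cvys]] := @decreasing_convex_selection _ _ _ mu K n.+1%:R.
- move=> j y Ky; have by_ := Kbm _ _ Ky; case: Ky => my yM uy Iy; split => //.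
  apply: le_trans Iy; apply: le_bm_integral; [exact: bm_penalty|exact: bm_penalty|].
  by move=> w; rewrite /pj lerD2l ler_wpM2r ?positive_part_ge0// ler_nat.
- by move=> j y [].
- move=> j y z Ky Kz; have by_ := Kbm _ _ Ky; have bz := Kbm _ _ Kz.
  case: Ky => my yM uy Iy; case: Kz => mz zM uz Iz.
  have bh : bm (fun w => (y w + z w) / 2).
    rewrite (_ : (fun w => _) = fun w => 2^-1 * (y w + z w)).
      by apply: bmZ; exact: bmD.
    by apply/funext => w; rewrite mulrC.
  split.
  + by case: bh.
  + move=> w; rewrite normrM [`|2^-1|]ger0_norm ?invr_ge0//.
    rewrite ler_pdivrMr//; apply: le_trans (ler_normD _ _) _.
    by have := yM w; have := zM w; lra.
  + have -> : (fun w => x0 w - (y w + z w) / 2) =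
       fun w => 2^-1 * ((x0 w - y w) + (x0 w - z w)) by apply/funext => w; field.
    rewrite uZ ?invr_ge0//; last by apply: bmD; exact: bmB.
    rewrite mulr_ge0 ?invr_ge0//; apply: le_trans (uD _ _ _ _); last 2 first.
    * exact: bmB.
    * exact: bmB.
    * exact: addr_ge0.
  + have [_ _ pm pv] := ppj j.
    have b1 := bm_penalty _ _ (ppj j) by_; have b2 := bm_penalty _ _ (ppj j) bz.
    have : I (fun w => pj j `|(y w + z w) / 2|) <=
           I (fun w => 2^-1 * (pj j `|y w| + pj j `|z w|)).
      apply: le_bm_integral; first exact: bm_penalty.
        by apply: bmZ; exact: bmD.
      move=> w; have hh : (0 <= (2^-1 : R) <= 1)%R by lra.
      have := pv `|y w| `|z w| 2^-1 hh.
      have -> : 1 - 2^-1 = 2^-1 :> R by field.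
      rewrite -!mulrDr; apply: le_trans; apply: pm.
      rewrite normrM [`|2^-1|]ger0_norm ?invr_ge0// mulrC ler_pM2l ?invr_gt0//.
      exact: ler_normD.
    rewrite bm_integralZ; last exact: bmD.
    by rewrite bm_integralD//; lra.
- by move=> j; have /existsNP [y /contrapT hy] := h j; exists y.
have mys j : measurable_fun [set: O] (ys j) by case: (Kys j).
have ysM j w : `|ys j w| <= n.+1%:R by case: (Kys j).
have [y [_ [[my yM] _ _ _ yl]]] := cvg_limn_sup_ae ys _ mys ysM.
have by_ : bm y by split => //; exists n.+1%:R.
have bys j : bm (ys j) by split => //; exists n.+1%:R.
have {}cvys : \forall w \ae mu, ys j w @[j --> \oo] --> y w.
  by apply: filterS cvys => w /cvg_ex [l hl]; rewrite (yl _ _ hl).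
have uy : 0 <= u (fun w => x0 w - y w).
  have [mx0 [M0 hM0]] := bx0.
  apply: (fatou_closed (fun j w => x0 w - ys j w) _ (M0 + n.+1%:R)).
  - by move=> j; exact: measurable_funB.
  - exact: bmB.
  - by move=> j w; apply: le_trans (ler_normB _ _) _; exact: lerD.
  - by apply: filterS cvys => w hw; apply: cvgB => //; exact: cvg_cst.
  - by move=> j; case: (Kys j).
have [pc p0 pm pv] := pp.
have Ip : I (fun w => p `|y w|) <= 1.
  have cvI : I (fun w => p `|ys j w|) @[j --> \oo] --> I (fun w => p `|y w|).
    apply: (@bm_bounded_convergence _ _ _ mu _ _ (p n.+1%:R)).
    - by move=> j; case: (bm_penalty _ _ pp (bys j)).
    - exact: bm_penalty.
    - by move=> j w; rewrite ger0_norm ?pm// -p0 pm.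
    - apply: filterS cvys => w hw; apply: continuous_cvg; first exact: pc.
      exact: cvg_norm.
  apply: cvg_le cvI => j; have [_ _ _ hI] := Kys j; apply: le_trans hI.
  apply: le_bm_integral; [exact: bm_penalty|exact: bm_penalty|].
  by move=> w; rewrite /pj lerDl mulr_ge0// positive_part_ge0.
pose g w := positive_part (`|y w| - n%:R).
have pg := @penalty_positive_part R n.
have bg : bm g by exact: (bm_penalty _ _ pg by_).
(* The penalty bound gives [j * I (positive_part (`|ys j| - n)) <= 1]. *)
have Ig0 : I g <= 0.
  have cvI : I (fun w => positive_part (`|ys j w| - n%:R)) @[j --> \oo] --> I g.
    apply: (@bm_bounded_convergence _ _ _ mu _ _ (positive_part (n.+1%:R - n%:R))).
    - by move=> j; case: (bm_penalty _ _ pg (bys j)).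
    - exact: bg.
    - by move=> j w; rewrite ger0_norm ?positive_part_ge0// positive_part_le// lerB.
    - apply: filterS cvys => w hw.
      have pcs := @positive_part_continuous R n%:R; move: pcs; rewrite /g.
      set ps := fun r : R => positive_part (r - n%:R) => pcs.
      rewrite -[X in _ --> X]/(ps `|y w|).
      rewrite -[X in X @ _ --> _]/(fun j => ps `|ys j w|).
      by apply: continuous_cvg; [exact: pcs|exact: cvg_norm].
  have h0 : (2 * j.+1%:R^-1 : R) @[j --> \oo] --> (2 * 0 : R).
    by apply: cvgM; [exact: cvg_cst|exact: cvg_harmonic].
  rewrite mulr0 in h0.
  rewrite -(cvg_lim _ cvI)// -(cvg_lim _ h0)//; apply: ler_lim.
  - by apply/cvg_ex; eexists; exact: cvI.
  - by apply/cvg_ex; eexists; exact: h0.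
  near=> j.
  have jj : 1 <= j%:R :> R by rewrite ler1n; near: j; exists 1%N.
  have [_ _ _ hI] := Kys j.
  have bgj : bm (fun w => positive_part (`|ys j w| - n%:R)) by exact: (bm_penalty _ _ pg (bys j)).
  have : j%:R * I (fun w => positive_part (`|ys j w| - n%:R)) <= 1.
    rewrite -bm_integralZ//; apply: le_trans hI; apply: le_bm_integral.
    - exact: bmZ.
    - exact: bm_penalty.
    - by move=> w; rewrite /pj lerDr -p0 pm.
  have i0 : 0 <= I (fun w => positive_part (`|ys j w| - n%:R)).
    by apply: bm_integral_ge0 => w; exact: positive_part_ge0.
  have j10 : 0 < j.+1%:R :> R by rewrite ltr0n.
  rewrite ler_pdivlMr// -natr1 mulrC.
  by have := ler_wpM2r i0 jj; lra.
have gae : \forall w \ae mu, g w = 0.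
  by apply: ae_eq0_of_Rintegral => //; [exact: bm_integrable|move=> w; exact: positive_part_ge0].
(* The limit is at most [n] almost everywhere only, while [reaches] asks for it everywhere. *)
pose y' w := Num.max (- n%:R) (Num.min n%:R (y w)).
have by' : bm y' by apply: bm_max; [exact: bm_cst|apply: bm_min => //; exact: bm_cst].
apply: (noreach y'); split.
- by case: by'.
- move=> w; rewrite /y' ler_norml le_max lexx /= ge_max ge_min lexx /= andbT.
  by apply: le_trans (ler0n _ _); rewrite oppr_le0.
- apply: le_trans uy _; apply: u_le; [exact: bmB|exact: bmB|].
  apply: filterS gae => w gw.
  have : `|y w| <= n%:R.
    rewrite leNgt; apply/negP => lt; move: gw; rewrite /g /positive_part gtr0_norm ?subr_gt0//.
    by move: lt; lra.
  by rewrite ler_norml /y' => /andP[y1 y2]; rewrite min_r// max_r.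
- apply: le_trans Ip; apply: le_bm_integral; [exact: bm_penalty|exact: bm_penalty|].
  move=> w; apply: pm; rewrite /y'.
  case: (lerP n%:R (y w)) => y1.
    rewrite max_r; last by apply: le_trans (ler0n _ _); rewrite oppr_le0.
    by rewrite normr_nat (le_trans y1)// ler_norm.
  case: (lerP (- n%:R) (y w)) => y2 //.
  by rewrite normrN normr_nat -normrN (le_trans _ (ler_norm _))//; move: y2; lra.
Unshelve. all: by end_near. Qed.

(** A Young function truncated at level [n].  At each level the slope is one of
    those given by [penalty_extend]; it acts above [m] only, so that the values
    below stabilise ([young_stable]). *)
Fixpoint young (n : nat) : R -> R :=
  if n is m.+1 then
    fun r => young m r + (xget 0%N [set j : nat | forall y,
      ~ reaches n (fun r => young m r + j%:R * positive_part (r - m%:R)) y])%:R * positive_part (r - m%:R)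
  else fun=> 0.

Lemma youngP n : penalty (young n) /\ forall y, ~ reaches n (young n) y.
Proof.
elim: n => [|n [IH1 IH2]].
  split.
    split => //; first by move=> x; exact: cvg_cst.
    by move=> a b t _; rewrite !mulr0 addr0.
  move=> y [my y0 uy _]; move: uy; apply/negP; rewrite -ltNge.
  by rewrite (_ : (fun _ => _) = x0)//; apply/funext => w; have := y0 w; rewrite normr_le0 => /eqP ->; rewrite subr0.
rewrite /=; case: xgetP => [j _ hj|hN].
  by split => //; exact: penalty_step.
by have [j hj] := penalty_extend n _ IH1 IH2; have := hN j.
Qed.

Lemma young_le n m r : (n <= m)%N -> young n r <= young m r.
Proof.
move=> /subnKC <-; elim: (m - n)%N => [|k IH]; first by rewrite addn0.
by rewrite addnS /=; apply: le_trans IH _; rewrite lerDl mulr_ge0// positive_part_ge0.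
Qed.

Lemma young_stable n m r : r <= n%:R -> (n <= m)%N -> young m r = young n r.
Proof.
move=> rn /subnKC <-; elim: (m - n)%N => [|k IH]; first by rewrite addn0.
rewrite addnS /= IH positive_part_eq0 ?mulr0 ?addr0// subr_le0 (le_trans rn)// ler_nat.
exact: leq_addr.
Qed.

(** The unit ball for the limit of the functions [young n].  A bounded function
    meets finitely many levels only. *)
Definition young_ball (y : O -> R) : Prop :=
  bm y /\ forall n, I (fun w => young n `|y w|) <= 1.

Lemma young_ball_avoids y : young_ball y -> u (fun w => x0 w - y w) < 0.
Proof.
move=> [[my [M yM]] Iy]; rewrite ltNge; apply/negP => uy.
pose n := (Num.trunc M).+1.
have [_ /(_ y)] := youngP n; apply; split => // w.
by apply: le_trans (yM w) _; apply: ltW; exact: truncnS_gt.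
Qed.

Lemma young_ball_convex y z (t : R) : 0 <= t <= 1 -> young_ball y -> young_ball z ->
  young_ball (fun w => t * y w + (1 - t) * z w).
Proof.
move=> /[dup] t01 /andP[t0 t1] [by_ Iy] [bz Iz].
have bh : bm (fun w => t * y w + (1 - t) * z w) by apply: bmD; exact: bmZ.
split => // n; have [pp _] := youngP n; have [_ _ pm pv] := pp.
have b1 := bm_penalty _ _ pp by_; have b2 := bm_penalty _ _ pp bz.
have : I (fun w => young n `|t * y w + (1 - t) * z w|) <=
    I (fun w => t * young n `|y w| + (1 - t) * young n `|z w|).
  apply: le_bm_integral; first exact: bm_penalty.
    by apply: bmD; exact: bmZ.
  move=> w; apply: le_trans (pv _ _ _ t01); apply: pm.
  apply: le_trans (ler_normD _ _) _.
  by rewrite !normrM (ger0_norm t0) [`|1 - t|]ger0_norm ?subr_ge0.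
rewrite bm_integralD; [|exact: bmZ|exact: bmZ].
rewrite !bm_integralZ//; have := Iy n; have := Iz n; move: t0 t1; nra.
Qed.

Lemma young_ball0 : young_ball (fun=> 0).
Proof.
split; first exact: bm_cst.
move=> n; have [[_ p0 _ _] _] := youngP n.
under eq_Rintegral do rewrite normr0 p0.
by rewrite bm_integral_cst mul0r.
Qed.

Lemma young_ball_shrink y (t : R) : 0 <= t <= 1 -> young_ball y -> young_ball (fun w => t * y w).
Proof.
move=> t01 by_; have := young_ball_convex _ _ _ t01 by_ young_ball0.
by under eq_fun do rewrite mulr0 addr0.
Qed.

(** On a small set the ball contains a constant as large as desired: this will
    force a functional that is bounded below on the ball to be small on small sets. *)
Lemma young_ball_small_indic (K : nat) : exists2 e : R, 0 < e &
  forall A, measurable A -> (mu A <= e%:E)%E -> young_ball (fun w => - K%:R * \1_A w).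
Proof.
have [[_ p0 pm _] _] := youngP K.
have P0 : 0 <= young K K%:R by rewrite -p0 pm.
exists ((young K K%:R + 1)^-1); first by rewrite invr_gt0; lra.
move=> A mA hA; split; first by apply: bmZ; exact: bm_indic.
move=> n.
have le1 w : young n `|- K%:R * \1_A w| <= young K K%:R * \1_A w.
  rewrite indicE; case: (w \in A); rewrite ?mulr1 ?mulr0.
    rewrite normrN normr_nat; have [nK|/ltnW Kn] := leqP n K.
      exact: young_le.
    by rewrite (@young_stable K n).
  by rewrite normr0; have [[_ -> _ _] _] := youngP n.
apply: (@le_trans _ _ (I (fun w => young K K%:R * \1_A w))).
  apply: le_bm_integral => //.
  - by apply: bm_penalty; [case: (youngP n)|apply: bmZ; exact: bm_indic].
  - by apply: bmZ; exact: bm_indic.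
rewrite bm_integralZ; last exact: bm_indic.
have Afin : mu A \is a fin_num by exact: fin_num_measure.
have -> : I \1_A = fine (mu A).
  by rewrite /Rintegral integral_indic// setIT.
have : fine (mu A) <= (young K K%:R + 1)^-1 by rewrite -lee_fin fineK.
move=> /(ler_wpM2l P0) /le_trans; apply.
by rewrite ler_pdivrMr ?mul1r; lra.
Qed.

Local Notation V := (bmfun O R).
Local Notation e0 := (- u x0).

Let uE f g : (forall w, f w = g w) -> u f = u g.
Proof. by move=> fg; congr u; exact/funext. Qed.

Let u0 : u (fun=> 0) = 0.
Proof.
by have := uZ 0 (fun=> 0) (lexx _) (@bm_cst _ _ _ 0); rewrite !mul0r.
Qed.

(** Concavity on the segment from [x0] to [x0 - l * y]: were the value at its end
    too large, [u] would be nonnegative at an intermediate point, and this point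
    belongs to [x0] minus the ball. *)
Lemma u_sub_young_ball (l : R) y : 0 <= l -> young_ball y ->
  u (fun w => x0 w - l * y w) <= e0 * l.
Proof.
move=> l0 by_; rewrite leNgt; apply/negP; set r := u (fun w => x0 w - l * y w) => hr.
have e00 : 0 < e0 by rewrite oppr_gt0.
have r0 : 0 < r by apply: le_lt_trans hr; rewrite mulr_ge0// ltW.
have er : 0 < e0 + r by exact: addr_gt0.
pose t := e0 / (e0 + r).
have t0 : 0 < t by exact: divr_gt0.
have t1 : t <= 1 by rewrite ler_pdivrMr// mul1r lerDl ltW.
have bally : young_ball (fun w => (t * l) * y w).
  apply: young_ball_shrink => //; rewrite (mulr_ge0 (ltW t0) l0)/=.
  by rewrite /t mulrAC ler_pdivrMr// mul1r ltW// (lt_le_trans hr)// lerDr ltW.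
have := young_ball_avoids _ bally; apply/negP; rewrite -leNgt.
have b1 : bm (fun w => x0 w - l * y w) by apply: bmB => //; apply: bmZ; case: by_.
have -> : u (fun w => x0 w - t * l * y w) =
    u (fun w => (1 - t) * x0 w + t * (x0 w - l * y w)) by apply: uE => w; ring.
apply: le_trans (uD _ _ (bmZ _ _ bx0) (bmZ _ _ b1)).
rewrite !uZ ?subr_ge0// ?(ltW t0)// -/r le_eqVlt; apply/orP; left; apply/eqP.
by rewrite /t; field; rewrite gt_eqF.
Qed.

Lemma u_cone_young_ball (s l : R) y : 0 <= s -> 0 <= l -> young_ball y ->
  u (fun w => s * x0 w - l * y w) <= e0 * l.
Proof.
move=> s0 l0 by_; have [by1 _] := by_.
have pcase s' : 0 < s' -> u (fun w => s' * x0 w - l * y w) <= e0 * l.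
  move=> sp.
  have -> : u (fun w => s' * x0 w - l * y w) = u (fun w => s' * (x0 w - (l / s') * y w)).
    by apply: uE => w; field; rewrite gt_eqF.
  rewrite uZ ?(ltW sp)//; last by apply: bmB => //; exact: bmZ.
  have := u_sub_young_ball (l / s') y (divr_ge0 l0 (ltW sp)) by_.
  move=> /(ler_wpM2l (ltW sp)) /le_trans; apply.
  by rewrite mulrC -mulrA divfK ?gt_eqF.
have [/pcase//|sp0] := ltP 0 s.
(* The case [s = 0] is a limit case: add a small multiple of [x0]. *)
have -> : s = 0 by apply/eqP; rewrite eq_le sp0 s0.
apply/ler_addgt0Pr => e ep.
have e00 : 0 < e0 by rewrite oppr_gt0.
have eep : 0 < e / e0 by exact: divr_gt0.
have := pcase _ eep.
have h := uD (fun w => (e / e0) * x0 w) (fun w => 0 * x0 w - l * y w) (bmZ _ _ bx0) _.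
have -> : u (fun w => e / e0 * x0 w - l * y w) =
   u (fun w => e / e0 * x0 w + (0 * x0 w - l * y w)) by apply: uE => w; ring.
have /h : bm (fun w => 0 * x0 w - l * y w) by apply: bmB; exact: bmZ.
rewrite uZ ?(ltW eep)//.
have -> : e / e0 * u x0 = - e by field; rewrite lt_eqF.
lra.
Qed.

(** A linear majorant [f] of the supremum of these values dominates [u] (take
    [s = l = 0]), has [f x0 <= 0] (take [x = - x0] and [s = 1]) and is at least
    [u x0] on the ball (take [x = y] and [l = 1]).  The supremum is finite by
    [u_cone_young_ball]. *)
Definition cone_values (x : V) : set R := [set r | exists (s l : R) y,
  [/\ 0 <= s, 0 <= l, young_ball y & r = u (fun w => x w + s * x0 w - l * y w) - e0 * l]].

Definition cone_sup (x : V) : R := sup (cone_values x).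

Lemma bm_comb (x : V) (s l : R) y : young_ball y -> bm (fun w => x w + s * x0 w - l * y w).
Proof.
move=> [by_ _]; apply: bmB; last exact: bmZ.
by apply: bmD; [exact: bmfunP|exact: bmZ].
Qed.

Lemma cone_values_ub x : ubound (cone_values x) (- u (fun w => - x w)).
Proof.
move=> _ [s [l [y [s0 l0 by_ ->]]]].
have := u_cone_young_ball s l y s0 l0 by_.
have -> : u (fun w => s * x0 w - l * y w) =
   u (fun w => (x w + s * x0 w - l * y w) + (- x w)) by apply: uE => w; ring.
have := uD _ _ (bm_comb x s l y by_) (bmN _ (bmfunP x)); lra.
Qed.

Lemma cone_sup_ge (x : V) (s l : R) y : 0 <= s -> 0 <= l -> young_ball y ->
  u (fun w => x w + s * x0 w - l * y w) - e0 * l <= cone_sup x.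
Proof.
move=> s0 l0 by_; apply: ub_le_sup; first by eexists; exact: cone_values_ub.
by exists s, l, y.
Qed.

Lemma u_le_cone_sup (x : V) : u x <= cone_sup x.
Proof.
have := cone_sup_ge x 0 0 _ (lexx _) (lexx _) young_ball0.
by rewrite (uE _ x) => [|w]; [rewrite mulr0 subr0|ring].
Qed.

Lemma cone_values_neq0 x : cone_values x !=set0.
Proof. by eexists; exists 0, 0, (fun=> 0); split => //; exact: young_ball0. Qed.

Lemma cone_sup_superlinear : superlinear cone_sup.
Proof.
apply: superlinear_sup.
- by move=> z; eexists; exact: cone_values_ub.
- exists 0, 0, (fun=> 0); split => //; first exact: young_ball0.
  by rewrite (uE _ (fun=> 0)) ?u0 ?mulr0 ?subr0// => w; rewrite !mul0r subr0 addr0.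
- exact: cone_values_neq0.
- by move=> r /cone_values_ub; rewrite (uE _ (fun=> 0)) ?u0 ?oppr0// => w; rewrite oppr0.
- move=> a b _ _ [s [l [y [s0 l0 by_ ->]]]] [s' [l' [y' [s0' l0' by' ->]]]].
  (* The terms [l * y] and [l' * y'] merge by convexity of the ball. *)
  have [z bz hz] : exists2 z, young_ball z & forall w, (l + l') * z w = l * y w + l' * y' w.
    have [L0|L0] := eqVneq (l + l') 0.
      have [l00 l00'] : l = 0 /\ l' = 0 by lra.
      exists y => // w; rewrite l00 l00'; ring.
    have Lp : 0 < l + l' by rewrite lt_def L0 addr_ge0.
    exists (fun w => l / (l + l') * y w + (1 - l / (l + l')) * y' w).
      apply: young_ball_convex => //; apply/andP; split; first exact: divr_ge0 (ltW _).
      by rewrite ler_pdivrMr// mul1r lerDl.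
    by move=> w; field.
  eexists; first by exists (s + s'), (l + l'), z; split; rewrite ?addr_ge0.
  have := uD _ _ (bm_comb a s l y by_) (bm_comb b s' l' y' by').
  rewrite (uE (fun w => a w + s * x0 w - l * y w + (b w + s' * x0 w - l' * y' w))
    (fun w => (a + b) w + (s + s') * x0 w - (l + l') * z w)).
    by rewrite mulrDr; lra.
  by move=> w; rewrite hz; have -> : (a + b) w = a w + b w by []; ring.
- move=> c z _ c0 [s [l [y [s0 l0 by_ ->]]]].
  exists (c * s), (c * l), y; split; rewrite ?(mulr_ge0 (ltW c0))//.
  rewrite (uE (fun w => (c *: z) w + c * s * x0 w - c * l * y w)
    (fun w => c * (z w + s * x0 w - l * y w))).
    by rewrite uZ ?(ltW c0)//; [ring|exact: bm_comb].
  by move=> w /=; rewrite mulrBr mulrDr !mulrA.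
Qed.

Lemma linear_extension : exists f : (O -> R) -> R,
  [/\ forall x, bm x -> u x <= f x,
      forall x y, bm x -> bm y -> f (fun w => x w + y w) = f x + f y,
      forall c x, bm x -> f (fun w => c * x w) = c * f x,
      f x0 <= 0 &
      forall y, young_ball y -> - e0 <= f y].
Proof.
have [g [vg gD gZ]] := superlinear_dominated cone_sup cone_sup_superlinear.
pose f (x : O -> R) := if pselect (bm x) is left bx then g (mkbm x bx) else 0.
have fE x (bx : bm x) (z : V) : (forall w, x w = z w) -> f x = g z.
  rewrite /f; case: pselect => // bx' xz; congr g.
  by apply: val_inj; apply/funext => w /=; rewrite xz.
exists f; split.
- move=> x bx; rewrite (fE _ bx (mkbm x bx))//; apply: le_trans (vg _).
  exact: (u_le_cone_sup (mkbm x bx)).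
- move=> x y bx by_; rewrite (fE x bx (mkbm x bx))// (fE y by_ (mkbm y by_))// -gD.
  by apply: fE => //; exact: bmD.
- move=> c x bx; rewrite (fE x bx (mkbm x bx))// -gZ.
  by apply: fE => //; exact: bmZ.
- rewrite (fE x0 bx0 (mkbm x0 bx0))//.
  have : 0 <= g (- mkbm x0 bx0).
    apply: le_trans (vg _); have := cone_sup_ge (- mkbm x0 bx0) 1 0 _ ler01 (lexx _) young_ball0.
    rewrite (uE _ (fun=> 0)) ?u0 => [|w]; first by rewrite mulr0 subr0.
    by rewrite mul1r mul0r subr0; exact: addNr.
  by rewrite -scaleN1r gZ mulN1r oppr_ge0.
- move=> y by_; have [by1 _] := by_; rewrite (fE y by1 (mkbm y by1))//.
  apply: le_trans (vg _); have := cone_sup_ge (mkbm y by1) 0 1 _ (lexx _) ler01 by_.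
  rewrite (uE _ (fun=> 0)) ?u0 => [|w]; first by rewrite mulr1 sub0r.
  by rewrite mul0r mul1r addr0 subrr.
Qed.

End separation.

(** * Functionals given by integrable densities *)

Section layers.
Context {d : measure_display} {O : measurableType d} {R : realType}.
Local Notation bm := (@bm d O R).

Lemma sum_lt_indic (p m : nat) : (p <= m)%N ->
  \sum_(k < m) ((k < p)%N%:R : R) = p%:R.
Proof.
elim: m p => [|m IH] p; first by rewrite leqn0 => /eqP ->; rewrite big_ord0.
rewrite leq_eqVlt => /orP[/eqP ->|].
  rewrite big_ord_recr /= ltnSn -natr1 -[in RHS](IH m)//; congr (_ + _).
  by apply: eq_bigr => i _; rewrite ltn_ord ltnS ltnW.
by rewrite ltnS => pm; rewrite big_ord_recr /= ltnNge pm addr0 IH.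
Qed.

(** A nonnegative bounded function [y] is within [1 / n] of the sum of the
    indicators of the sets [k + 1 <= n * y], divided by [n]. *)
Lemma bounded_functional_eq0 (L : (O -> R) -> R) (C : R) :
  (forall x y, bm x -> bm y -> L (fun w => x w + y w) = L x + L y) ->
  (forall (c : R) x, bm x -> L (fun w => c * x w) = c * L x) ->
  (forall x (M : R), bm x -> (forall w, `|x w| <= M) -> `|L x| <= C * M) ->
  (forall A, measurable A -> L \1_A = 0) ->
  forall x, bm x -> L x = 0.
Proof.
move=> LD LZ LC LA.
have L0 : L (fun=> 0) = 0.
  by have := LZ 0 _ (@bm_cst _ O R 0); rewrite !mul0r.
have Lsum (s : seq nat) (F : nat -> set O) : (forall k, measurable (F k)) ->
    L (fun w => \sum_(k <- s) \1_(F k) w) = 0.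
  move=> mF; elim: s => [|k s IH].
    by rewrite (_ : (fun _ => _) = fun=> 0)//; apply/funext => w; rewrite big_nil.
  rewrite (_ : (fun _ => _) = fun w => \1_(F k) w + \sum_(j <- s) \1_(F j) w).
    rewrite LD ?LA ?IH ?addr0//; first exact: bm_indic.
    by apply: bm_sum => j; exact: bm_indic.
  by apply/funext => w; rewrite big_cons.
have Lpos y : bm y -> (forall w, 0 <= y w) -> L y = 0.
  move=> by_ y0; have [my [M yM]] := by_.
  apply/eqP; rewrite -normr_eq0 eq_le normr_ge0 andbT; apply/ler_addgt0Pr => e e0.
  rewrite add0r.
  (* The bound for [x = 1] shows that [C] is nonnegative. *)
  have C0 : 0 <= C.
    by have := LC _ 1 (@bm_cst _ O R 1) (fun _ => _); rewrite normr1 mulr1 => h; apply: le_trans (h _).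
  pose n := (Num.trunc (C / e)).+1.
  have n0 : 0 < n%:R :> R by rewrite ltr0n.
  have Cn : C * n%:R^-1 <= e.
    by rewrite ler_pdivrMr// mulrC -ler_pdivrMr// ltW// /n truncnS_gt.
  pose m := (Num.trunc (n%:R * M)).+1.
  pose F k := [set w | k.+1%:R <= n%:R * y w].
  have mF k : measurable (F k).
    have := @measurable_fun_le _ _ _ setT (fun=> k.+1%:R) (fun w => n%:R * y w) .
    rewrite /F => h; rewrite -[X in measurable X]setTI; apply: h => //.
    by apply: measurable_funM => //; exact: measurable_cst.
  pose z w : R := n%:R^-1 * \sum_(k <- iota 0 m) \1_(F k) w.
  have Fm : bm (fun w => \sum_(k <- iota 0 m) (\1_(F k) w : R)).
    by apply: bm_sum => k; exact: bm_indic.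
  have bz : bm z by exact: bmZ.
  have Lz : L z = 0 by rewrite LZ// Lsum// mulr0.
  have zE w : z w = n%:R^-1 * (Num.trunc (n%:R * y w))%:R.
    congr (_ * _); rewrite -[in RHS](@sum_lt_indic (Num.trunc (n%:R * y w)) m); last first.
      rewrite /m; apply: leqW; apply: le_truncn; rewrite ler_pM2l//.
      exact: le_trans (ler_norm _) (yM w).
    rewrite -[iota 0 m]/(index_iota 0 m) big_mkord; apply: eq_bigr => k _.
    rewrite indicE truncn_gt_nat /F; congr ((nat_of_bool _)%:R).
    by apply/idP/idP => [/set_mem|/mem_set].
  have -> : L y = L (fun w => y w - z w).
    rewrite (_ : (fun _ => _) = fun w => y w + (-1) * z w).
      by rewrite (LD y (fun w => -1 * z w))// ?(LZ _ z)// ?Lz ?mulr0 ?addr0//; exact: bmZ.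
    by apply/funext => w; rewrite mulN1r.
  apply: le_trans Cn; apply: LC; first exact: bmB.
  move=> w; rewrite zE.
  have /andP[h1 h2] := truncn_itv (mulr_ge0 (ltW n0) (y0 w)).
  set t := (Num.trunc _)%:R in h1 h2 *.
  have -> : y w - n%:R^-1 * t = n%:R^-1 * (n%:R * y w - t) by field; rewrite gt_eqF.
  have in0 : 0 <= n%:R^-1 :> R by rewrite invr_ge0 ler0n.
  rewrite normrM (ger0_norm in0) ler_piMr//.
  by rewrite ger0_norm ?subr_ge0//; move: h2; rewrite -natr1 -/t; lra.
move=> x bx; have [mx [M xM]] := bx.
have : L (fun w => x w + M) = 0.
  apply: Lpos; first by apply: bmD => //; exact: bm_cst.
  by move=> w; have := xM w; rewrite ler_norml; lra.
rewrite LD//; last exact: bm_cst.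
suff -> : L (fun=> M) = 0 by rewrite addr0.
rewrite (_ : (fun _ => _) = fun w => M * 1).
  by rewrite LZ ?Lpos ?mulr0//; exact: bm_cst.
by apply/funext => w; rewrite mulr1.
Qed.

End layers.

Section density.
Context {d : measure_display} {O : measurableType d} {R : realType}.
Variable mu : {finite_measure set O -> \bar R}.
Local Notation I := (Rintegral mu [set: O]).
Local Notation bm := (@bm d O R).

Variable f : (O -> R) -> R.
Hypothesis fD : forall x y, bm x -> bm y -> f (fun w => x w + y w) = f x + f y.
Hypothesis fZ : forall (c : R) x, bm x -> f (fun w => c * x w) = c * f x.
Hypothesis f_ge0 : forall x, bm x -> (forall w, 0 <= x w) -> 0 <= f x.
Hypothesis f_small : forall e : R, 0 < e -> exists2 r : R, 0 < r &
  forall A, measurable A -> (mu A <= r%:E)%E -> f \1_A <= e.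

(** A measure is defined on all sets, hence the default value. *)
Definition indic_measure (A : set O) : \bar R :=
  if pselect (measurable A) then (f \1_A)%:E else 0%E.

Lemma indic_measureE A : measurable A -> indic_measure A = (f \1_A)%:E.
Proof. by rewrite /indic_measure; case: pselect. Qed.

Lemma f_indicU A B : measurable A -> measurable B -> A `&` B = set0 ->
  f \1_(A `|` B) = f \1_A + f \1_B.
Proof.
move=> mA mB AB; rewrite -fD; [|exact: bm_indic|exact: bm_indic].
congr f; apply/funext => w; rewrite !indicE in_setU.
have [wA|wA] := boolP (w \in A); have [wB|wB] := boolP (w \in B);
  rewrite /= ?addr0 ?add0r//.
have : (A `&` B) w by split; exact: set_mem.
by rewrite AB.
Qed.

Lemma indic_measure0 : indic_measure set0 = 0%E.
Proof.
rewrite indic_measureE// indic0; congr EFin.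
by have := fZ 0 _ (@bm_cst _ O R 0); rewrite !mul0r.
Qed.

Lemma indic_measure_ge0 A : (0 <= indic_measure A)%E.
Proof.
rewrite /indic_measure; case: pselect => // mA; rewrite lee_fin f_ge0//.
exact: bm_indic.
Qed.

(** The tails of a disjoint union have small measure, and [f] is small on them. *)
Lemma indic_measure_semi_sigma_additive : semi_sigma_additive indic_measure.
Proof.
move=> A mA tA mU.
pose B n := \big[setU/set0]_(i < n) A i.
have mB n : measurable (B n) by exact: bigsetU_measurable.
pose D n := \bigcup_k A k `\` B n.
have mD n : measurable (D n) by exact: measurableD.
have BU n : B n `<=` \bigcup_k A k by rewrite /B -bigcup_mkord; exact: bigcup_subset.
have sumE n : (\sum_(0 <= i < n) indic_measure (A i))%E = (f \1_(\bigcup_k A k) - f \1_(D n))%:E.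
  have -> : f \1_(\bigcup_k A k) = f \1_(B n) + f \1_(D n).
    rewrite -f_indicU// ?setDIK//.
    by rewrite /D setDUK.
  rewrite addrK; elim: n => [|n IH].
    by rewrite big_nil /B big_ord0 -indic_measureE// indic_measure0.
  rewrite big_nat_recr//= IH indic_measureE// -EFinD /B big_ord_recr /=.
  rewrite f_indicU//; first exact: mB.
  rewrite -subset0 -bigcup_mkord => w [[k /= kn Akw] Anw].
  have kE : k = n by apply: tA => //; exists w.
  by move: kn; rewrite kE ltnn.
rewrite (_ : (fun n => _) = fun n => (f \1_(\bigcup_k A k) - f \1_(D n))%:E); last first.
  by apply/funext => n; exact: sumE.
rewrite indic_measureE//; apply: cvg_EFin; first exact: nearW.
rewrite -[X in _ --> X]subr0; apply: cvgB; first exact: cvg_cst.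
apply/cvgrPdist_le => e e0; have [r r0 hr] := f_small e e0.
have : mu (D n) @[n --> \oo] --> mu (\bigcap_n D n).
  apply: nonincreasing_cvg_mu => //.
  - by rewrite ltey_eq fin_num_measure//; exact: mD.
  - exact: bigcap_measurable.
  - move=> n m nm; apply/subsetPset; apply: setDS.
    by rewrite /B -!bigcup_mkord; move=> w [k /= kn Akw]; exists k => //=; exact: leq_trans kn nm.
have -> : \bigcap_n D n = set0.
  rewrite -subset0 => w hw.
  have [[k _ Akw] _] := hw 0%N Logic.I.
  have [_ []] := hw k.+1 Logic.I.
  by rewrite /B -bigcup_mkord; exists k => //=.
rewrite measure0 => /fine_cvgP [_ /cvgrPdist_le /(_ r r0)].
apply: filterS => n /=; rewrite sub0r normrN => h.
rewrite sub0r normrN ger0_norm; last by apply: f_ge0 => //; exact: bm_indic.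
apply: hr => //; rewrite -[leLHS]fineK; last exact: fin_num_measure.
by rewrite lee_fin (le_trans (ler_norm _)).
Qed.

HB.instance Definition _ := isMeasure.Build d O R indic_measure
  indic_measure0 indic_measure_ge0 indic_measure_semi_sigma_additive.

Lemma indic_measure_fin : fin_num_fun indic_measure.
Proof. by move=> A mA; rewrite indic_measureE. Qed.

HB.instance Definition _ := @Measure_isFinite.Build d O R indic_measure indic_measure_fin.

Lemma indic_measure_dominates : indic_measure `<< mu.
Proof.
apply/null_content_dominatesP => A mA muA.
rewrite indic_measureE//; congr EFin; apply/eqP; rewrite eq_le f_ge0 ?andbT//; last exact: bm_indic.
apply/ler_addgt0Pr => e e0; rewrite add0r; have [r r0 hr] := f_small e e0.
by apply: hr => //; rewrite muA lee_fin ltW.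
Qed.

(** The density is the Radon-Nikodym derivative of the measure that [f] defines
    on sets; the two functionals agree on indicators, hence everywhere. *)
Lemma functional_density : exists h : O -> R,
  [/\ measurable_fun [set: O] h, forall w, 0 <= h w,
      mu.-integrable [set: O] (EFin \o h) &
      forall x, bm x -> f x = I (fun w => x w * h w)].
Proof.
have [g [g0 gi gE]] := radon_nikodym_finite indic_measure_dominates.
pose h := fine \o g.
have mg := measurable_int _ gi.
have mh : measurable_fun [set: O] h by exact: measurableT_comp.
have h0 w : 0 <= h w by exact: fine_ge0.
have gh : ae_eq mu [set: O] g (EFin \o h).
  apply: filterS (integrable_ae measurableT gi) => w /(_ Logic.I) hw _.
  by rewrite /= fineK.
have hi : mu.-integrable [set: O] (EFin \o h).
  apply/integrableP; split; first exact/measurable_EFinP.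
  have /integrableP [_] := gi; apply: le_lt_trans.
  apply: ge0_le_integral => //.
  - by apply: measurableT_comp => //; exact/measurable_EFinP.
  - exact: measurableT_comp.
  by move=> w _; rewrite /= /h /=; case: (g w) => //= *; rewrite normr0 leey.
exists h; split => // x bx.
have xhi y : bm y -> mu.-integrable [set: O] (EFin \o (fun w => y w * h w)).
  by move=> by_; exact: integrableMbm.
pose L y := f y - I (fun w => y w * h w).
suff : L x = 0 by rewrite /L => /eqP; rewrite subr_eq0 => /eqP.
have f1 := f_ge0 _ (bm_cst 1) (fun _ => ler01).
apply: (@bounded_functional_eq0 _ O R L (f (fun=> 1) + I h)) => //.
- move=> y z by_ bz; rewrite /L fD//.
  under eq_Rintegral do rewrite mulrDl.
  rewrite RintegralD//; [by ring|exact: xhi|exact: xhi].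
- move=> c y by_; rewrite /L fZ//.
  under eq_Rintegral do rewrite -mulrA.
  by rewrite RintegralZl//; [ring|exact: xhi].
- move=> y M by_ yM; rewrite /L mulrDl; apply: le_trans (ler_normB _ _) _; apply: lerD.
    have h1 : 0 <= f (fun w => M * 1 + y w).
      apply: f_ge0 => [|w]; first by apply: bmD => //; exact: bm_cst.
      by have := yM w; rewrite ler_norml; lra.
    have h2 : 0 <= f (fun w => M * 1 + (-1) * y w).
      apply: f_ge0 => [|w]; first by apply: bmD; [exact: bm_cst|exact: bmZ].
      by have := yM w; rewrite ler_norml; lra.
    move: h1 h2; rewrite !fD//; [|exact: bm_cst|exact: bmZ|exact: bm_cst].
    rewrite !fZ//; last exact: bm_cst.
    by rewrite ler_norml; lra.
  apply: le_trans (le_normr_Rintegral _ _) _ => //; first exact: xhi.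
  rewrite mulrC -RintegralZl//; apply: le_Rintegral => //.
  + exact: integrable_norm (xhi _ by_).
  + by under [X in integrable _ _ X]eq_fun do rewrite /= EFinM; exact: integrableZl.
  + by move=> w _; rewrite normrM [`|h w|]ger0_norm// ler_wpM2r.
- move=> A mA; rewrite /L; apply/eqP; rewrite subr_eq0; apply/eqP; apply: EFin_inj.
  rewrite -indic_measureE// [LHS]gE// /Rintegral fineK; last first.
    by apply: integrable_fin_num => //; apply: xhi; exact: bm_indic.
  rewrite [LHS]integral_mkcond.
  apply: (@ae_eq_integral _ _ _ mu [set: O]) => //.
  + by apply/(measurable_restrictT _ _).1 => //; exact: measurable_funS mg.
  + by apply/measurable_EFinP; apply: measurable_funM => //; exact: measurable_indic.
  apply: filterS gh => w /(_ Logic.I) /= hw _; rewrite patchE indicE.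
  by case: (w \in A); rewrite ?mul1r ?mul0r.
Qed.

End density.

Section separating_density.
Context {d : measure_display} {O : measurableType d} {R : realType}.
Variable mu : {finite_measure set O -> \bar R}.
Local Notation I := (Rintegral mu [set: O]).
Local Notation bm := (@bm d O R).
Variables (u : (O -> R) -> R).
Hypothesis uD : forall f g, bm f -> bm g -> u f + u g <= u (fun w => f w + g w).
Hypothesis uZ : forall (c : R) f, 0 <= c -> bm f -> u (fun w => c * f w) = c * u f.
Hypothesis u_le : forall f g, bm f -> bm g ->
  (\forall w \ae mu, f w <= g w) -> u f <= u g.
Hypothesis u_cont : forall (zs : nat -> O -> R) (z : O -> R) (M : R),
  (forall n, measurable_fun [set: O] (zs n)) -> bm z ->
  (forall n w, `|zs n w| <= M) -> (forall n w, zs n.+1 w <= zs n w) ->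
  (forall w, zs n w @[n --> \oo] --> z w) ->
  u (zs n) @[n --> \oo] --> u z.

(** A theorem of Delbaen on coherent risk measures: continuity from above makes
    the separating functionals countably additive. *)
Theorem separating_density (x0 : O -> R) : bm x0 -> u x0 < 0 ->
  exists h : O -> R,
  [/\ measurable_fun [set: O] h, forall w, 0 <= h w,
      mu.-integrable [set: O] (EFin \o h),
      forall x, bm x -> u x <= I (fun w => x w * h w) &
      I (fun w => x0 w * h w) <= 0].
Proof.
move=> bx0 ux0.
have [f [uf fD fZ fx0 fb]] := linear_extension mu u x0 uD uZ u_le u_cont bx0 ux0.
have u0 : u (fun=> 0) = 0.
  by have := uZ 0 (fun=> 0) (lexx _) (@bm_cst _ O R 0); rewrite !mul0r.
have f_ge0 x : bm x -> (forall w, 0 <= x w) -> 0 <= f x.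
  move=> bx x_ge0; apply: le_trans (uf _ bx); rewrite -u0; apply: u_le => //.
    exact: bm_cst.
  exact: aeW.
have f_small e : 0 < e -> exists2 r : R, 0 < r &
    forall A, measurable A -> (mu A <= r%:E)%E -> f \1_A <= e.
  move=> e0; pose K := (Num.trunc (- u x0 / e)).+1.
  have K0 : 0 < K%:R :> R by rewrite ltr0n.
  have [r r0 hr] := young_ball_small_indic mu u x0 uD uZ u_le u_cont bx0 ux0 K.
  exists r => // A mA muA; have := fb _ (hr A mA muA).
  rewrite fZ; last exact: bm_indic.
  rewrite mulNr lerN2 => h.
  rewrite -(ler_pM2l K0); apply: le_trans h _.
  by rewrite -ler_pdivrMr// ltW// truncnS_gt.
have [h [mh h0 hi hE]] := functional_density mu f fD fZ f_ge0 f_small.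
exists h; split => //; last by rewrite -hE.
by move=> x bx; rewrite -hE//; exact: uf.
Qed.

End separating_density.

(** * Sub-sigma-algebras and conditional expectations *)

Section sub_sigma_algebra.
Context {d : measure_display} {T : measurableType d} {R : realType}.
Variables (P : probability T R) (G : set (set T)).
Hypotheses (sG : sigma_algebra [set: T] G) (GM : G `<=` measurable).
Local Notation TG := (g_sigma_algebraType G).
Local Notation E := (Rintegral P [set: T]).
Local Notation integrable f := (P.-integrable [set: T] (EFin \o f)).

Lemma sub_measurableE : (measurable : set (set TG)) = G.
Proof. exact: measurable_g_measurableTypeE. Qed.

Lemma mwE (f : T -> R) : measurable_wrt G f <->
  measurable_fun [set: TG] (f : TG -> R).
Proof.
split => [mf _ B mB|mf B mB].
  by rewrite setTI sub_measurableE; exact: mf.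
have := mf measurableT B mB; rewrite setTI => h.
by rewrite -sub_measurableE.
Qed.

Lemma id_measurable : measurable_fun [set: T] (id : T -> TG).
Proof. by move=> _ B; rewrite sub_measurableE setTI => GB; exact: GM. Qed.

Lemma mw_measurable (f : T -> R) : measurable_wrt G f -> measurable_fun [set: T] f.
Proof. by move=> mf _ B mB; rewrite setTI; exact: GM (mf B mB). Qed.

Lemma sub_algT : G [set: T].
Proof. by rewrite -sub_measurableE; exact: measurableT. Qed.

Lemma sub_algC A : G A -> G (~` A).
Proof. rewrite -sub_measurableE; exact: measurableC. Qed.

Lemma sub_algI A B : G A -> G B -> G (A `&` B).
Proof. rewrite -sub_measurableE; exact: measurableI. Qed.

Lemma sub_algU A B : G A -> G B -> G (A `|` B).
Proof. rewrite -sub_measurableE; exact: measurableU. Qed.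

Lemma sub_algD A B : G A -> G B -> G (A `\` B).
Proof. rewrite -sub_measurableE; exact: measurableD. Qed.

Lemma mw_cst c : measurable_wrt G (fun=> c : R).
Proof. by apply/mwE; exact: measurable_cst. Qed.

Lemma mwD (f g : T -> R) : measurable_wrt G f -> measurable_wrt G g ->
  measurable_wrt G (fun w => f w + g w).
Proof. by move=> /mwE mf /mwE mg; apply/mwE; exact: measurable_funD. Qed.

Lemma mwM (f g : T -> R) : measurable_wrt G f -> measurable_wrt G g ->
  measurable_wrt G (fun w => f w * g w).
Proof. by move=> /mwE mf /mwE mg; apply/mwE; exact: measurable_funM. Qed.

Lemma mwB (f g : T -> R) : measurable_wrt G f -> measurable_wrt G g ->
  measurable_wrt G (fun w => f w - g w).
Proof. by move=> /mwE mf /mwE mg; apply/mwE; exact: measurable_funB. Qed.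

Lemma mw_min (f g : T -> R) : measurable_wrt G f -> measurable_wrt G g ->
  measurable_wrt G (fun w => Num.min (f w) (g w)).
Proof. by move=> /mwE mf /mwE mg; apply/mwE; exact: measurable_minr. Qed.

Lemma mw_max (f g : T -> R) : measurable_wrt G f -> measurable_wrt G g ->
  measurable_wrt G (fun w => Num.max (f w) (g w)).
Proof. by move=> /mwE mf /mwE mg; apply/mwE; exact: measurable_maxr. Qed.

Lemma mw_indic A : G A -> measurable_wrt G (\1_A : T -> R).
Proof.
by move=> GA; apply/mwE; apply: measurable_indic; rewrite sub_measurableE.
Qed.

Lemma mw_lt (f g : T -> R) : measurable_wrt G f -> measurable_wrt G g ->
  G [set w | f w < g w].
Proof.
move=> mf mg.
have -> : [set w | f w < g w] = ~` [set w | g w <= f w].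
  by apply/seteqP; split => w /=; rewrite ltNge => /negP.
apply: sub_algC; move/mwE : mf => mf; move/mwE : mg => mg.
rewrite -sub_measurableE -[X in measurable X]setTI.
exact: (@measurable_fun_le _ TG _ setT).
Qed.

Definition idG : {mfun T >-> TG} :=
  HB.pack (id : T -> TG) (isMeasurableFun.Build _ _ _ _ _ id_measurable).

Definition PG : probability TG R := distribution P idG.

Lemma bmG (x : T -> R) : @bm _ TG R x <-> measurable_wrt G x /\ exists M, forall w, `|x w| <= M.
Proof. by split=> [[mx xM]|[/mwE mx xM]]; split => //; apply/mwE. Qed.

Lemma bmG_bm (x : T -> R) : @bm _ TG R x -> bm x.
Proof. by move=> /bmG [mx xM]; split => //; exact: mw_measurable. Qed.

(** The functional [x |-> E (x * Y)] on bounded [G]-measurable functions is small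
    on small sets; its density for the restriction of [P] to [G] is the conditional
    expectation. *)
Lemma condexp_ge0_exists (Y : T -> R) : (forall w, 0 <= Y w) -> integrable Y ->
  exists h : T -> R, [/\ measurable_wrt G h, integrable h &
    forall x, @bm _ TG R x -> E (fun w => x w * Y w) = E (fun w => x w * h w)].
Proof.
move=> Y0 iY.
pose f (x : TG -> R) := E (fun w => x w * Y w).
have [||||h [mh h0 hi hE]] := @functional_density _ TG R PG f.
- move=> x y /bmG_bm bx /bmG_bm by_; rewrite /f.
  under eq_Rintegral do rewrite mulrDl.
  by rewrite RintegralD//; exact: integrableMbm.
- move=> c x /bmG_bm bx; rewrite /f.
  under eq_Rintegral do rewrite -mulrA.
  by rewrite RintegralZl//; exact: integrableMbm.
- by move=> x bx x0; apply: Rintegral_ge0 => w _; rewrite mulr_ge0.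
- move=> e e0; have [r [r0 hr]] := integral_normr_continuous iY e0.
  exists (r / 2); first by rewrite divr_gt0.
  move=> A; rewrite sub_measurableE => GA PA; have mA := GM _ GA.
  have {}PA : (P A < r%:E)%E.
    by apply: le_lt_trans PA _; rewrite lte_fin ltr_pdivrMr// mulr_natr mulr2n ltrDr.
  have /ltW := hr A mA PA; apply: le_trans.
  rewrite le_eqVlt; apply/orP; left; apply/eqP.
  rewrite /f [RHS]Rintegral_mkcond; apply: eq_Rintegral => w _.
  rewrite patchE indicE; case: (w \in A); rewrite ?mul1r ?mul0r//.
  by rewrite ger0_norm.
have mwh : measurable_wrt G h by apply/mwE.
have ih : integrable h.
  apply/integrableP; split; first by apply/measurable_EFinP; exact: mw_measurable.
  have /integrableP [_] := hi; apply: le_lt_trans.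
  rewrite /PG /distribution (ge0_integral_pushforward id_measurable)//.
  by do 2 apply: measurableT_comp => //.
exists h; split => // x bx.
rewrite -/(f x) hE// /Rintegral; congr fine.
rewrite /PG /distribution (integral_pushforward id_measurable)//.
- by apply/measurable_EFinP; apply: measurable_funM => //; case: bx.
- exact: integrableMbm (bmG_bm _ bx) ih.
Qed.

Lemma condexp_exists (Y : T -> R) : integrable Y ->
  exists h : T -> R, [/\ measurable_wrt G h, integrable h &
    forall x, @bm _ TG R x -> E (fun w => x w * Y w) = E (fun w => x w * h w)].
Proof.
move=> iY.
have mY : measurable_fun [set: T] Y by apply/measurable_EFinP; exact: measurable_int iY.
have ip : integrable Y^\+%R by exact: integrable_funrpos.
have im : integrable Y^\-%R by exact: integrable_funrneg.
have [h1 [m1 i1 e1]] := condexp_ge0_exists _ (funrpos_ge0 Y) ip.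
have [h2 [m2 i2 e2]] := condexp_ge0_exists _ (funrneg_ge0 Y) im.
exists (fun w => h1 w - h2 w); split; first exact: mwB.
  exact: integrable_sub.
move=> x bx; have bx' := bmG_bm _ bx.
under [RHS]eq_Rintegral do rewrite mulrBr.
rewrite RintegralB//; [|exact: integrableMbm|exact: integrableMbm].
rewrite -e1// -e2// -RintegralB//; [|exact: integrableMbm|exact: integrableMbm].
by apply: eq_Rintegral => w _; rewrite -mulrBr; congr (_ * _); by rewrite -[in LHS](funrposBneg Y).
Qed.

(** Test on the event where [g < f]. *)
Lemma ae_le_of_integrals (f g : T -> R) : measurable_wrt G f -> measurable_wrt G g ->
  integrable f -> integrable g ->
  (forall A, G A -> E (fun w => \1_A w * f w) <= E (fun w => \1_A w * g w)) ->
  \forall w \ae P, f w <= g w.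
Proof.
move=> mf mg fi gi fg.
pose A := [set w | g w < f w].
have GA : G A by exact: mw_lt.
have mA := GM _ GA.
have bA : bm (\1_A : T -> R) by exact: bm_indic.
pose k w : R := \1_A w * (f w - g w).
have k0 w : 0 <= k w.
  rewrite /k indicE; case: (boolP (w \in A)) => [/set_mem wA|]; last by rewrite mul0r.
  by rewrite mul1r subr_ge0 ltW.
have ki : integrable k by apply: integrableMbm => //; exact: integrable_sub.
have : \forall w \ae P, k w = 0.
  apply: (ae_eq0_of_Rintegral P) => //.
  rewrite (_ : E k = E (fun w => \1_A w * f w) - E (fun w => \1_A w * g w)).
    by rewrite subr_le0 fg.
  rewrite -RintegralB//; [|exact: integrableMbm|exact: integrableMbm].
  by apply: eq_Rintegral => w _; rewrite /k mulrBr.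
apply: filterS => w kw; rewrite leNgt; apply/negP => lt.
move: kw; rewrite /k indicE mem_set// mul1r => /eqP.
by rewrite subr_eq0 gt_eqF.
Qed.

Lemma ae_eq_of_integrals (f g : T -> R) : measurable_wrt G f -> measurable_wrt G g ->
  integrable f -> integrable g ->
  (forall A, G A -> E (fun w => \1_A w * f w) = E (fun w => \1_A w * g w)) ->
  \forall w \ae P, f w = g w.
Proof.
move=> mf mg fi gi fg.
have h1 : \forall w \ae P, f w <= g w by apply: ae_le_of_integrals => // A GA; rewrite fg.
have h2 : \forall w \ae P, g w <= f w by apply: ae_le_of_integrals => // A GA; rewrite fg.
by apply: filterS2 h1 h2 => w p q; apply/eqP; rewrite eq_le p q.
Qed.

Lemma integral_indic_mul A (k : T -> R) :
  (\int[P]_(w in A) (k w)%:E = \int[P]_w (\1_A w * k w)%:E)%E.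
Proof.
rewrite integral_mkcond; apply: eq_integral => w _.
by rewrite patchE indicE; case: (w \in A); rewrite ?mul1r ?mul0r.
Qed.

Lemma is_condexp_exists (Y : T -> R) : integrable Y ->
  exists Z, is_condexp P G (EFin \o Y) Z.
Proof.
move=> iY; have [h [mh ih hE]] := condexp_exists _ iY.
exists h; split => // A GA.
have bA : @bm _ TG R \1_A by apply: bm_indic; rewrite sub_measurableE.
have := congr1 EFin (hE _ bA).
rewrite /Rintegral !fineK; last 2 first.
- by apply: integrable_fin_num => //; apply: integrableMbm => //; exact: bmG_bm.
- by apply: integrable_fin_num => //; apply: integrableMbm => //; exact: bmG_bm.
by rewrite /= !(integral_indic_mul A).
Qed.

(** Conditional expectations, which are specified by integrals over events, may
    be tested against all bounded variables: such a version exists by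
    [condexp_exists], and versions agree almost surely. *)
Lemma condexp_pull (Y Z x : T -> R) : integrable Y ->
  is_condexp P G (EFin \o Y) Z -> measurable_wrt G x -> (exists M : R, forall w, `|x w| <= M) ->
  E (fun w => x w * Z w) = E (fun w => x w * Y w).
Proof.
move=> iY [mZ iZ ZE] mx xM.
have bx : @bm _ TG R x by apply/bmG.
have [h [mh ih hE]] := condexp_exists _ iY.
have Zh : \forall w \ae P, Z w = h w.
  apply: ae_eq_of_integrals => // A GA.
  have bA : @bm _ TG R \1_A by apply: bm_indic; rewrite sub_measurableE.
  rewrite -hE//; have := ZE A GA; rewrite /= !(integral_indic_mul A) => e.
  by rewrite /Rintegral e.
have mx' := mw_measurable _ mx.
rewrite hE//; apply: ae_Rintegral_eq.
- by apply: measurable_funM => //; exact: mw_measurable.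
- by apply: measurable_funM => //; exact: mw_measurable.
- by apply: filterS Zh => w ->.
Qed.

End sub_sigma_algebra.

(** * Pairings as series of expectations *)

Section series.
Context {d : measure_display} {T : measurableType d} {R : realType}.
Variables (P : probability T R).
Local Notation E := (Rintegral P [set: T]).
Local Notation integrable f := (P.-integrable [set: T] (EFin \o f)).

Lemma ereal_cvgP (u : nat -> \bar R) : cvgn u <-> limn_esup u = limn_einf u.
Proof.
split=> [/cvg_ex[l /cvg_limn_einf_sup[-> ->]]//|h].
apply/cvg_ex; exists (limn_esup u).
apply: (@squeeze_cvge _ _ _ _ (einfs u) u (esups u)).
- apply: nearW => n; apply/andP; split.
    by apply: ereal_inf_lbound; exists n => /=.
  by apply: ereal_sup_ubound; exists n => /=.
- by rewrite h limn_einf_lim; exact: is_cvg_einfs.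
- by rewrite limn_esup_lim; exact: is_cvg_esups.
Qed.

(** The sum under the expectation that defines a pairing is a limit only almost
    surely; its measurability is needed everywhere. *)
Lemma measurable_limn (f : nat -> T -> \bar R) :
  (forall n, measurable_fun [set: T] (f n)) ->
  measurable_fun [set: T] (fun w => limn (f ^~ w)).
Proof.
move=> mf.
have m1 : measurable_fun [set: T] (fun w => limn_esup (f ^~ w)).
  exact: measurable_fun_limn_esup.
have m2 : measurable_fun [set: T] (fun w => limn_einf (f ^~ w)).
  rewrite /limn_einf; apply: measurableT_comp => //.
  by apply: measurable_fun_limn_esup => n; exact: measurableT_comp.
rewrite (_ : (fun _ => _) = fun w => if limn_esup (f ^~ w) == limn_einf (f ^~ w)
    then limn_esup (f ^~ w) else point).
  apply: measurable_fun_ifT => //.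
  exact: measurable_fun_eqe.
apply/funext => w; case: eqP => [|h].
  by move=> /ereal_cvgP /is_cvg_limn_esupE.
by rewrite dvgP// => /ereal_cvgP.
Qed.

(** Everything is dominated by [m] times the variation. *)
Lemma pairing_series (X D : nat -> T -> R) (m : R) :
  (forall t, measurable_fun [set: T] (X t)) ->
  (forall t, measurable_fun [set: T] (D t)) ->
  (\int[P]_w (\sum_(0 <= t <oo) (`|D t w|)%:E) < +oo)%E ->
  (\forall w \ae P, forall t, `|X t w| <= m) ->
  [/\ P.-integrable [set: T] (fun w => (\sum_(0 <= t <oo) (X t w * D t w)%:E)%E),
    (\sum_(0 <= t < n) E (fun w => X t w * D t w)) @[n --> \oo] -->
      fine (\int[P]_w (\sum_(0 <= t <oo) (X t w * D t w)%:E))%E,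
    forall t, integrable (fun w => X t w * D t w) &
    \forall w \ae P, (\sum_(0 <= t < n) (X t w * D t w)%:E)%E @[n --> \oo] -->
      (\sum_(0 <= t <oo) (X t w * D t w)%:E)%E /\
      (\sum_(0 <= t <oo) (X t w * D t w)%:E)%E \is a fin_num].
Proof.
move=> mX mD Dfin Xm.
pose N w := (\sum_(0 <= t <oo) (`|D t w|)%:E)%E.
have N0 w : (0 <= N w)%E by apply: nneseries_ge0 => t _ _; rewrite lee_fin.
have mN : measurable_fun [set: T] N.
  apply: ge0_emeasurable_sum => [t w _ _|t _]; first by rewrite lee_fin.
  by apply/measurable_EFinP; exact: measurableT_comp.
have iN : P.-integrable [set: T] N.
  apply/integrableP; split => //.
  by under eq_integral do rewrite gee0_abs//.
have m0 : 0 <= m by have [w h] := ae_exists _ Xm; exact: le_trans (h 0%N).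
have mS n : measurable_fun [set: T] (fun w => (\sum_(0 <= t < n) (X t w * D t w)%:E)%E).
  apply: emeasurable_sum => t; apply/measurable_EFinP; exact: measurable_funM.
have Nae := integrable_ae measurableT iN.
have Dle w n : (\sum_(0 <= t < n) (`|D t w|)%:E <= N w)%E.
  by apply: nneseries_lim_ge => t _ _; rewrite lee_fin.
have cv : \forall w \ae P, [set: T] w ->
    (\sum_(0 <= t < n) (X t w * D t w)%:E)%E @[n --> \oo] -->
    (\sum_(0 <= t <oo) (X t w * D t w)%:E)%E /\
    (\sum_(0 <= t <oo) (X t w * D t w)%:E)%E \is a fin_num.
  apply: filterS2 Nae Xm => w /(_ Logic.I) Nw Xw _.
  have : cvgn [normed series (fun t => X t w * D t w)].
    apply: nnseries_is_cvg => [t|]; first exact: normr_ge0.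
    apply: (@le_lt_trans _ _ (m%:E * N w)%E); last first.
      by rewrite -(fineK Nw) -EFinM ltry.
    rewrite -nneseriesZl//.
    apply: lee_nneseries => [t _ _|t _]; first by rewrite lee_fin normr_ge0.
    by rewrite /= lee_fin normrM ler_wpM2r.
  move=> /normed_cvg /cvg_ex [l hl].
  have h : (\sum_(0 <= t < n) (X t w * D t w)%:E)%E @[n --> \oo] --> l%:E.
    apply/fine_cvgP; split; first by apply: nearW => n; rewrite sumEFin.
    by apply: cvg_trans hl; apply: near_eq_cvg; apply: nearW => n /=; rewrite sumEFin.
  by rewrite (cvg_lim _ h).
have mY : measurable_fun [set: T] (fun w => (\sum_(0 <= t <oo) (X t w * D t w)%:E)%E).
  exact: measurable_limn.
have img : P.-integrable [set: T] (fun w => m%:E * N w)%E by exact: integrableZl.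
have dom : \forall w \ae P, forall n, [set: T] w ->
    (`|\sum_(0 <= t < n) (X t w * D t w)%:E| <= m%:E * N w)%E.
  apply: filterS Xm => w Xw n _.
  apply: (@le_trans _ _ (m%:E * \sum_(0 <= t < n) (`|D t w|)%:E)%E); last first.
    by apply: lee_wpmul2l; rewrite ?lee_fin.
  rewrite !sumEFin /= lee_fin mulr_sumr; apply: le_trans (ler_norm_sum _ _ _) _.
  by apply: ler_sum => t _; rewrite normrM ler_wpM2r.
have cv' : \forall w \ae P, [set: T] w ->
    (\sum_(0 <= t < n) (X t w * D t w)%:E)%E @[n --> \oo] -->
    (\sum_(0 <= t <oo) (X t w * D t w)%:E)%E.
  by apply: filterS cv => w h /h [].
have [iY _ cvI] := dominated_convergence measurableT mS mY cv' img dom.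
have iXD t : integrable (fun w => X t w * D t w).
  have iD : integrable (D t).
    apply/integrableP; split; first exact/measurable_EFinP.
    apply: le_lt_trans Dfin; apply: ge0_le_integral => //.
    - by apply: measurableT_comp => //; exact/measurable_EFinP.
    - move=> w _; apply: le_trans (Dle w t.+1).
      by rewrite big_nat_recr//= leeDr// sumEFin lee_fin sumr_ge0.
  have imD : integrable (fun w => m * D t w).
    by rewrite (_ : _ \o _ = fun w => (m%:E * (D t w)%:E)%E)//; exact: integrableZl.
  have mXD : measurable_fun [set: T] (EFin \o (fun w => X t w * D t w)).
    by apply/measurable_EFinP; exact: measurable_funM.
  apply/integrableP; split => //.
  have /integrableP [mmD] := imD; apply: le_lt_trans.
  apply: ae_ge0_le_integral => //; [exact: measurableT_comp|exact: measurableT_comp|].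
  apply: filterS Xm => w Xw _ /=; rewrite lee_fin !normrM ler_wpM2r//.
  by rewrite (le_trans (Xw t))// ler_norm.
split => //.
- move: cvI; rewrite -[X in _ --> X]fineK; last exact: integrable_fin_num.
  move=> /fine_cvgP [_]; apply: cvg_trans; apply: near_eq_cvg; apply: nearW => n /=.
  rewrite integral_sum//=.
  rewrite -[RHS]/(fine (_%:E)) -sumEFin; congr fine; apply: eq_bigr => t _.
  by rewrite /Rintegral fineK//; apply: integrable_fin_num => //; exact: iXD.
- by apply: filterS cv => w /(_ Logic.I).
Qed.

End series.

(** * Almost sure classes of measurable variables *)

Section L0.
Context {d : measure_display} {T : measurableType d} {R : realType}.
Variables (P : probability T R) (G : set (set T)).
Hypotheses (sG : sigma_algebra [set: T] G) (GM : G `<=` measurable).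

Lemma L0_cst (c : R) : L0 P G (fun=> c).
Proof.
split; first exact: measurable_cst.
by exists (fun=> c); [exact: mw_cst|exact: aeW].
Qed.

Lemma L0_mw (f : T -> R) : measurable_wrt G f -> L0 P G f.
Proof.
move=> mf; split; first exact: mw_measurable mf.
by exists f => //; exact: aeW.
Qed.

Lemma L0D (f g : T -> R) : L0 P G f -> L0 P G g -> L0 P G (fun w => f w + g w).
Proof.
move=> [mf [f' mf' ff']] [mg [g' mg' gg']]; split; first exact: measurable_funD.
exists (fun w => f' w + g' w); first exact: mwD.
by apply: filterS2 ff' gg' => w -> ->.
Qed.

Lemma L0M (f g : T -> R) : L0 P G f -> L0 P G g -> L0 P G (fun w => f w * g w).
Proof.
move=> [mf [f' mf' ff']] [mg [g' mg' gg']]; split; first exact: measurable_funM.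
exists (fun w => f' w * g' w); first exact: mwM.
by apply: filterS2 ff' gg' => w -> ->.
Qed.

Lemma L0B (f g : T -> R) : L0 P G f -> L0 P G g -> L0 P G (fun w => f w - g w).
Proof.
move=> [mf [f' mf' ff']] [mg [g' mg' gg']]; split; first exact: measurable_funB.
exists (fun w => f' w - g' w); first exact: mwB.
by apply: filterS2 ff' gg' => w -> ->.
Qed.

Lemma L0_indic A : G A -> L0 P G (\1_A : T -> R).
Proof. by move=> GA; apply: L0_mw; exact: mw_indic. Qed.

Lemma L0_ae (f g : T -> R) : measurable_fun [set: T] g ->
  (\forall w \ae P, f w = g w) -> L0 P G f -> L0 P G g.
Proof.
move=> mg fg [_ [f' mf' ff']]; split => //; exists f' => //.
by apply: filterS2 fg ff' => w -> ->.
Qed.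

(** Clip any measurable version. *)
Lemma L0_version (f : T -> R) (m : R) : L0 P G f -> (\forall w \ae P, `|f w| <= m) -> exists g,
  [/\ measurable_wrt G g, forall w, `|g w| <= `|m| & \forall w \ae P, f w = g w].
Proof.
move=> [mf [g mg fg]] fm.
exists (fun w => Num.max (- `|m|) (Num.min `|m| (g w))); split.
- by apply: mw_max => //; [exact: mw_cst|apply: mw_min => //; exact: mw_cst].
- move=> w; rewrite ler_norml le_max lexx /= ge_max ge_min lexx /= andbT.
  by rewrite ge0_cp.
- apply: filterS2 fg fm => w -> /le_trans /(_ (ler_norm m)).
  by rewrite ler_norml => /andP[h1 h2]; rewrite min_r// max_r.
Qed.

Lemma Linf_version (f : T -> R) : Linf P G f -> exists g M,
  [/\ measurable_wrt G g, forall w, `|g w| <= M & \forall w \ae P, f w = g w].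
Proof. by move=> [Lf [m fm]]; have [g gP] := L0_version f m Lf fm; exists g, `|m|. Qed.

End L0.

(** * Weak topologies *)

Section pointwise_initial.
Variables (S U : choiceType) (V : topologicalType) (f : S -> {ptws U -> V}).
Local Notation W := (initial_topology f).

Lemma cvg_initial_ptws (Fi : set_system S) (FF : Filter Fi) (s : S) :
  (forall u, f x u @[x --> Fi] --> f s u) -> Fi --> (s : W).
Proof.
move=> h A /= [_ [[B Bop <-] Bfs sBA]].
have : {ptws, (f @ Fi) --> f s}.
  apply/cvg_sup => u C /= [_ [[C' C'op <-] C'fs sCC']].
  by apply: filterS sCC' _; apply: (h u); exact: open_nbhs_nbhs.
move=> /(_ B) hB; apply: filterS sBA _; apply: hB.
by rewrite nbhsE; exists B.
Qed.

Lemma eval_initial_continuous u : continuous (fun x : W => f x u).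
Proof.
move=> x; apply: (@continuous_comp W _ _ (f : W -> {ptws U -> V}) (fun g => g u)).
  exact: initial_continuous.
exact: (@proj_continuous U (fun=> V) u (f x)).
Qed.

End pointwise_initial.

Section weak_topologies.
Context {d : measure_display} {T : measurableType d} {R : realType}.
Variables (P : probability T R) (F : nat -> set (set T)).
Local Notation Rinf := (Rinf P F).
Local Notation A1 := (A1 P F).

Lemma Rinf_closed_seq (C : set (process T R)) (Xn : nat -> process T R) X :
  Rinf_closed P F C -> (forall n, Rinf (Xn n)) -> (forall n, C (Xn n)) -> Rinf X ->
  (forall a, A1 a -> pairing P (Xn n) a @[n --> \oo] --> pairing P X a) -> C X.
Proof.
move=> Ccl RXn CXn RX cv.
pose Yn n : Rinf := exist _ (Xn n) (mem_set (RXn n)).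
pose Y : Rinf := exist _ X (mem_set RX).
have YY : Yn n @[n --> \oo] --> (Y : Rinf_weak P F).
  by apply: cvg_initial_ptws => -[a Aa]; apply: cv; exact: set_mem.
have YC : \forall n \near \oo, C (\val (Yn n)) by apply: nearW => n; exact: CXn.
exact: (closed_cvg (fun Z : Rinf_weak P F => C (\val Z)) Ccl YC Y YY).
Qed.

Lemma Rinf_closed_pairing (b : process T R) : A1 b ->
  closed ([set X : Rinf | 0 <= pairing P (\val X) b] : set (Rinf_weak P F)).
Proof.
move=> Ab; pose bb : A1 := exist _ b (mem_set Ab).
have h := @eval_initial_continuous _ _ _ ((fun (X : Rinf) (a : A1) => pairing P (\val X) (\val a))
       : Rinf -> {ptws A1 -> R}) bb.
by apply: (@closed_comp _ _ _ [set r : R | 0 <= r]); [move=> x _; exact: h|exact: closed_ge].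
Qed.

(** The hypothesis makes [C] an intersection of closed half-spaces. *)
Lemma Rinf_closed_polar (C : set (process T R)) : C `<=` Rinf ->
  (forall X, Rinf X -> (forall b, A1 b -> (forall Y, C Y -> 0 <= pairing P Y b) ->
    0 <= pairing P X b) -> C X) -> Rinf_closed P F C.
Proof.
move=> CR h; rewrite /Rinf_closed.
pose B := [set b | A1 b /\ forall Y, C Y -> 0 <= pairing P Y b].
rewrite (_ : [set X | _] = \bigcap_(b in B) [set X : Rinf | 0 <= pairing P (\val X) b]).
  by apply: closed_bigI => b [Ab _]; exact: Rinf_closed_pairing.
apply/seteqP; split => [X /= CX b [_ hb]|X /= hX]; first exact: hb.
apply: h; first exact: (set_mem (valP X)).
by move=> b Ab hb; apply: hX.
Qed.

Lemma A1_closed_pairing (X : process T R) (c : R) : Rinf X ->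
  closed ([set a : A1 | c <= pairing P X (\val a)] : set (A1_weak P F)).
Proof.
move=> RX; pose XX : Rinf := exist _ X (mem_set RX).
have h := @eval_initial_continuous _ _ _ ((fun (a : A1) (X : Rinf) => pairing P (\val X) (\val a))
       : A1 -> {ptws Rinf -> R}) XX.
by apply: (@closed_comp _ _ _ [set r : R | c <= r]); [move=> x _; exact: h|exact: closed_ge].
Qed.

Lemma A1_closed_polar (K : set (process T R)) : K `<=` A1 ->
  (forall a, A1 a -> (forall X c, Rinf X -> (forall b, K b -> c <= pairing P X b) ->
    c <= pairing P X a) -> K a) -> A1_closed P F K.
Proof.
move=> KA h; rewrite /A1_closed.
pose B := [set Xc : process T R * R | Rinf Xc.1 /\ forall b, K b -> Xc.2 <= pairing P Xc.1 b].
rewrite (_ : [set a | _] = \bigcap_(Xc in B) [set a : A1 | Xc.2 <= pairing P Xc.1 (\val a)]).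
  by apply: closed_bigI => Xc [RX _]; exact: A1_closed_pairing.
apply/seteqP; split => [a /= Ka [X c] [_ hX]|a /= ha]; first exact: hX.
apply: h; first exact: (set_mem (valP a)).
by move=> X c RX hX; apply: (ha (X, c)).
Qed.

(** Finitely many functionals and a precision define the basic weak neighbourhoods
    of [a0]; the filter they generate on [K] converges to [a0]. *)
Lemma A1_closed_approx (K : set (process T R)) a0 :
  A1_closed P F K -> K `<=` A1 -> A1 a0 ->
  (forall (s : seq (process T R)) (e : R), (forall X, List.In X s -> Rinf X) -> 0 < e ->
    exists2 a, K a & forall X, List.In X s -> `|pairing P X a0 - pairing P X a| < e) ->
  K a0.
Proof.
move=> Kcl KA Aa0 h.
pose B (i : seq (process T R) * R) : set A1 := [set a : A1 | K (\val a) /\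
  forall X, List.In X i.1 -> `|pairing P X a0 - pairing P X (\val a)| < i.2].
pose D := [set i : seq (process T R) * R | (forall X, List.In X i.1 -> Rinf X) /\ 0 < i.2].
pose Fi := filter_from D B.
have Di : D ([::], 1) by split.
have FF : Filter Fi.
  apply: filter_from_filter; first by exists ([::], 1).
  move=> [s e] [s' e'] [/= hs he] [/= hs' he'].
  exists (s ++ s', Num.min e e'); first split.
  - by move=> X /= /List.in_app_iff [/hs|/hs'].
  - by rewrite /= lt_min he.
  move=> a [/= Ka ha]; split; split => // X Xs.
  - have := ha X (proj2 (List.in_app_iff _ _ _) (or_introl Xs)).
    by rewrite lt_min => /andP[].
  - have := ha X (proj2 (List.in_app_iff _ _ _) (or_intror Xs)).
    by rewrite lt_min => /andP[].
have PF : ProperFilter Fi.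
  apply: filter_from_proper => -[s e] [hs he].
  have [a Ka ha] := h s e hs he.
  by exists (exist _ a (mem_set (KA _ Ka))).
pose aa : A1 := exist _ a0 (mem_set Aa0).
have cv : Fi --> (aa : A1_weak P F).
  apply: cvg_initial_ptws => -[X RX] /=; apply/cvgrPdist_lt => e e0.
  exists ([:: X], e).
    by split => // Y [<-|//]; exact: set_mem.
  by move=> a [_ ha]; apply: ha; left.
have FK : \forall a \near Fi, K (\val (a : A1)) by exists ([::], 1) => // a [].
exact: (@closed_cvg (A1_weak P F) (A1_weak P F) Fi PF (fun x => x) (fun Z : A1_weak P F => K (\val Z)) Kcl FK aa cv).
Qed.

End weak_topologies.

(** * The optional sigma-algebra *)

Section optional.
Context {d : measure_display} {T : measurableType d} {R : realType}.
Variables (P : probability T R) (F : nat -> set (set T)).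
Hypotheses (sF : forall t, sigma_algebra [set: T] (F t)) (FM : forall t, F t `<=` measurable).

(** Functions measurable for these sets are the processes adapted everywhere
    ([optional_measurable_fun]). *)
Definition optional_sets : set (set (T * nat)) :=
  [set B | forall t, F t [set w | B (w, t)]].

Lemma optional_sigma_algebra : sigma_algebra [set: T * nat] optional_sets.
Proof.
split.
- by move=> t; case: (sF t).
- move=> B hB t; rewrite (_ : [set w | _] = [set: T] `\` [set w | B (w, t)]).
    by case: (sF t) => _ h _; exact: h (hB t).
  by apply/seteqP; split => w /= [].
- move=> B hB t; rewrite (_ : [set w | _] = \bigcup_n [set w | B n (w, t)]).
    by case: (sF t) => _ _; apply => n; exact: hB.
  by apply/seteqP; split => w /= [n _ h]; exists n.
Qed.

Local Notation TO := (g_sigma_algebraType optional_sets).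

Lemma optional_measurableE : (measurable : set (set TO)) = optional_sets.
Proof. exact: (measurable_g_measurableTypeE optional_sigma_algebra). Qed.

Lemma optional_measurable_fun (f : TO -> R) : measurable_fun [set: TO] f <->
  forall t, measurable_wrt (F t) (fun w => f (w, t)).
Proof.
split=> [mf t B mB|mf _ B mB].
  by have := mf measurableT B mB; rewrite setTI optional_measurableE => /(_ t).
by rewrite setTI optional_measurableE => t; exact: mf.
Qed.

Definition slice (t : nat) (w : T) : TO := (w, t).

Lemma slice_measurable t : measurable_fun [set: T] (slice t).
Proof. by move=> _ B; rewrite optional_measurableE setTI => /(_ t) h; exact: FM h. Qed.

Definition slice_mfun t : {mfun T >-> TO} :=
  HB.pack (slice t) (isMeasurableFun.Build _ _ _ _ _ (slice_measurable t)).

(** Summable weights make the product measure finite; they are compensated in the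
    increments of [optional_integral_pairing]. *)
Definition time_weight (t : nat) : R := 1 / (2 ^ t.+1)%:R.

Lemma time_weight_ge0 t : 0 <= time_weight t.
Proof. exact: divr_ge0. Qed.

Lemma time_weight_gt0 t : 0 < time_weight t.
Proof. by rewrite divr_gt0// ltr0n expn_gt0. Qed.

Definition slice_measure t : {measure set TO -> \bar R} :=
  mscale (NngNum (time_weight_ge0 t)) (distribution P (slice_mfun t)).

Lemma slice_measureE t B : slice_measure t B = ((time_weight t)%:E * P [set w | B (w, t)])%E.
Proof. by []. Qed.

Lemma optional_mass : fin_num_fun (mseries slice_measure 0).
Proof.
apply: lty_fin_num_fun.
rewrite /mseries; apply: (@le_lt_trans _ _ (\sum_(0 <= t <oo) (1 / (2 ^ (t + 1))%:R : R)%:E)%E); last first.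
  by rewrite (cvg_lim _ (@cvg_geometric_eseries_half R 1 0))// ltry.
apply: lee_nneseries => t _ //.
rewrite slice_measureE addn1 -[leRHS]mule1; apply: lee_wpmul2l; first by rewrite lee_fin time_weight_ge0.
by rewrite (_ : [set w | _] = [set: T]) ?probability_setT//; apply/seteqP.
Qed.

Definition optional_measure : {finite_measure set TO -> \bar R} :=
  HB.pack (mseries slice_measure 0) (Measure_isFinite.Build _ _ _ _ optional_mass).

Lemma ae_slice (p : TO -> Prop) : (\forall z \ae optional_measure, p z) ->
  forall t, \forall w \ae P, p (w, t).
Proof.
move=> [A [mA A0 pA]] t; exists [set w | A (w, t)]; split.
- by move: mA; rewrite optional_measurableE => /(_ t) h; exact: FM h.
- have h : (slice_measure t A <= 0)%E.
    rewrite -A0; apply: (@le_trans _ _ (\sum_(0 <= k < t.+1) slice_measure k A)%E).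
      by rewrite big_nat_recr//= leeDr//; apply: sume_ge0.
    by apply: nneseries_lim_ge => k _ _; exact: measure_ge0.
  have := measure_ge0 P [set w | A (w, t)]; rewrite le_eqVlt => /orP[/eqP <- //|P0].
  by move: h; rewrite slice_measureE leNgt mule_gt0// lte_fin time_weight_gt0.
- by move=> w /= nw; exact: pA.
Qed.

Lemma optional_integral (f : TO -> R) : measurable_fun [set: TO] f -> (forall z, 0 <= f z) ->
  (\int[optional_measure]_z (f z)%:E =
   \int[P]_w \sum_(0 <= t <oo) (time_weight t * f (w, t))%:E)%E.
Proof.
move=> mf f0.
have mfE : measurable_fun [set: TO] (EFin \o f) by exact/measurable_EFinP.
have f0E z : (0 <= (EFin \o f) z)%E by rewrite lee_fin.
rewrite [LHS](@ge0_integral_measure_series _ _ _ slice_measure)//; last by move=> z _; rewrite lee_fin.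
have mft t : measurable_fun [set: T] (fun w => (time_weight t * f (w, t))%:E).
  apply/measurable_EFinP; apply: measurable_funM => //.
  exact: (measurableT_comp mf (slice_measurable t)).
rewrite integral_nneseries//; last by move=> t w _; rewrite lee_fin mulr_ge0// time_weight_ge0.
apply: eq_eseriesr => t _.
rewrite ge0_integral_mscale//.
rewrite [X in (_ * X)%E](ge0_integral_pushforward (slice_measurable t))//.
rewrite preimage_setT -ge0_integralZl//.
- exact: (measurableT_comp mfE (slice_measurable t)).
- by move=> w _; exact: f0E.
- by move=> y _; rewrite lee_fin.
- by move=> y _; rewrite lee_fin.
Qed.

End optional.

(** * Separation in finite dimension *)

(** The image of [K] under [v] is convex and bounded but need not be closed, so a
    near-minimiser of the Euclidean norm replaces the projection of the origin.
    Moving from it towards [v a] by the proportion [l] cannot decrease the norm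
    much, which bounds its inner product with [v a] from below. *)
Lemma finite_separation {R : realType} (U : Type) (K : set U) n (v : U -> 'I_n -> R) (M e : R) :
  K !=set0 -> (forall a i, K a -> `|v a i| <= M) ->
  (forall a b l, K a -> K b -> 0 <= l <= 1 ->
    exists2 c, K c & forall i, v c i = (1 - l) * v a i + l * v b i) ->
  0 < e -> (forall a, K a -> exists i, e <= `|v a i|) ->
  exists (c : 'I_n -> R) (del : R), 0 < del /\ forall a, K a -> del <= \sum_i c i * v a i.
Proof.
move=> [a1 Ka1] vM conv e0 far.
pose f a := \sum_i v a i ^+ 2.
pose S := [set f a | a in K].
have f_far a : K a -> e ^+ 2 <= f a.
  move=> Ka; have [i ei] := far a Ka; rewrite /f (bigD1 i)//= -[v a i ^+ 2]ger0_norm ?sqr_ge0// normrX.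
  rewrite ler_wpDr//; first by apply: sumr_ge0 => j _; exact: sqr_ge0.
  by rewrite ler_pXn2r// ?nnegrE ?ltW.
have Slb : lbound S (e ^+ 2) by move=> _ [a Ka <-]; exact: f_far.
have Sinf : has_inf S by split; [exists (f a1); exists a1|exists (e ^+ 2)].
pose m := inf S.
have m_e : e ^+ 2 <= m by apply: lb_le_inf => //; case: Sinf.
have m0 : 0 < m by apply: lt_le_trans m_e; exact: exprn_gt0.
have m_le a : K a -> m <= f a by move=> Ka; apply: ge_inf; [exists (e ^+ 2)|exists a].
have M0 : 0 <= M by have [i ei] := far a1 Ka1; exact: le_trans (vM a1 i Ka1).
pose B : R := n%:R * (4 * M ^+ 2).
have B0 : 0 <= B by rewrite /B !mulr_ge0// sqr_ge0.
(* Here [m] is the infimum of the square norm and [B] bounds square distances; the step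
   is such that [l * (1 + B) <= m], half of which is lost below. *)
pose l := m / (1 + B + m).
have den0 : 0 < 1 + B + m by lra.
have l0 : 0 < l by rewrite divr_gt0.
have l1 : l <= 1 by rewrite ler_pdivrMr// mul1r; lra.
have lB : l * (1 + B) <= m.
  by rewrite /l mulrAC ler_pdivrMr// ler_pM2l//; lra.
have [|_ [a2 Ka2 <-] fa2] := inf_adherent (eps := l ^+ 2) _ Sinf; first exact: exprn_gt0.
exists (v a2), (m / 2); split; first by rewrite divr_gt0.
move=> a Ka.
have [c Kc vc] := conv a2 a l Ka2 Ka (introT andP (conj (ltW l0) l1)).
have := m_le c Kc.
have -> : f c = f a2 + 2 * l * (\sum_i v a2 i * v a i - f a2) + l ^+ 2 * \sum_i (v a i - v a2 i) ^+ 2.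
  rewrite /f -sumrB !mulr_sumr -!big_split /=; apply: eq_bigr => i _; rewrite vc; ring.
set q := \sum_i v a2 i * v a i.
have qB : \sum_i (v a i - v a2 i) ^+ 2 <= B.
  rewrite /B -[n%:R * _](_ : \sum_(i < n) (4 * M ^+ 2) = _); last first.
    by rewrite sumr_const card_ord -[LHS]mulr_natl.
  apply: ler_sum => i _; have := vM a i Ka; have := vM a2 i Ka2.
  rewrite !ler_norml => /andP[h1 h2] /andP[h3 h4]; nra.
have := m_le a2 Ka2; move: fa2 qB; rewrite -/m.
move: (f a2) (\sum_i (v a i - v a2 i) ^+ 2) => F2 V h1 h2 h3 h4.
have h5 : l ^+ 2 * V <= l ^+ 2 * B by apply: ler_wpM2l => //; exact: sqr_ge0.
have h6 : l * (F2 - q) * 2 <= l * (l * (1 + B)) by rewrite expr2 in h1 h4 h5; nra.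
have h7 : (F2 - q) * 2 <= l * (1 + B) by rewrite -(ler_pM2l l0) mulrA.
by rewrite ler_pdivrMr//; lra.
Qed.

(** * Stochastic intervals and conditional pairings *)

Section processes.
Context {d : measure_display} {T : measurableType d} {R : realType}.
Variables (P : probability T R) (F : nat -> set (set T)).
Hypothesis hF : is_filtration F.
Variables tau theta : T -> etime.
Hypotheses (htau : stopping_time F tau) (htheta : stopping_time F theta).
Hypothesis htau_fin : \forall w \ae P, tau w <> None.
Hypothesis htau_theta : \forall w \ae P, le_etime (tau w) (theta w).
Local Notation E := (Rintegral P [set: T]).
Local Notation integrable f := (P.-integrable [set: T] (EFin \o f)).
Local Notation G := (sigma_at F tau).
Local Notation Rinf := (Rinf P F).
Local Notation A1 := (A1 P F).
Local Notation cpairing := (cpairing P F tau theta).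

Let sF t : sigma_algebra [set: T] (F t). Proof. by case: hF. Qed.
Let FM t : F t `<=` measurable. Proof. by case: hF. Qed.
Let Fle s t : (s <= t)%N -> F s `<=` F t. Proof. by case: hF => _ _; apply. Qed.

Lemma sigma_atP : sigma_algebra [set: T] G.
Proof.
split.
- split => // t; rewrite set0I -(setDv [set: T]).
  by case: (sF t) => h0 _ _; rewrite setDv.
- move=> A [mA hA]; split; first exact: measurableD.
  move=> t.
  have -> : ([set: T] `\` A) `&` [set w | le_etime (tau w) (Some t)] =
      [set w | le_etime (tau w) (Some t)] `\` (A `&` [set w | le_etime (tau w) (Some t)]).
    by apply/seteqP; split => w /= [h1 h2]; split => //; [move=> [? _]; case: h1|split => //; apply: contra_not h2].
  by apply: (sub_algD _ (sF t)); [exact: htau|exact: hA].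
- move=> A hA; split; first by apply: bigcup_measurable => n _; case: (hA n).
  move=> t; rewrite setI_bigcupl; case: (sF t) => _ _; apply => n.
  by case: (hA n).
Qed.

Lemma sigma_at_measurable : G `<=` measurable.
Proof. by move=> A []. Qed.

Let sG := sigma_atP.
Let GM := sigma_at_measurable.

Lemma sigma_at_FI A t : G A -> F t (A `&` [set w | le_etime (tau w) (Some t)]).
Proof. by case. Qed.

Definition St t : set T :=
  [set w | le_etime (tau w) (Some t) && le_etime (Some t) (theta w)].

Lemma L0_le s t f : (s <= t)%N -> L0 P (F s) f -> L0 P (F t) f.
Proof. by move=> st [mf [g mg fg]]; split=> //; exists g => // B mB; exact: Fle st _ (mg B mB). Qed.

Lemma F_theta_ge t : F t [set w | le_etime (Some t) (theta w)].
Proof.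
case: t => [|t].
  rewrite (_ : [set _ | _] = [set: T]); first exact: sub_algT.
  by apply/seteqP; split => w //= _; case: (theta w).
rewrite (_ : [set _ | _] = ~` [set w | le_etime (theta w) (Some t)]).
  by apply: sub_algC => //; exact: Fle (leqnSn t) _ (htheta t).
apply/seteqP; split => w /=; case: (theta w) => //= n; rewrite ltnNge => /negP//.
Qed.

Lemma F_theta_eq s : F s [set w | theta w == Some s].
Proof.
rewrite (_ : [set _ | _] = [set w | le_etime (theta w) (Some s)] `&`
  [set w | le_etime (Some s) (theta w)]).
  by apply: (sub_algI _ (sF s)); [exact: htheta|exact: F_theta_ge].
apply/seteqP; split => w /= => [/eqP -> //=|[]].
by case: (theta w) => //= n h1 h2; apply/eqP; congr Some; apply/eqP; rewrite eqn_leq h1.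
Qed.

Lemma F_St A t : G A -> F t (A `&` St t).
Proof.
move=> GA; rewrite (_ : A `&` St t = (A `&` [set w | le_etime (tau w) (Some t)])
   `&` [set w | le_etime (Some t) (theta w)]).
  by apply: (sub_algI _ (sF t)); [exact: sigma_at_FI|exact: F_theta_ge].
by apply/seteqP; split => w /= => [[? /andP[]]|[[? ?] ?]] //; split => //; exact/andP.
Qed.

Lemma F_St1 t : F t (St t).
Proof. by have := F_St [set: T] t (sub_algT _ sG); rewrite setTI. Qed.

Lemma adapted_measurable X : adapted P F X -> forall t, measurable_fun [set: T] (X t).
Proof. by move=> aX t; case: (aX t). Qed.

Lemma adapted_incr a : adapted P F a -> forall t, L0 P (F t) (incr a t).
Proof.
move=> aa [|t]; rewrite /incr.
  by apply: L0B => //; exact: L0_cst.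
by apply: L0B => //; exact: L0_le (leqnSn t) (aa t).
Qed.

(** A process cut down to the stochastic interval and weighted by a variable known
    at its left end: pairing with it computes conditional pairings. *)
Definition locf (x : T -> R) (X : process T R) : process T R :=
  fun t w => x w * (\1_(St t) w * X t w).

(** A variable known at [tau] is known at [t] once it is cut to an event on which
    [tau] has occurred by [t]. *)
Lemma mw_mul_cut (x : T -> R) (S : set T) t : (forall A, G A -> F t (A `&` S)) ->
  measurable_wrt G x -> measurable_wrt (F t) (fun w => x w * \1_S w).
Proof.
move=> GS mx B mB.
have GB : G (x @^-1` B) by exact: mx.
have FS : F t S by rewrite -[S]setTI; apply: GS; exact: sub_algT _ sG.
have [B0|B0] := pselect (B 0).
  rewrite (_ : _ @^-1` B = ((x @^-1` B) `&` S) `|` ~` S).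
    by apply: (sub_algU _ (sF t)); [exact: GS|apply: sub_algC].
  apply/seteqP; split => w /=.
    rewrite indicE; case: (boolP (w \in S)) => [/set_mem wS|/negP wS] /=.
      by rewrite mulr1; left.
    by move=> _; right => wS'; apply: wS; exact: mem_set.
  move=> [[xB wS]|wS]; rewrite indicE; first by rewrite mem_set// mulr1.
  by rewrite memNset// mulr0.
rewrite (_ : _ @^-1` B = (x @^-1` B) `&` S); first exact: GS.
apply/seteqP; split => w /=.
  rewrite indicE; case: (boolP (w \in S)) => [/set_mem wS|wS] /=.
    by rewrite mulr1.
  by rewrite mulr0.
by move=> [xB wS]; rewrite indicE mem_set// mulr1.
Qed.

Lemma mw_mul_tau (x : T -> R) t : measurable_wrt G x ->
  measurable_wrt (F t) (fun w => x w * \1_(St t) w).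
Proof. by apply: mw_mul_cut => A; exact: F_St. Qed.

Lemma locf_Rinf x X : measurable_wrt G x -> (exists M : R, forall w, `|x w| <= M) ->
  Rinf X -> Rinf (locf x X).
Proof.
move=> mx [M xM] [aX [m Xm]]; split.
  move=> t; rewrite /locf; under eq_fun do rewrite mulrA.
  by apply: L0M => //; apply: L0_mw => //; exact: mw_mul_tau.
exists (M * m); apply: filterS Xm => w Xw t.
rewrite /locf !normrM; apply: ler_pM => //.
rewrite indicE; case: (_ \in _); rewrite ?normr1 ?mul1r//.
by rewrite normr0 mul0r (le_trans _ (Xw t)).
Qed.

Lemma A1_incr_measurable a : A1 a -> forall t, measurable_fun [set: T] (incr a t).
Proof. by move=> [aa _] t; case: (adapted_incr _ aa t). Qed.

Lemma pairing_cvg X a : Rinf X -> A1 a ->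
  (\sum_(0 <= t < n) E (fun w => X t w * incr a t w)) @[n --> \oo] --> pairing P X a.
Proof.
move=> [aX [m Xm]] Aa.
have [_ h _ _] := pairing_series P X (incr a) m (adapted_measurable _ aX)
  (A1_incr_measurable _ Aa) Aa.2 Xm.
exact: h.
Qed.

Lemma pairing_integrable X a t : Rinf X -> A1 a ->
  integrable (fun w => X t w * incr a t w).
Proof.
move=> [aX [m Xm]] Aa.
by have [_ _ h _] := pairing_series P X (incr a) m (adapted_measurable _ aX)
  (A1_incr_measurable _ Aa) Aa.2 Xm.
Qed.

(** A pairing depends on the products of values and increments only, and linearly:
    this covers linearity in either argument. *)
Lemma pairing_comb (X Y Z a b c : process T R) (al be : R) :
  Rinf X -> Rinf Y -> Rinf Z -> A1 a -> A1 b -> A1 c ->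
  (\forall w \ae P, forall t, Z t w * incr c t w =
     al * (X t w * incr a t w) + be * (Y t w * incr b t w)) ->
  pairing P Z c = al * pairing P X a + be * pairing P Y b.
Proof.
move=> RX RY RZ Aa Ab Ac h.
have c1 := pairing_cvg _ _ RX Aa; have c2 := pairing_cvg _ _ RY Ab.
have c3 := pairing_cvg _ _ RZ Ac.
apply: (cvg_unique _ c3) => //.
have : (al * (\sum_(0 <= t < n) E (fun w => X t w * incr a t w))
   + be * (\sum_(0 <= t < n) E (fun w => Y t w * incr b t w))) @[n --> \oo] -->
   al * pairing P X a + be * pairing P Y b.
  apply: cvgD.
    by apply: (@cvgM _ _ _ _ (fun=> al) _ al); [exact: cvg_cst|exact: c1].
  by apply: (@cvgM _ _ _ _ (fun=> be) _ be); [exact: cvg_cst|exact: c2].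
apply: cvg_trans; apply: near_eq_cvg; apply: nearW => n /=.
rewrite !mulr_sumr -big_split /=; apply: eq_bigr => t _.
have i1 := pairing_integrable _ _ t RX Aa; have i2 := pairing_integrable _ _ t RY Ab.
have i3 := pairing_integrable _ _ t RZ Ac.
rewrite -!RintegralZl// -RintegralD//; [|exact: integrable_scale|exact: integrable_scale].
apply: ae_Rintegral_eq.
- by apply: measurable_funD; apply: measurable_funM => //; apply: (@integrable_measurable _ _ _ P).
- exact: integrable_measurable i3.
- by apply: filterS h => w ->.
Qed.

Lemma pairing_eq (X Y a b : process T R) : Rinf X -> Rinf Y -> A1 a -> A1 b ->
  (\forall w \ae P, forall t, X t w * incr a t w = Y t w * incr b t w) ->
  pairing P X a = pairing P Y b.
Proof.
move=> RX RY Aa Ab h; rewrite (pairing_comb Y Y X b b a 1 0)// ?mul1r ?mul0r ?addr0//.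
by apply: filterS h => w e t; rewrite e mul1r mul0r addr0.
Qed.

Lemma pairing_ge0 X a : Rinf X -> A1 a ->
  (\forall w \ae P, forall t, 0 <= X t w * incr a t w) -> 0 <= pairing P X a.
Proof.
move=> RX Aa h; have c := pairing_cvg _ _ RX Aa.
apply: cvg_ge c => n; apply: sumr_ge0 => t _; apply: ae_Rintegral_ge0.
  exact: integrable_measurable (pairing_integrable _ _ t RX Aa).
by apply: filterS h => w.
Qed.

Lemma Rinf_cst (c : R) : Rinf (fun _ _ => c).
Proof.
split; first by move=> t; exact: L0_cst.
by exists `|c|; apply: aeW.
Qed.

(** Testing a conditional pairing against [x] amounts to multiplying the process
    by [x] before pairing. *)
Lemma cpairing_spec X a : Rinf X -> A1 a ->
  [/\ measurable_wrt G (cpairing X a), integrable (cpairing X a) &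
   forall x, measurable_wrt G x -> (exists M : R, forall w, `|x w| <= M) ->
     E (fun w => x w * cpairing X a w) = pairing P (locf x X) a].
Proof.
move=> RX Aa.
pose Y w := (\sum_(0 <= t <oo | le_etime (tau w) (Some t) && le_etime (Some t) (theta w))
                (X t w * incr a t w)%:E)%E.
have RL : Rinf (locf (fun=> 1) X).
  by apply: locf_Rinf => //; [exact: mw_cst|exists 1 => w; rewrite normr1].
have YE w : Y w = (\sum_(0 <= t <oo) (locf (fun=> 1) X t w * incr a t w)%:E)%E.
  rewrite /Y eseries_mkcond; apply: eq_eseriesr => t _.
  rewrite /locf mul1r indicE /St.
  case: ifPn => h; first by rewrite mem_set// mul1r.
  by rewrite memNset ?mul0r ?mul0r//; exact/negP.
have [[aL [m Lm]] [aX [mX Xm]]] := (RL, RX).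
have [iY _ _ Ycv] := pairing_series P _ (incr a) m (adapted_measurable _ aL)
  (A1_incr_measurable _ Aa) Aa.2 Lm.
have {}iY : P.-integrable [set: T] Y by apply: eq_integrable iY => // w _; rewrite YE.
have Yfin : \forall w \ae P, Y w \is a fin_num by apply: filterS Ycv => w []; rewrite YE.
pose Yr := fine \o Y.
have mY := measurable_int _ iY.
have mYr : measurable_fun [set: T] Yr by exact: measurableT_comp.
have iYr : integrable Yr.
  apply/integrableP; split; first exact/measurable_EFinP.
  have /integrableP [_] := iY; apply: le_lt_trans; apply: ge0_le_integral => //.
  - by apply: measurableT_comp => //; exact/measurable_EFinP.
  - exact: measurableT_comp.
  - by move=> w _; rewrite /= /Yr /=; case: (Y w) => //= *; rewrite normr0 leey.
have YYr : \forall w \ae P, Y w = (EFin \o Yr) w.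
  by apply: filterS Yfin => w h; rewrite /= /Yr /= fineK.
have [Z [mZ iZ ZE]] := is_condexp_exists _ _ sG GM _ iYr.
have hex : is_condexp P G Y (cpairing X a).
  apply: xgetPex; exists Z; split => // A GA; rewrite ZE//.
  apply: ae_eq_integral => //.
  - exact: GM.
  - by apply: measurable_funTS; exact/measurable_EFinP.
  - exact: measurable_funTS.
  - by apply: filterS YYr => w h _; exact: esym h.
have [mc ic cE] := hex; split => // x mx xM.
have hex' : is_condexp P G (EFin \o Yr) (cpairing X a).
  split => // A GA; rewrite cE//; apply: ae_eq_integral => //.
  - exact: GM.
  - exact: measurable_funTS.
  - by apply: measurable_funTS; exact/measurable_EFinP.
  - by apply: filterS YYr => w h _; exact: h.
rewrite (condexp_pull _ _ sG GM _ _ _ iYr hex' mx xM).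
rewrite /pairing /Rintegral; congr fine.
have Rx := locf_Rinf _ _ mx xM RX.
have [aLx [mx' Lmx]] := Rx.
have [iYx _ _ Yxfin] := pairing_series P _ (incr a) mx' (adapted_measurable _ aLx)
  (A1_incr_measurable _ Aa) Aa.2 Lmx.
apply: ae_eq_integral => //.
- by apply/measurable_EFinP; apply: measurable_funM => //; exact: mw_measurable mx.
- exact: measurable_int iYx.
apply: filterS2 YYr Ycv => w YwE [Ywcv _] _.
rewrite EFinM -[(Yr w)%:E]/((EFin \o Yr) w) -YwE YE.
have hcv := cvgeZl (y := (x w)%:E) isT Ywcv.
rewrite -[LHS](cvg_lim _ hcv)//.
congr (limn _); apply/funext => n; rewrite !sumEFin -EFinM mulr_sumr; congr EFin.
by apply: eq_bigr => t _; rewrite /locf mul1r !mulrA.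
Qed.

Lemma bounded_indic (A : set T) : exists M : R, forall w, `|\1_A w : R| <= M.
Proof. by exists 1 => w; case: (indic01 R A w) => ->; rewrite ?normr0 ?normr1. Qed.

Lemma indicSt_in t w : St t w -> (\1_(St t) w : R) = 1.
Proof. by move=> h; rewrite indicE mem_set. Qed.

Lemma indicSt_notin t w : ~ St t w -> (\1_(St t) w : R) = 0.
Proof. by move=> h; rewrite indicE memNset. Qed.

Lemma Linf_bounded_mw x : measurable_wrt G x -> (exists M : R, forall w, `|x w| <= M) ->
  Linf P G x.
Proof.
move=> mx [M xM]; split; first exact: L0_mw.
by exists M; apply: aeW.
Qed.

Lemma integrable_bounded_mw (x : T -> R) : measurable_wrt G x ->
  (exists M : R, forall w, `|x w| <= M) -> integrable x.
Proof.
by move=> mx xM; apply: bm_integrable; split => //; exact: mw_measurable mx.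
Qed.

Lemma bounded_mul (x y : T -> R) : (exists M : R, forall w, `|x w| <= M) ->
  (exists M : R, forall w, `|y w| <= M) -> exists M : R, forall w, `|x w * y w| <= M.
Proof.
by move=> [M xM] [N yN]; exists (M * N) => w; rewrite normrM ler_pM.
Qed.

(** By [cpairing_spec], the right-hand side of the hypothesis is the integral of the
    conditional pairing over [A]. *)
Lemma cpairing_geP (z : T -> R) X a : Rinf X -> A1 a -> Linf P G z ->
  (forall A, G A -> E (fun w => \1_A w * z w) <= pairing P (locf \1_A X) a) ->
  \forall w \ae P, z w <= cpairing X a w.
Proof.
move=> RX Aa Lz h; have [z' [M [mz' z'M zz']]] := Linf_version P G sG z Lz.
move: (cpairing X a) (cpairing_spec X a RX Aa) => cX [mc ic cE].
have mz : measurable_fun [set: T] z by case: Lz => [] [].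
suff : \forall w \ae P, z' w <= cX w.
  by apply: filterS2 zz' => w ->.
have iz' : integrable z' by apply: integrable_bounded_mw => //; exists M.
apply: (ae_le_of_integrals P G sG GM _ _ mz' mc iz' ic) => A GA; rewrite cE; [|exact: mw_indic|exact: bounded_indic].
apply: le_trans (h _ GA); rewrite le_eqVlt; apply/orP; left; apply/eqP.
have mA : measurable_fun [set: T] (\1_A : T -> R) by apply: measurable_indic; exact: GM.
apply: ae_Rintegral_eq.
- by apply: measurable_funM => //; exact: mw_measurable mz'.
- by apply: measurable_funM.
- by apply: filterS zz' => w ->.
Qed.

(** The conditional form of [pairing_comb]: it is enough to know the products on
    the stochastic interval, and the coefficients may be known at [tau]. *)
Lemma cpairing_comb (X Y Z a b c : process T R) (x y : T -> R) :
  Rinf X -> Rinf Y -> Rinf Z -> A1 a -> A1 b -> A1 c -> Linf P G x -> Linf P G y ->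
  (\forall w \ae P, forall t, St t w -> Z t w * incr c t w =
     x w * (X t w * incr a t w) + y w * (Y t w * incr b t w)) ->
  \forall w \ae P, cpairing Z c w = x w * cpairing X a w + y w * cpairing Y b w.
Proof.
move=> RX RY RZ Aa Ab Ac Lx Ly h.
have [x' [Mx [mx x'M xx']]] := Linf_version P G sG x Lx.
have [y' [My [my y'M yy']]] := Linf_version P G sG y Ly.
have bx : exists M : R, forall w, `|x' w| <= M by exists Mx.
have by_ : exists M : R, forall w, `|y' w| <= M by exists My.
move: (cpairing X a) (cpairing_spec X a RX Aa) => cX [mX iX XE].
move: (cpairing Y b) (cpairing_spec Y b RY Ab) => cY [mY iY YE].
move: (cpairing Z c) (cpairing_spec Z c RZ Ac) => cZ [mZ iZ ZE].
pose W w := x' w * cX w + y' w * cY w.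
have mW : measurable_wrt G W by apply: mwD => //; apply: mwM.
have bmx : bm x' by split => //; exact: mw_measurable mx.
have bmy : bm y' by split => //; exact: mw_measurable my.
have i1 : integrable (fun w => x' w * cX w) by exact: integrableMbm.
have i2 : integrable (fun w => y' w * cY w) by exact: integrableMbm.
have iW : integrable W.
  rewrite (_ : EFin \o W = (EFin \o (fun w => x' w * cX w)%R) \+
    (EFin \o (fun w => y' w * cY w)%R))%E; first exact: integrableD.
  by apply/funext.
have key A : G A -> E (fun w => \1_A w * cZ w) = E (fun w => \1_A w * W w).
  move=> GA; have mA : measurable_wrt G (\1_A : T -> R) by exact: mw_indic.
  have bA := bounded_indic A.
  have bmA : bm (\1_A : T -> R) by split => //; exact: mw_measurable mA.
  have mAx : measurable_wrt G (fun w => \1_A w * x' w) by exact: mwM.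
  have mAy : measurable_wrt G (fun w => \1_A w * y' w) by exact: mwM.
  have bAx := bounded_mul _ _ bA bx. have bAy := bounded_mul _ _ bA by_.
  rewrite ZE//.
  rewrite (pairing_comb (locf (fun w => \1_A w * x' w) X) (locf (fun w => \1_A w * y' w) Y)
    (locf \1_A Z) a b c 1 1)//; do ?exact: locf_Rinf.
    have e1 := XE _ mAx bAx; have e2 := YE _ mAy bAy.
    rewrite !mul1r -e1 -e2.
    rewrite -RintegralD//; last 2 first.
    - by apply: integrableMbm => //; exact: bmM.
    - by apply: integrableMbm => //; exact: bmM.
    by apply: eq_Rintegral => w _; rewrite /W mulrDr !mulrA.
  apply: filterS3 h xx' yy' => w hw hx hy t.
  have [wS|wS] := pselect (St t w); last first.
    by rewrite /locf indicSt_notin//; ring.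
  rewrite /locf indicSt_in// !mul1r -mulrA hw// hx hy; ring.
have h3 : \forall w \ae P, cZ w = W w by exact: (ae_eq_of_integrals P G sG GM).
by apply: filterS3 h3 xx' yy' => w -> -> ->.
Qed.

Lemma cpairing_ge0 X a : Rinf X -> A1 a ->
  (\forall w \ae P, forall t, St t w -> 0 <= X t w * incr a t w) ->
  \forall w \ae P, 0 <= cpairing X a w.
Proof.
move=> RX Aa h; apply: (cpairing_geP (fun=> 0)) => //.
  by apply: Linf_bounded_mw; [exact: mw_cst|exists 0 => w; rewrite normr0].
move=> A GA; rewrite E_mul0.
apply: pairing_ge0 => //.
  by apply: locf_Rinf => //; [exact: mw_indic|exact: bounded_indic].
apply: filterS h => w h t; rewrite /locf.
have [wS|wS] := pselect (St t w); last by rewrite indicSt_notin// mul0r mulr0 mul0r.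
rewrite indicSt_in// mul1r -mulrA; apply: mulr_ge0; last exact: h.
by case: (indic01 R A w) => ->.
Qed.

(** * Increments of densities *)

Local Notation D := (densities P F tau theta).
Local Notation proj := (proj_process tau theta).

Lemma sum_incr (a : process T R) n w : \sum_(0 <= t < n.+1) incr a t w = a n w.
Proof.
elim: n => [|n IH]; first by rewrite big_nat1 /incr subr0.
by rewrite big_nat_recr//= IH /incr addrC subrK.
Qed.

(** Projection moves the value at [tau] into a single increment at [tau] and
    stops the increments after [theta]. *)
Lemma incr_proj (Y : process T R) n t w : tau w = Some n ->
  le_etime (tau w) (theta w) ->
  incr (proj Y) t w = if (t < n)%N then 0 else if t == n then Y n w
    else if le_etime (Some t) (theta w) then incr Y t w else 0.
Proof.
move=> tn; rewrite tn => nth; rewrite /incr /proj_process tn /=.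
have mn : min_etime n (theta w) = n.
  by move: nth; rewrite /min_etime; case: (theta w) => //= k /minn_idPl.
case: t => [|t].
  case: n tn nth mn => [|n] tn nth mn //=; last by rewrite subr0.
  by rewrite mn subr0.
have [tn'|nt|tE] := ltngtP t.+1 n.
- by rewrite leqNgt (ltn_trans _ tn')//= subrr.
- rewrite -ltnS nt; move: nt; rewrite ltnS => nt.
  rewrite /min_etime; case: (theta w) => [k|] //=.
  have [tk|kt] := leqP t.+1 k; first by rewrite (minn_idPl (ltnW tk)).
  by rewrite (minn_idPr _) ?subrr// -ltnS.
- by rewrite -tE ltnn subr0 tE mn.
Qed.

Lemma sum_incr_le (Y : process T R) n w : (forall t, 0 <= incr Y t w) ->
  ((Y n w)%:E <= \sum_(0 <= t <oo) (`|incr Y t w|)%:E)%E.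
Proof.
move=> Y0; apply: (@le_trans _ _ (\sum_(0 <= t < n.+1) (`|incr Y t w|)%:E)%E).
  rewrite sumEFin lee_fin -sum_incr; apply: ler_sum => t _; exact: ler_norm.
by apply: nneseries_lim_ge => t _ _; rewrite lee_fin.
Qed.

Lemma A1pos_process_ge0 (Y : process T R) n w : (forall t, 0 <= incr Y t w) -> 0 <= Y n w.
Proof. by move=> Y0; rewrite -sum_incr; apply: sumr_ge0. Qed.

Lemma eq_process_incr (a b : process T R) : eq_process P a b ->
  \forall w \ae P, forall t, incr a t w = incr b t w.
Proof. by apply: filterS => w h [|t]; rewrite /incr !h. Qed.

Lemma A1pos_on_incr a : A1pos_on P F tau theta a ->
  \forall w \ae P, forall t, 0 <= incr a t w /\ (~ St t w -> incr a t w = 0).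
Proof.
move=> [aa [Y [AY Y0] aY]].
apply: filterS3 (eq_process_incr _ _ aY) Y0 (filterI htau_fin htau_theta) =>
  w ha hY [tfin tth] t.
rewrite ha; case tn : (tau w) tfin => [n|] // _.
rewrite (incr_proj Y n t w tn tth).
have [tn'|nt|tE] := ltngtP t n.
- by split.
- have [th|th] := boolP (le_etime (Some t) (theta w)); last by split.
  by split=> // nS; case: nS; rewrite /St /= tn /= (ltnW nt).
- split; first exact: A1pos_process_ge0.
  by move=> nS; case: nS; rewrite /St /= tE tn /= leqnn /=; move: tth; rewrite tn.
Qed.

Lemma variation_measurable a : adapted P F a ->
  measurable_fun [set: T] (fun w => (\sum_(0 <= t <oo) `|incr a t w|%:E)%E).
Proof.
move=> aa; apply: ge0_emeasurable_sum => [t w _ _|t _]; first by rewrite lee_fin.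
by apply/measurable_EFinP; apply: measurableT_comp => //; case: (adapted_incr _ aa t).
Qed.

Lemma variation_ge0 (a : process T R) w : (0 <= \sum_(0 <= t <oo) `|incr a t w|%:E)%E.
Proof. by apply: nneseries_ge0 => t _ _; rewrite lee_fin. Qed.

Lemma A1_eq a b : A1 a -> (forall t, measurable_fun [set: T] (b t)) -> eq_process P a b -> A1 b.
Proof.
move=> [aa afin] mb ab; have ab_ : adapted P F b.
  move=> t; have abt : \forall w \ae P, a t w = b t w by apply: filterS ab => w.
  exact: (L0_ae P (F t) (a t) (b t) (mb t) abt (aa t)).
split=> //; apply: le_lt_trans afin; rewrite le_eqVlt; apply/orP; left; apply/eqP.
apply: ae_eq_integral => //; [exact: variation_measurable|exact: variation_measurable|].
apply: filterS (eq_process_incr _ _ ab) => w h _.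
by apply: eq_eseriesr => t _; rewrite h.
Qed.

Lemma incr_add (a b : process T R) t w :
  incr (fun s v => a s v + b s v) t w = incr a t w + incr b t w.
Proof. by rewrite /incr; case: t => [|t]; ring. Qed.

Lemma A1_add a b : A1 a -> A1 b -> A1 (fun t w => a t w + b t w).
Proof.
move=> Aa Ab; have [[aa afin] [ab bfin]] := (Aa, Ab).
have aab : adapted P F (fun t w => a t w + b t w).
  by move=> t; exact: (L0D P (F t) (sF t) _ _ (aa t) (ab t)).
split => //.
apply: (@le_lt_trans _ _ (\int[P]_w (\sum_(0 <= t <oo) `|incr a t w|%:E + \sum_(0 <= t <oo) `|incr b t w|%:E))%E).
  apply: ge0_le_integral => //.
  - by move=> w _; exact: variation_ge0.
  - exact: (variation_measurable (fun t w => a t w + b t w) aab).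
  - by apply: emeasurable_funD; exact: variation_measurable.
  move=> w _; rewrite -nneseriesD; [|by move=> t _ _; rewrite lee_fin|by move=> t _ _; rewrite lee_fin].
  apply: lee_nneseries => t _ //; rewrite -EFinD lee_fin.
  by rewrite incr_add ler_normD.
rewrite ge0_integralD//; last 4 first.
- by move=> w _; exact: variation_ge0.
- exact: variation_measurable.
- by move=> w _; exact: variation_ge0.
- exact: variation_measurable.
exact: lte_add_pinfty.
Qed.

Lemma A1pos_on_A1 a : A1pos_on P F tau theta a -> A1 a.
Proof.
move=> pa; have hincr := A1pos_on_incr _ pa.
have [aa [Y [[aY YA] Y0] aYp]] := pa; split => //.
apply: le_lt_trans YA; apply: ae_ge0_le_integral => //.
- by move=> w _; exact: variation_ge0.
- exact: variation_measurable.
- by move=> w _; exact: variation_ge0.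
- exact: variation_measurable.
apply: filterS3 hincr aYp Y0 => w ha haY hY _.
apply: lime_le; first by apply: is_cvg_nneseries => t _ _; rewrite lee_fin.
apply: nearW => -[|n].
  by rewrite big_nil; exact: variation_ge0.
rewrite (eq_bigr (fun t => (incr a t w)%:E)); last first.
  by move=> t _; rewrite ger0_norm//; case: (ha t).
rewrite sumEFin sum_incr haY /proj_process; case: ifP => _; first exact: sum_incr_le.
by apply: nneseries_ge0 => t _ _; rewrite lee_fin.
Qed.

Lemma density_A1 a : D a -> A1 a.
Proof. by move=> [pa _]; exact: A1pos_on_A1. Qed.

Lemma density_incr a : D a ->
  \forall w \ae P, forall t, 0 <= incr a t w /\ (~ St t w -> incr a t w = 0).
Proof. by move=> [pa _]; exact: A1pos_on_incr. Qed.

(** A process without increments outside the interval is its own projection. *)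
Lemma density_of_incr a : A1 a ->
  (\forall w \ae P, forall t, 0 <= incr a t w /\ (~ St t w -> incr a t w = 0)) ->
  (\forall w \ae P, cpairing (fun _ _ => 1) a w = 1) -> D a.
Proof.
move=> Aa h h1; split => //; have [aa _] := Aa; split => //.
exists a.
  by split => //; apply: filterS h => w hw t; case: (hw t).
apply: filterS3 h htau_fin htau_theta => w hw tfin tth t.
case tn : (tau w) tfin => [n|] // _; rewrite /proj_process tn /=.
have zero s : ~ St s w -> incr a s w = 0 by case: (hw s).
have [nt|tn'] := leqP n t; last first.
  rewrite -sum_incr big_nat big1// => s /= st; apply: zero.
  rewrite /St /= tn /= => /andP[ns _].
  by move: (leq_ltn_trans ns st); rewrite ltnNge tn'.
rewrite /min_etime; case thE : (theta w) => [k|] //.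
have [//|kt] := leqP t k.
have stop j : a (k + j)%N w = a k w.
  elim: j => [|j IH]; first by rewrite addn0.
  rewrite addnS -IH; apply/eqP; rewrite -subr_eq0.
  rewrite -[X in X == _]/(incr a (k + j).+1 w) zero//.
  by rewrite /St /= thE /= => /andP[_]; rewrite ltnNge leq_addr.
by rewrite -(subnKC (ltnW kt)) stop.
Qed.

Lemma density_one a : D a -> \forall w \ae P, cpairing (fun _ _ => 1) a w = 1.
Proof. by case. Qed.

Local Notation Ron := (Rinf_on P F tau theta).
Local Notation tau_le t w := (le_etime (tau w) (Some t)).

(** * Processes on the stochastic interval *)

Lemma indicb (b : T -> bool) w : (\1_[set v | b v] w : R) = (b w)%:R.
Proof. by rewrite indicE; congr (nat_of_bool _)%:R; apply/idP/idP => [/set_mem|/mem_set]. Qed.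

(** The stopped value is a finite sum over the possible values of [theta] before [t]. *)
Lemma proj_adapted X : adapted P F X -> adapted P F (proj X).
Proof.
move=> aX t.
pose Eq s := [set w | theta w == Some s].
have -> : proj X t = fun w => \1_[set w | tau_le t w] w *
   ((\sum_(s < t) \1_(Eq s) w * X s w) + \1_[set w | le_etime (Some t) (theta w)] w * X t w).
  apply/funext => w.
  rewrite /proj_process !indicb; case: (tau_le t w); rewrite ?mul0r// mul1r.
  under eq_bigr do rewrite indicb.
  case: (theta w) => [n|] /=; last first.
    by rewrite big1 ?add0r ?mul1r// => s _; rewrite mul0r.
  have [tn|nt] := leqP t n.
    rewrite mul1r big1 ?add0r// => s _.
    rewrite (_ : _ == _ = false) ?mul0r//; apply/eqP => -[ns].
    by move: (ltn_ord s); rewrite -ns ltnNge tn.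
  rewrite mul0r addr0 (bigD1 (Ordinal nt))//= eqxx mul1r big1 ?addr0// => s.
  move=> sn; rewrite (_ : _ == _ = false) ?mul0r//; apply/eqP => -[ns].
  by move: sn; rewrite -val_eqE /= ns eqxx.
apply: L0M; [exact: sF|by apply: L0_indic; [exact: sF|exact: FM|exact: htau]|].
apply: L0D => //; last first.
  by apply: L0M => //; apply: L0_indic => //; exact: F_theta_ge.
have h (k : nat) : (k <= t)%N -> L0 P (F t) (fun w => \sum_(s < k) \1_(Eq s) w * X s w).
  elim: k => [|k IH] kt; first by under eq_fun do rewrite big_ord0; exact: L0_cst.
  under eq_fun do rewrite big_ord_recr /=.
  apply: L0D => //; first by apply: IH; exact: ltnW.
  by apply: (L0_le k); [exact: ltnW|apply: L0M => //; apply: L0_indic => //; exact: F_theta_eq].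
exact: h.
Qed.

Lemma proj_bounded (X : process T R) m w : (forall t, `|X t w| <= m) -> forall t, `|proj X t w| <= m.
Proof.
move=> Xm t; rewrite /proj_process; case: ifP => _ //.
by rewrite normr0 (le_trans _ (Xm 0%N)).
Qed.

Lemma proj_Rinf X : Rinf X -> Rinf (proj X).
Proof.
move=> [aX [m Xm]]; split; first exact: proj_adapted.
by exists m; apply: filterS Xm => w; exact: proj_bounded.
Qed.

Lemma proj_Ron X : Rinf X -> Ron (proj X).
Proof.
move=> RX; split; first by case: (proj_Rinf _ RX).
by exists X => //; apply: aeW.
Qed.

Lemma proj_idem (X : process T R) w : le_etime (tau w) (theta w) ->
  forall t, proj (proj X) t w = proj X t w.
Proof.
move=> tth t; rewrite /proj_process; case: ifP => // tt.
rewrite (_ : le_etime _ _ = true).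
  congr (X _ w); case: (theta w) => //= n.
  by apply/minn_idPl; exact: geq_minr.
by move: tth tt; case: (tau w) => //= n; case: (theta w) => //= k; rewrite leq_min => -> ->.
Qed.

Lemma RonP X : Ron X <-> Rinf X /\ eq_process P X (proj X).
Proof.
split=> [[aX [Y RY XY]]|[RX Xp]]; last by split; [case: RX|exists X].
split.
  split=> //; have [_ [m Ym]] := RY; exists m.
  by apply: filterS2 Ym XY => w h e t; rewrite e; exact: proj_bounded.
apply: filterS2 XY htau_theta => w e tth t; rewrite e -proj_idem//.
by rewrite /proj_process; case: ifP => // _; rewrite e.
Qed.

Lemma Ron_Rinf X : Ron X -> Rinf X.
Proof. by move=> /RonP[]. Qed.

Lemma LinfD x y : Linf P G x -> Linf P G y -> Linf P G (fun w => x w + y w).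
Proof.
move=> [Lx [m xm]] [Ly [n yn]]; split; first exact: L0D.
exists (m + n); apply: filterS2 xm yn => w h k.
by apply: le_trans (ler_normD _ _) _; exact: lerD.
Qed.

Lemma LinfM x y : Linf P G x -> Linf P G y -> Linf P G (fun w => x w * y w).
Proof.
move=> [Lx [m xm]] [Ly [n yn]]; split; first exact: L0M.
by exists (m * n); apply: filterS2 xm yn => w h k; rewrite normrM ler_pM.
Qed.

Lemma Linf_cst c : Linf P G (fun=> c).
Proof. by split; [exact: L0_cst|exists `|c|; apply: aeW]. Qed.

Lemma LinfB x y : Linf P G x -> Linf P G y -> Linf P G (fun w => x w - y w).
Proof.
move=> Lx Ly; rewrite (_ : (fun _ => _) = fun w => x w + (-1) * y w).
  by apply: LinfD => //; apply: LinfM => //; exact: Linf_cst.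
by apply/funext => w; rewrite mulN1r.
Qed.

Lemma Linf_indic A : G A -> Linf P G (\1_A : T -> R).
Proof. by move=> GA; apply: Linf_bounded_mw; [exact: mw_indic|exact: bounded_indic]. Qed.

Lemma Linf_measurable x : Linf P G x -> measurable_fun [set: T] x.
Proof. by case=> -[]. Qed.

Lemma Ron_mul X x : Ron X -> Linf P G x -> Ron (fun t w => x w * X t w).
Proof.
move=> /RonP [[aX [m Xm]] Xp] Lx; have mx := Linf_measurable _ Lx.
apply/RonP; split; last first.
  apply: filterS Xp => w e t; rewrite e /proj_process; case: ifP; rewrite ?mulr0//.
have [x' [M [mx' _ xx']]] := Linf_version P G sG x Lx.
have [_ [m' xm']] := Lx.
split; last by exists (m' * m); apply: filterS2 xm' Xm => w h k t; rewrite normrM ler_pM.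
move=> t; apply: (L0_ae _ _ (fun w => (x' w * \1_[set v | tau_le t v] w) * X t w)).
- by apply: measurable_funM => //; case: (aX t).
- apply: filterS2 xx' Xp => w -> e; rewrite indicb e /proj_process.
  by case: ifP => _; rewrite ?mulr1// !mulr0.
- apply: L0M => //; apply: L0_mw => //; apply: mw_mul_cut => // A; exact: sigma_at_FI.
Qed.

Lemma Ron_add X Y : Ron X -> Ron Y -> Ron (fun t w => X t w + Y t w).
Proof.
move=> /RonP [[aX [m Xm]] Xp] /RonP [[aY [n Yn]] Yp]; apply/RonP; split; [split|].
- by move=> t; exact: (L0D P (F t) (sF t) _ _ (aX t) (aY t)).
- exists (m + n); apply: filterS2 Xm Yn => w h k t.
  by apply: le_trans (ler_normD _ _) _; exact: lerD.
- apply: filterS2 Xp Yp => w h k t; rewrite h k /proj_process.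
  by case: ifP => tt; rewrite ?addr0// h k /proj_process tt.
Qed.

Lemma Ron_comb X Y x y : Ron X -> Ron Y -> Linf P G x -> Linf P G y ->
  Ron (fun t w => x w * X t w + y w * Y t w).
Proof. by move=> RX RY Lx Ly; apply: Ron_add; exact: Ron_mul. Qed.

(** The process [1_{[tau, oo)}] used in translations. *)
Definition unit_process : process T R := fun t w => (tau_le t w)%:R.

Lemma Ron_unit : Ron unit_process.
Proof.
rewrite (_ : unit_process = proj (fun _ _ => 1)); first by apply: proj_Ron; exact: Rinf_cst.
by apply/funext => t; apply/funext => w; rewrite /proj_process /unit_process; case: ifP.
Qed.

Lemma unit_St t w : St t w -> unit_process t w = 1.
Proof. by rewrite /St /unit_process /= => /andP[-> _]. Qed.

Lemma Rinf_comb X Y (x y : R) : Rinf X -> Rinf Y -> Rinf (fun t w => x * X t w + y * Y t w).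
Proof.
move=> [aX [m Xm]] [aY [n Yn]]; split.
  move=> t; apply: (L0D P (F t) (sF t)).
    by apply: (L0M P (F t) (sF t) (fun=> x)); [exact: L0_cst|exact: aX].
  by apply: (L0M P (F t) (sF t) (fun=> y)); [exact: L0_cst|exact: aY].
exists (`|x| * m + `|y| * n); apply: filterS2 Xm Yn => w h k t.
apply: le_trans (ler_normD _ _) _; rewrite !normrM.
by apply: lerD; apply: ler_wpM2l.
Qed.

Lemma cpairing_combl a X Y Z x y : A1 a -> Rinf X -> Rinf Y -> Rinf Z -> Linf P G x -> Linf P G y ->
  (\forall w \ae P, forall t, St t w -> Z t w = x w * X t w + y w * Y t w) ->
  \forall w \ae P, cpairing Z a w = x w * cpairing X a w + y w * cpairing Y a w.
Proof.
move=> Aa RX RY RZ Lx Ly h; apply: cpairing_comb => //.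
by apply: filterS h => w h t St; rewrite h// mulrDl !mulrA.
Qed.

Lemma cpairing_le a X Y : D a -> Rinf X -> Rinf Y -> le_process P X Y ->
  \forall w \ae P, cpairing X a w <= cpairing Y a w.
Proof.
move=> Da RX RY XY; have Aa := density_A1 _ Da.
have RZ := Rinf_comb Y X 1 (-1) RY RX.
have := cpairing_combl a Y X _ (fun=> 1) (fun=> -1) Aa RY RX RZ (Linf_cst _) (Linf_cst _).
have := cpairing_ge0 _ a RZ Aa.
move: (cpairing _ _) (cpairing X a) (cpairing Y a) => cZ cX cY h1 h2.
have {}h1 : \forall w \ae P, 0 <= cZ w.
  apply: h1; apply: filterS2 XY (density_incr _ Da) => w h k t _.
  apply: mulr_ge0; last by case: (k t).
  by rewrite mul1r mulN1r subr_ge0.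
have {}h2 : \forall w \ae P, cZ w = 1 * cY w + -1 * cX w by apply: h2; exact: aeW.
by apply: filterS2 h1 h2 => w h k; move: h; rewrite k; lra.
Qed.

Lemma cpairing_cst a c : D a -> \forall w \ae P, cpairing (fun _ _ => c) a w = c.
Proof.
move=> Da; have Aa := density_A1 _ Da.
have R1 := Rinf_cst 1; have Rc := Rinf_cst c.
have := cpairing_combl a _ _ _ (fun=> c) (fun=> 0) Aa R1 R1 Rc (Linf_cst _) (Linf_cst _).
move: (density_one _ Da); move: (cpairing _ _) (cpairing _ _) => cc c1 h1 h.
have {}h : \forall w \ae P, cc w = c * c1 w + 0 * c1 w.
  by apply: h; apply: aeW => w t _; rewrite mulr1 mul0r addr0.
by apply: filterS2 h1 h => w -> ->; rewrite mulr1 mul0r addr0.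
Qed.

Lemma cpairing_bound a X m : D a -> Rinf X -> (\forall w \ae P, forall t, `|X t w| <= m) ->
  \forall w \ae P, `|cpairing X a w| <= m.
Proof.
move=> Da RX Xm.
have := cpairing_le a _ _ Da RX (Rinf_cst m).
have := cpairing_le a _ _ Da (Rinf_cst (- m)) RX.
move: (cpairing_cst a m Da) (cpairing_cst a (- m) Da).
move: (cpairing (fun _ _ => m) a) (cpairing (fun _ _ => - m) a) (cpairing X a).
move=> c1 c2 c3 h1 h2 h3 h4.
have {}h3 : \forall w \ae P, c2 w <= c3 w.
  by apply: h3; apply: filterS Xm => w h t; have := h t; rewrite ler_norml => /andP[].
have {}h4 : \forall w \ae P, c3 w <= c1 w.
  by apply: h4; apply: filterS Xm => w h t; have := h t; rewrite ler_norml => /andP[].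
apply: filterS2 (filterI h1 h2) (filterI h3 h4) => w [e1 e2] [h5 h6].
by rewrite ler_norml -e2 h5 -e1 h6.
Qed.

Lemma Ron_translation X m : Ron X -> Linf P G m ->
  Ron (fun t w => X t w + m w * unit_process t w).
Proof. by move=> RX Lm; apply: Ron_add => //; apply: Ron_mul Lm; exact: Ron_unit. Qed.

Lemma cpairing_translation X a m : Ron X -> D a -> Linf P G m ->
  \forall w \ae P, cpairing (fun t v => X t v + m v * unit_process t v) a w = cpairing X a w + m w.
Proof.
move=> RX Da Lm; pose Z : process T R := fun t v => X t v + m v * unit_process t v; rewrite -/Z.
have RZ := Ron_Rinf _ (Ron_translation X m RX Lm); have RX' := Ron_Rinf _ RX.
have Aa := density_A1 _ Da.
have := cpairing_combl a X _ Z (fun=> 1) m Aa RX' (Rinf_cst 1) RZ (Linf_cst _) Lm.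
move: (density_one _ Da).
move: (cpairing (fun _ _ => 1) a) (cpairing X a) (cpairing Z a) => c1 cX cZ h1 h.
have {}h : \forall w \ae P, cZ w = 1 * cX w + m w * c1 w.
  by apply: h; apply: aeW => w t wS; rewrite /Z unit_St//; ring.
by apply: filterS2 h h1 => w -> ->; rewrite mul1r mulr1.
Qed.

(** * Approximation of essential infima by finite minima *)

(** Properties of [B] that are stable under minima of two functions hold here by
    induction. *)
Inductive finite_min (B : set (T -> R)) : (T -> R) -> Prop :=
| finite_min1 f : B f -> finite_min B f
| finite_min2 f g : finite_min B f -> finite_min B g ->
    finite_min B (fun w => Num.min (f w) (g w)).

Lemma finite_min_bounded (B : set (T -> R)) (m : R) :
  (forall f, B f -> measurable_wrt G f /\ \forall w \ae P, `|f w| <= m) ->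
  forall f, finite_min B f -> measurable_wrt G f /\ \forall w \ae P, `|f w| <= m.
Proof.
move=> hB f; elim => [{}f /hB //|{}f g _ [mf fm] _ [mg gm]]; split; first exact: mw_min.
by apply: filterS2 fm gm => w h k; rewrite /Num.min; case: ifP.
Qed.

Lemma bounded_limit (fs : nat -> T -> R) (m : R) : 0 <= m -> (forall n, L0 P G (fs n)) ->
  (\forall w \ae P, forall n, `|fs n w| <= m) -> (\forall w \ae P, cvgn (fun n => fs n w)) ->
  exists z : T -> R, [/\ measurable_wrt G z, forall w, `|z w| <= m &
    \forall w \ae P, fs n w @[n --> \oo] --> z w].
Proof.
move=> m0 Lf fm fcv.
have /choice [gs gsP] : forall n, exists g,
    [/\ measurable_wrt G g, forall w, `|g w| <= m & \forall w \ae P, fs n w = g w].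
  move=> n; rewrite -(ger0_norm m0); apply: L0_version => //.
  by apply: filterS fm => w.
have [|n w|z [zs [[mz zm] _ _ _ zlim]]] := @cvg_limn_sup_ae _ (g_sigma_algebraType G) R gs m.
- by move=> n; apply/mwE => //; case: (gsP n).
- by case: (gsP n).
exists z; split => //; first exact/mwE.
have /ae_foralln fg : forall n, \forall w \ae P, fs n w = gs n w by move=> n; case: (gsP n).
apply: filterS2 fcv fg => w cv e.
have fE : (fun n => fs n w) = (fun n => gs n w) by apply/funext.
have -> : z w = limn (fun n => fs n w) by apply: zlim; rewrite -fE.
exact: cv.
Qed.

(** Choose finite minima whose expectations tend to the infimum of all such
    expectations; they may be taken decreasing.  Their limit [z] is below every
    [f] in [B], since otherwise [Num.min z f] would have a smaller expectation. *)
Lemma finite_min_approx (B : set (T -> R)) (m : R) : B !=set0 -> 0 <= m ->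
  (forall f, B f -> measurable_wrt G f /\ \forall w \ae P, `|f w| <= m) ->
  exists (gs : nat -> T -> R) (z : T -> R), [/\ forall n, finite_min B (gs n),
    measurable_wrt G z /\ (forall w, `|z w| <= m),
    \forall w \ae P, (forall n, z w <= gs n w) /\ gs n w @[n --> \oo] --> z w &
    forall f, B f -> \forall w \ae P, z w <= f w].
Proof.
move=> [f0 Bf0] m0 hB.
have hM := finite_min_bounded B m hB.
have iM f : finite_min B f -> integrable f.
  by move=> /hM [mf fm]; apply: (ae_bounded_integrable _ m) => //; exact: mw_measurable mf.
pose S := [set E g | g in finite_min B].
have Slb : lbound S (- m).
  move=> _ [g Bg <-]; rewrite -[leLHS](E_cst P); apply: ae_le_Rintegral; [|exact: iM|].
    by apply: bm_integrable; exact: bm_cst.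
  by apply: filterS (hM _ Bg).2 => w; rewrite ler_norml => /andP[].
have Sinf : has_inf S by split; [exists (E f0); exists f0 => //; exact: finite_min1|exists (- m)].
pose c := inf S.
have cS g : finite_min B g -> c <= E g by move=> Bg; apply: ge_inf; [exists (- m)|exists g].
have /choice [hs hsP] : forall n, exists h, finite_min B h /\ E h < c + n.+1%:R^-1.
  move=> n; have [|_ [h Bh <-] hlt] := inf_adherent (eps := n.+1%:R^-1) _ Sinf; first by rewrite invr_gt0.
  by exists h.
pose gs := fix gs n := if n is k.+1 then (fun w => Num.min (gs k w) (hs n w)) else hs 0%N.
have Bgs n : finite_min B (gs n).
  by elim: n => [|n IH] /=; [case: (hsP 0%N)|apply: finite_min2 => //; case: (hsP n.+1)].
have gs_hs n w : gs n w <= hs n w by case: n => [//|n] /=; rewrite ge_min lexx orbT.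
have gs_dec n w : gs n.+1 w <= gs n w by rewrite /= ge_min lexx.
have Egs n : E (gs n) <= c + n.+1%:R^-1.
  apply: le_trans (ltW (hsP n).2); apply: ae_le_Rintegral; [exact: iM|by apply: iM; case: (hsP n)|].
  by apply: aeW.
have /ae_foralln gm : forall n, \forall w \ae P, `|gs n w| <= m by move=> n; case: (hM _ (Bgs n)).
have gcv : \forall w \ae P, cvgn (fun n => gs n w).
  apply: filterS gm => w h; apply: nonincreasing_is_cvgn; first exact/nonincreasing_seqP.
  by exists (- m) => _ [n _ <-]; have := h n; rewrite ler_norml => /andP[].
have Lgs n : L0 P G (gs n) by apply: L0_mw; case: (hM _ (Bgs n)).
have [z [mz zm zcv]] := bounded_limit gs m m0 Lgs gm gcv.
have gz : \forall w \ae P, (forall n, z w <= gs n w) /\ gs n w @[n --> \oo] --> z w.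
  apply: filterS zcv => w cv; split => // n; rewrite -(cvg_lim _ cv)//.
  apply: nonincreasing_cvgn_ge; first exact/nonincreasing_seqP.
  by apply/cvg_ex; exists (z w).
exists gs, z; split => // f Bf.
have [mf fm] := hB f Bf.
have if_ : integrable f by apply: iM; exact: finite_min1.
have iz : integrable z by apply: bm_integrable; split; [exact: mw_measurable mz|exists m].
have imin : integrable (fun w => Num.min (z w) (f w)).
  apply: (ae_bounded_integrable _ m).
    by apply: measurable_minr; apply: (@integrable_measurable _ _ _ P).
  by apply: filterS fm => w h; rewrite /Num.min; case: ifP.
suff : \forall w \ae P, Num.min (z w) (f w) = z w.
  by apply: filterS => w <-; rewrite ge_min lexx orbT.
apply: ae_eq_of_Rintegral_le => //; first by apply: aeW => w; rewrite ge_min lexx.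
suff : forall e : R, 0 < e -> E z <= E (fun w => Num.min (z w) (f w)) + e by move/ler_addgt0Pr.
move=> e e0; have [n ne] : exists n : nat, n.+1%:R^-1 < e.
  by have [n _ /(_ n (leqnn n))] := near_infty_natSinv_lt (PosNum e0); exists n.
have Bk : finite_min B (fun w => Num.min (gs n w) (f w)) by apply: finite_min2 => //; exact: finite_min1.
(* The map [y |-> y - Num.min y r] is nondecreasing, and [z <= gs n]. *)
have : E (fun w => z w - Num.min (z w) (f w)) <= E (fun w => gs n w - Num.min (gs n w) (f w)).
  apply: ae_le_Rintegral; [exact: integrable_sub|by apply: integrable_sub; exact: iM|].
  apply: filterS gz => w [zg _]; have := zg n.
  by rewrite /Num.min; case: ltP => h1; case: ltP => h2; lra.
rewrite !RintegralB//; [|exact: iM|exact: iM].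
have := Egs n; have := cS _ Bk.
move: (E z) (E (gs n)) (E (fun w => Num.min (gs n w) (f w))) (E (fun w => Num.min (z w) (f w))).
by move: (n.+1%:R^-1 : R) ne => *; lra.
Qed.

Lemma is_ess_inf_ae S (Z W : T -> \bar R) : is_ess_inf P S Z -> measurable_fun [set: T] W ->
  (\forall w \ae P, Z w = W w) -> is_ess_inf P S W.
Proof.
move=> [mZ Zle Zge] mW ZW; split => //.
- by move=> f Sf; apply: filterS2 ZW (Zle f Sf) => w ->.
- by move=> V mV hV; apply: filterS2 ZW (Zge V mV hV) => w ->.
Qed.

Lemma is_ess_inf_unique S (Z W : T -> \bar R) : is_ess_inf P S Z -> is_ess_inf P S W ->
  \forall w \ae P, Z w = W w.
Proof.
move=> [mZ Zle Zge] [mW Wle Wge].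
by apply: filterS2 (Zge W mW Wle) (Wge Z mZ Zle) => w h k; apply/eqP; rewrite eq_le h k.
Qed.

Lemma ess_infP S (Z : T -> \bar R) : is_ess_inf P S Z ->
  \forall w \ae P, Z w = ess_inf P S w.
Proof. by move=> hZ; apply: (is_ess_inf_unique S) => //; apply: xgetPex; exists Z. Qed.

(** A finite value excludes the default value of [ess_inf], so that the essential
    infimum exists. *)
Lemma ess_inf_finite S (f : T -> R) : measurable_fun [set: T] f ->
  (\forall w \ae P, (f w)%:E = ess_inf P S w) -> is_ess_inf P S (EFin \o f).
Proof.
move=> mf h.
have hS : is_ess_inf P S (ess_inf P S).
  have [[Z hZ]|nZ] := pselect (exists Z, is_ess_inf P S Z); first by apply: xgetPex; exists Z.
  have : \forall w \ae P, False.
    apply: filterS h => w; rewrite /ess_inf xgetPN//.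
    by move=> Z hZ; apply: nZ; exists Z.
  by move=> /ae_exists [].
apply: (is_ess_inf_ae S _ _ hS); first exact/measurable_EFinP.
by apply: filterS h => w /= <-.
Qed.

Variable phi : process T R -> T -> R.
Hypothesis hphi : functional_on P F tau theta phi.

(** * Processes with prescribed increments *)

Definition cumul (D : process T R) : process T R := fun t w => \sum_(0 <= s < t.+1) D s w.

Lemma incr_cumul D t w : incr (cumul D) t w = D t w.
Proof.
rewrite /incr /cumul; case: t => [|t]; first by rewrite big_nat1 subr0.
by rewrite big_nat_recr//= addrAC subrr add0r.
Qed.

Lemma cumul_A1 D : adapted P F D ->
  (\int[P]_w \sum_(0 <= t <oo) `|D t w|%:E < +oo)%E -> A1 (cumul D).
Proof.
move=> aD Dfin; split; last by under eq_integral do under eq_eseriesr do rewrite incr_cumul.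
move=> t; rewrite /cumul.
have h (k : nat) : (k <= t.+1)%N -> L0 P (F t) (fun w => \sum_(0 <= s < k) D s w).
  elim: k => [|k IH] kt; first by under eq_fun do rewrite big_geq//; exact: L0_cst.
  under eq_fun do rewrite big_nat_recr//=.
  apply: (L0D P (F t) (sF t)); first by apply: IH; exact: ltnW.
  exact: (L0_le k).
exact: h.
Qed.

Lemma cumul_dominated a D : A1 a -> adapted P F D ->
  (forall t w, `|D t w| <= `|incr a t w|) -> A1 (cumul D).
Proof.
move=> Aa aD Da; apply: cumul_A1 => //; apply: le_lt_trans Aa.2.
apply: ge0_le_integral => //.
- by move=> w _; apply: nneseries_ge0 => t _ _; rewrite lee_fin.
- apply: ge0_emeasurable_sum => [t w _ _|t _]; first by rewrite lee_fin.
  by apply/measurable_EFinP; apply: measurableT_comp => //; case: (aD t).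
- by apply: variation_measurable; case: Aa.
- by move=> w _; apply: lee_nneseries => t _ //; rewrite lee_fin.
Qed.

(** Pairing with it evaluates at time [t], with weight [k] ([pairing_jump]). *)
Definition jump t (k : T -> R) : process T R := fun s w => if (t <= s)%N then k w else 0.

Lemma incr_jump t k s w : incr (jump t k) s w = if s == t then k w else 0.
Proof.
rewrite /incr /jump; case: s => [|s]; first by rewrite subr0 leqn0 eq_sym.
by rewrite -[(t <= s)%N]ltnS; case: (ltngtP t s.+1) => _; rewrite ?subrr ?subr0.
Qed.

Lemma sum_at (M : nmodType) (x : M) t n : (t < n)%N ->
  \sum_(0 <= s < n) (if s == t then x else 0) = x.
Proof. by move=> tn; rewrite -big_mkcond big_nat1_eq tn. Qed.

Lemma jump_A1 t k : L0 P (F t) k -> integrable k -> A1 (jump t k).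
Proof.
move=> Lk /integrableP[_ ik]; split.
  move=> s; rewrite /jump; case: leqP => ts; last exact: L0_cst.
  exact: (L0_le t s k ts Lk).
apply: le_lt_trans ik; rewrite le_eqVlt; apply/orP; left; apply/eqP.
apply: eq_integral => w _; apply: cvg_lim => //; apply: cvg_near_cst; exists t.+1 => // n /= tn.
rewrite -[RHS](sum_at _ _ _ _ tn); apply: eq_bigr => s _.
by rewrite incr_jump; case: eqP => // _; rewrite normr0.
Qed.

Lemma pairing_jump t k X : L0 P (F t) k -> integrable k -> Rinf X ->
  pairing P X (jump t k) = E (fun w => X t w * k w).
Proof.
move=> Lk ik RX; have c := pairing_cvg X _ RX (jump_A1 t k Lk ik).
apply: (cvg_unique _ c) => //; apply: cvg_near_cst; exists t.+1 => // n /= tn.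
rewrite -[RHS](sum_at _ _ _ _ tn); apply: eq_bigr => s _.
under eq_Rintegral do rewrite incr_jump.
by case: eqP => [->//|_]; exact: E_mul0.
Qed.

Lemma pairing_add X a b : Rinf X -> A1 a -> A1 b ->
  pairing P X (fun t w => a t w + b t w) = pairing P X a + pairing P X b.
Proof.
move=> RX Aa Ab; rewrite (pairing_comb X X X a b _ 1 1) ?mul1r//; first exact: A1_add.
by apply: aeW => w t; rewrite incr_add; ring.
Qed.

(** Restricting to an event known at [tau] can be moved from the process to the
    increments of [a]. *)
Lemma pairing_cumul_locf A a : G A -> A1 a ->
  exists2 b, A1 b & forall Y, Rinf Y -> pairing P Y b = pairing P (locf \1_A Y) a.
Proof.
move=> GA Aa; pose D0 : process T R := fun t w => \1_A w * \1_(St t) w * incr a t w.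
have mA : measurable_wrt G (\1_A : T -> R) by exact: mw_indic.
have AD : A1 (cumul D0).
  apply: (cumul_dominated a) => //.
    move=> t; apply: (L0M P (F t) (sF t)); last by case: Aa => aa _; exact: adapted_incr.
    by apply: (L0_mw P (F t) (FM t)); exact: mw_mul_tau.
  move=> t w; rewrite /D0 !normrM.
  have i1 B : `|\1_B w : R| <= 1 by case: (indic01 R B w) => ->; rewrite ?normr0 ?normr1.
  by rewrite ler_piMl// mulr_ile1.
exists (cumul D0) => // Y RY.
have RL : Rinf (locf \1_A Y) by apply: locf_Rinf => //; exact: bounded_indic.
apply: pairing_eq => //; apply: aeW => w t; rewrite incr_cumul /D0 /locf; ring.
Qed.

Lemma Rinf_mul_integrable Y r (f : T -> R) : Rinf Y -> integrable f ->
  integrable (fun w => Y r w * f w).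
Proof.
move=> [aY [n Yn]] fi.
have LY : Linf P (F r) (Y r) by split; [exact: aY|exists n; apply: filterS Yn => w].
have [y [M [my yM Yy]]] := Linf_version P (F r) (sF r) _ LY.
have by_ : bm y by split; [exact: mw_measurable my|exists M].
apply: (ae_integrable (fun w => y w * f w)).
- apply: measurable_funM; first by case: (aY r).
  by apply/measurable_EFinP; exact: measurable_int fi.
- by apply: filterS Yy => w ->.
- exact: integrableMbm.
Qed.

Lemma ae_zero_of_tests t (f : T -> R) : L0 P (F t) f -> integrable f ->
  (forall B, F t B -> E (fun w => \1_B w * f w) = 0) -> \forall w \ae P, f w = 0.
Proof.
move=> [mf [g mg fg]] fi h.
have mg' := mw_measurable _ (FM t) _ mg.
have gi : integrable g by exact: (ae_integrable f g).
have m0 : measurable_wrt (F t) (fun=> 0 : R) by exact: (mw_cst _ (sF t)).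
have i0 : integrable (fun=> 0) by apply: bm_integrable; exact: bm_cst.
have : \forall w \ae P, g w = 0.
  apply: (ae_eq_of_integrals P _ (sF t) (FM t) _ _ mg m0 gi i0) => B FB.
  have mB : measurable_fun [set: T] (\1_B : T -> R) by apply: measurable_indic; exact: FM FB.
  rewrite E_mul0 -(h B FB); apply: ae_Rintegral_eq.
  - exact: measurable_funM.
  - exact: measurable_funM.
  - by apply: filterS fg => w ->.
by apply: filterS2 fg => w ->.
Qed.

(** * Processes on the interval form a weakly closed space *)

Section bipolar.
Variable X : process T R.
Hypothesis RX : Rinf X.
Hypothesis X_bipolar : forall b, A1 b -> (forall Y, Ron Y -> pairing P Y b = 0) -> pairing P X b = 0.

(** Jumps at [t] on events before [tau] annihilate the processes on the interval. *)
Lemma bipolar_before t : \forall w \ae P, ~~ tau_le t w -> X t w = 0.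
Proof.
have [aX [m Xm]] := RX.
pose J w : R := 1 - (tau_le t w)%:R.
have mJ : measurable_wrt (F t) J.
  rewrite (_ : J = fun w => 1 - \1_[set v | tau_le t v] w); last by apply/funext => w; rewrite indicb.
  by apply: mwB => //; [exact: mw_cst|apply: mw_indic => //; exact: htau].
have J01 w : `|J w| <= 1 by rewrite /J; case: (tau_le t w); rewrite ?subrr ?normr0 ?subr0 ?normr1.
have bJ : bm J by split; [exact: mw_measurable mJ|exists 1].
have : \forall w \ae P, J w * X t w = 0.
  apply: (ae_zero_of_tests t); first by apply: L0M => //; exact: L0_mw.
    apply: integrableMbm => //; apply: (ae_bounded_integrable _ m); first by case: (aX t).
    by apply: filterS Xm => w.
  move=> B FB; have bB : bm (\1_B : T -> R) by apply: bm_indic; exact: FM FB.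
  have Lk : L0 P (F t) (fun w => \1_B w * J w).
    by apply: L0_mw => //; apply: mwM => //; exact: mw_indic.
  have bk := bmM _ _ bB bJ; have ik := bm_integrable P _ bk.
  rewrite (_ : (fun w => _) = fun w => X t w * (\1_B w * J w)); last by apply/funext => w; ring.
  rewrite -(pairing_jump t)//; apply: X_bipolar; first exact: jump_A1.
  move=> Y RY; rewrite pairing_jump//; last exact: Ron_Rinf.
  rewrite -[RHS](E_cst P 0).
  have /RonP[[aY _] Yp] := RY; apply: ae_Rintegral_eq => //.
    by apply: measurable_funM; [case: (aY t)|case: bk].
  apply: filterS Yp => w e; rewrite e /proj_process /J.
  by case: (tau_le t w); rewrite ?subrr ?mulr0// mul0r.
by apply: filterS => w; rewrite /J => + nt; rewrite (negbTE nt) subr0 mul1r.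
Qed.

(** On an event where [theta] is [s], a jump at [t] minus the corresponding jump
    at [s] annihilates the processes that are constant from [theta] on. *)
Lemma bipolar_after s t : (s < t)%N -> \forall w \ae P, theta w = Some s -> X t w = X s w.
Proof.
move=> st; have [aX [m Xm]] := RX.
pose J w : R := \1_[set v | theta v == Some s] w.
have mJ : measurable_wrt (F s) J by apply: mw_indic => //; exact: F_theta_eq.
have bJ : bm J by apply: bm_indic; exact: FM (F_theta_eq s).
have : \forall w \ae P, J w * (X t w - X s w) = 0.
  apply: (ae_zero_of_tests t).
  - apply: L0M => //; first by apply: (L0_le s); [exact: ltnW|exact: L0_mw].
    by apply: L0B => //; apply: (L0_le s); [exact: ltnW|].
  - apply: integrableMbm => //; apply: (ae_bounded_integrable _ (m + m)).
      by apply: measurable_funB; [case: (aX t)|case: (aX s)].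
    by apply: filterS Xm => w h; apply: le_trans (ler_normB _ _) _; exact: lerD.
  move=> B FB; have bB : bm (\1_B : T -> R) by apply: bm_indic; exact: FM FB.
  pose k w : R := \1_B w * J w.
  have bk : bm k by exact: bmM.
  have ik := bm_integrable P _ bk.
  have Lk : L0 P (F t) k.
    apply: L0_mw => //; apply: mwM => //; first exact: mw_indic.
    by move=> C mC; apply: (Fle s t) (mJ C mC); exact: ltnW.
  (* The weight [k] is known at time [t] only: the jump at time [s] has the conditional
     expectation of [k] as weight. *)
  have [c [mc ic cE]] := condexp_exists P (F s) (sF s) (FM s) k ik.
  have mc' : measurable_wrt (F s) (fun w => -1 * c w) by apply: mwM => //; exact: mw_cst.
  have Lc : L0 P (F s) (fun w => -1 * c w) by exact: L0_mw.
  have icN : integrable (fun w => -1 * c w) by exact: integrable_scale.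
  have cs Y : Rinf Y -> E (fun w => Y s w * c w) = E (fun w => Y s w * k w).
    move=> [aY [n Yn]].
    have LY : Linf P (F s) (Y s) by split; [exact: aY|exists n; apply: filterS Yn => w].
    have [y [M [my yM Yy]]] := Linf_version P (F s) (sF s) _ LY.
    have mY : measurable_fun [set: T] (Y s) by case: (aY s).
    have my' := mw_measurable _ (FM s) _ my.
    have mcT := mw_measurable _ (FM s) _ mc.
    have mk : measurable_fun [set: T] k by case: bk.
    rewrite (ae_Rintegral_eq (fun w => Y s w * c w) (fun w => y w * c w)); last 3 first.
    - exact: measurable_funM.
    - exact: measurable_funM.
    - by apply: filterS Yy => w ->.
    rewrite -cE; last by apply/bmG => //; split=> //; exists M.
    apply: ae_Rintegral_eq; [exact: measurable_funM|exact: measurable_funM|].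
    by apply: filterS Yy => w ->.
  pose b : process T R := fun r w => jump t k r w + jump s (fun w => -1 * c w) r w.
  have Ab : A1 b by apply: A1_add; exact: jump_A1.
  have bE Y : Rinf Y -> pairing P Y b = E (fun w => k w * (Y t w - Y s w)).
    move=> RY; rewrite pairing_add//; [|exact: jump_A1|exact: jump_A1].
    rewrite !pairing_jump//.
    under [X in _ + X]eq_Rintegral do rewrite mulrCA.
    rewrite RintegralZl//; last exact: Rinf_mul_integrable.
    rewrite mulN1r cs// -RintegralB//; [|exact: Rinf_mul_integrable|exact: Rinf_mul_integrable].
    by apply: eq_Rintegral => w _; ring.
  rewrite (_ : (fun w => _) = fun w => k w * (X t w - X s w)); last by apply/funext => w; rewrite /k; ring.
  rewrite -bE//; apply: X_bipolar => // Y RY; have RY' := Ron_Rinf _ RY; rewrite bE//.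
  rewrite -[RHS](E_cst P 0).
  have /RonP[[aY _] Yp] := RY; apply: ae_Rintegral_eq => //.
    apply: measurable_funM; first by case: bk.
    by apply: measurable_funB; [case: (aY t)|case: (aY s)].
  apply: filterS2 Yp htau_theta => w e tth.
  rewrite /k /J indicb; case: eqP => [ths|_]; last by rewrite mulr0 mul0r.
  rewrite !e /proj_process ths /= (minn_idPr (ltnW st)) minnn.
  rewrite ths in tth; rewrite tth (_ : tau_le t w) ?subrr ?mulr0//.
  by move: tth; case: (tau w) => //= n ns; exact: leq_trans ns (ltnW st).
by apply: filterS => w + ths; rewrite /J indicb ths eqxx mul1r => /eqP; rewrite subr_eq0 => /eqP.
Qed.

Lemma Ron_bipolar : Ron X.
Proof.
apply/RonP; split => //.
have /ae_foralln hb := bipolar_before.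
have /ae_foralln ha : forall s, \forall w \ae P, forall t, (s < t)%N -> theta w = Some s -> X t w = X s w.
  move=> s; apply/ae_foralln => t; have [st|ts] := ltnP s t; last by apply: aeW.
  by apply: filterS (bipolar_after s t st) => w.
apply: filterS2 hb ha => w hb ha t; rewrite /proj_process; case: ifPn => [_|/hb//].
rewrite /min_etime; case ths : (theta w) => [s|] //.
by case: (leqP t s) => // st; exact: ha.
Qed.

End bipolar.

(** * From a representation to a coherent functional with closed acceptance set *)

Section representation.
Variable Q : set (process T R).
Hypothesis hQ : represents P F tau theta Q phi.

Let QD : Q `<=` D. Proof. by case: hQ. Qed.

Lemma represents_ess_inf X : Ron X -> is_ess_inf P [set cpairing X a | a in Q] (EFin \o phi X).
Proof.
move=> RX; apply: ess_inf_finite; first by case: hphi => h _; exact: h.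
by case: hQ => _ _ h; exact: h.
Qed.

Lemma represents_le X a : Ron X -> Q a -> \forall w \ae P, phi X w <= cpairing X a w.
Proof.
move=> RX Qa; have [_ h _] := represents_ess_inf X RX.
move: (h (cpairing X a) (ex_intro2 _ _ a Qa erefl)); move: (cpairing X a) => c.
by apply: filterS => w /=; rewrite lee_fin.
Qed.

Lemma represents_ge X (f : T -> R) : Ron X -> measurable_fun [set: T] f ->
  (forall a, Q a -> \forall w \ae P, f w <= cpairing X a w) -> \forall w \ae P, f w <= phi X w.
Proof.
move=> RX mf h; have [_ _ hX] := represents_ess_inf X RX.
have : \forall w \ae P, ((f w)%:E <= (phi X w)%:E)%E.
  apply: hX; first exact/measurable_EFinP.
  move=> _ [a Qa <-]; move: (h a Qa); move: (cpairing X a) => c.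
  by apply: filterS => w; rewrite lee_fin.
by apply: filterS => w; rewrite lee_fin.
Qed.

(** The limit of [finite_min_approx] is another lower bound of the same family, so
    it is [phi X]. *)
Lemma represents_approx X : Ron X -> exists (gs : nat -> T -> R) (z : T -> R),
  [/\ forall n, finite_min [set cpairing X a | a in Q] (gs n),
    measurable_wrt G z /\ (exists m, forall w, `|z w| <= m),
    \forall w \ae P, z w = phi X w &
    \forall w \ae P, gs n w @[n --> \oo] --> phi X w].
Proof.
move=> RX; have [_ [m Xm]] := Ron_Rinf _ RX.
have Rx := Ron_Rinf _ RX.
have Xm' : \forall w \ae P, forall t, `|X t w| <= `|m|.
  by apply: filterS Xm => w h t; apply: le_trans (h t) (ler_norm _).
have [[a0 Qa0] _ _] := hQ.
have [||gs [z [gsB [mz zm] gsz zle]]] := finite_min_approx [set cpairing X a | a in Q] `|m| _ (normr_ge0 m).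
- by exists (cpairing X a0); exists a0.
- move=> _ [a Qa <-]; have Da := QD _ Qa; split; last exact: cpairing_bound.
  by case: (cpairing_spec X a Rx (density_A1 _ Da)).
have zphi : \forall w \ae P, z w <= phi X w.
  apply: represents_ge => //; first exact: mw_measurable mz.
  by move=> a Qa; apply: zle; exists a.
have phig f : finite_min [set cpairing X a | a in Q] f -> \forall w \ae P, phi X w <= f w.
  elim => [_ [a Qa <-]|{}f g _ h1 _ h2]; first exact: represents_le.
  by apply: filterS2 h1 h2 => w p q; rewrite le_min p q.
have /ae_foralln phigs : forall n, \forall w \ae P, phi X w <= gs n w by move=> n; exact: phig.
have zE : \forall w \ae P, z w = phi X w.
  apply: filterS3 zphi phigs gsz => w h1 h2 [_ h3]; apply/eqP; rewrite eq_le h1 /=.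
  exact: cvg_ge h2 h3.
exists gs, z; split => //; first by split => //; exists `|m|.
by apply: filterS2 zE gsz => w <- [].
Qed.

(** One inequality holds termwise.  The other one, termwise too, says that
    [phi (l * X)] is below [l * cpairing X a] for all [a]; since [l] may vanish, the infimum
    over [a] is taken through finite minima. *)
Lemma represents_homogeneous X l : Ron X -> Linf P G l -> (\forall w \ae P, 0 <= l w) ->
  \forall w \ae P, phi (fun t v => l v * X t v) w = l w * phi X w.
Proof.
move=> RX Ll l0; have RlX := Ron_mul _ _ RX Ll.
have Rx := Ron_Rinf _ RX; have Rlx := Ron_Rinf _ RlX.
have mphi Y : Ron Y -> measurable_fun [set: T] (phi Y) by case: hphi => h _; exact: h.
have hcp a : Q a -> \forall w \ae P, cpairing (fun t v => l v * X t v) a w = l w * cpairing X a w.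
  move=> Qa; have := cpairing_combl a X X _ l (fun=> 0) (density_A1 _ (QD _ Qa)) Rx Rx Rlx Ll (Linf_cst _).
  move: (cpairing _ a) (cpairing X a) => c1 c2 h.
  have {}h : \forall w \ae P, c1 w = l w * c2 w + 0 * c2 w.
    by apply: h; apply: aeW => w t _; rewrite mul0r addr0.
  by apply: filterS h => w ->; rewrite mul0r addr0.
have h1 : \forall w \ae P, l w * phi X w <= phi (fun t v => l v * X t v) w.
  apply: represents_ge => //.
    by apply: measurable_funM; [exact: Linf_measurable|exact: mphi].
  move=> a Qa; move: (hcp a Qa) (represents_le X a RX Qa).
  move: (cpairing _ a) (cpairing X a) => c1 c2 h k.
  by apply: filterS3 h k l0 => w -> p q; exact: ler_wpM2l.
have [gs [z [gsB _ _ gscv]]] := represents_approx X RX.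
have h2 f : finite_min [set cpairing X a | a in Q] f ->
    \forall w \ae P, phi (fun t v => l v * X t v) w <= l w * f w.
  elim => [_ [a Qa <-]|{}f g _ k1 _ k2]; last first.
    by apply: filterS2 k1 k2 => w p q; rewrite /Num.min; case: ifP.
  move: (hcp a Qa) (represents_le _ a RlX Qa).
  move: (cpairing _ a) (cpairing X a) => c1 c2 h k.
  by apply: filterS2 h k => w ->.
have /ae_foralln h3 : forall n, \forall w \ae P, phi (fun t v => l v * X t v) w <= l w * gs n w.
  by move=> n; exact: h2.
apply: filterS3 h1 h3 gscv => w p q cv; apply/eqP; rewrite eq_le p andbT.
have cv' : l w * gs n w @[n --> \oo] --> l w * phi X w by apply: cvgM => //; exact: cvg_cst.
exact: cvg_ge q cv'.
Qed.

Lemma represents_coherent : coherent_utility P F tau theta phi.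
Proof.
have mphi Y : Ron Y -> measurable_fun [set: T] (phi Y) by case: hphi => h _; exact: h.
have Lphi X : Ron X -> Linf P G (phi X).
  move=> RX; have [gs [z [_ [mz [m zm]] zE _]]] := represents_approx X RX; split.
    apply: (L0_ae _ _ z) => //; [exact: mphi|exact: L0_mw].
  by exists m; apply: filterS zE => w <-.
split; last exact: represents_homogeneous.
split.
  split=> //.
  - move=> X A RX GA; apply: represents_homogeneous => //; first exact: Linf_indic.
    by apply: aeW => w; case: (indic01 R A w) => ->.
  - move=> X Y RX RY XY; apply: represents_ge => //; first exact: mphi.
    move=> a Qa; move: (represents_le X a RX Qa).
    move: (cpairing_le a X Y (QD _ Qa) (Ron_Rinf _ RX) (Ron_Rinf _ RY) XY).
    move: (cpairing X a) (cpairing Y a) => c1 c2.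
    by apply: filterS2 => w p q; exact: le_trans q p.
  - move=> X m RX Lm; pose Z : process T R := fun t v => X t v + m v * (tau_le t v)%:R; rewrite -/Z.
    have RZ : Ron Z by exact: Ron_translation.
    have hcp a (Qa : Q a) := cpairing_translation X a m RX (QD _ Qa) Lm.
    have mm := Linf_measurable _ Lm.
    have h1 : \forall w \ae P, phi X w + m w <= phi Z w.
      apply: represents_ge => //; first by apply: measurable_funD => //; exact: mphi.
      move=> a Qa; move: (represents_le X a RX Qa) (hcp a Qa).
      move: (cpairing X a) (cpairing Z a) => c1 c2.
      by apply: filterS2 => w p ->; rewrite lerD2r.
    have h2 : \forall w \ae P, phi Z w - m w <= phi X w.
      apply: represents_ge => //; first by apply: measurable_funB => //; exact: mphi.
      move=> a Qa; move: (represents_le Z a RZ Qa) (hcp a Qa).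
      move: (cpairing X a) (cpairing Z a) => c1 c2.
      by apply: filterS2 => w p q; move: p; rewrite q; lra.
    by apply: filterS2 h1 h2 => w p q; apply/eqP; rewrite eq_le p andbT; lra.
move=> X Y l RX RY [Ll l01].
have L1l : Linf P G (fun w => 1 - l w) by apply: LinfB => //; exact: Linf_cst.
have RZ : Ron (mix l X Y) by exact: Ron_comb.
apply: represents_ge => //.
  apply: measurable_funD; apply: measurable_funM; do ?exact: mphi.
    exact: Linf_measurable.
  exact: (Linf_measurable _ L1l).
have [[RX' RY'] RZ'] := (Ron_Rinf _ RX, Ron_Rinf _ RY, Ron_Rinf _ RZ).
move=> a Qa; have := cpairing_combl a X Y (mix l X Y) l _ (density_A1 _ (QD _ Qa)) RX' RY' RZ' Ll L1l.
move: (represents_le X a RX Qa) (represents_le Y a RY Qa).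
move: (cpairing X a) (cpairing Y a) (cpairing (mix l X Y) a) => c1 c2 c3 h1 h2 h.
have {}h : \forall w \ae P, c3 w = l w * c1 w + (1 - l w) * c2 w by apply: h; exact: aeW.
apply: filterS2 (filterI h1 h2) (filterI h l01) => w [p q] [-> /andP[l0 l1]].
by apply: lerD; apply: ler_wpM2l => //; rewrite subr_ge0.
Qed.

Lemma represents_acceptance X : acceptance P F tau theta phi X <->
  Ron X /\ forall a, Q a -> \forall w \ae P, 0 <= cpairing X a w.
Proof.
split=> [[RX X0]|[RX h]]; split=> //.
  by move=> a Qa; move: (represents_le X a RX Qa); move: (cpairing X a) => c; apply: filterS2 X0 => w; exact: le_trans.
exact: represents_ge.
Qed.

(** An element of the bipolar lies on the interval by [Ron_bipolar]; and its
    conditional pairing with [a] in [Q] is nonnegative, because the localisations of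
    [a] on events known at [tau] are nonnegative on the acceptance set. *)
Lemma represents_closed : Rinf_closed P F (acceptance P F tau theta phi).
Proof.
apply: Rinf_closed_polar => [X [RX _]|X RX hX]; first exact: Ron_Rinf.
have RonX : Ron X.
  apply: Ron_bipolar => // b Ab hb.
  pose nb := cumul (fun t w => -1 * incr b t w).
  have Anb : A1 nb.
    apply: (cumul_dominated b) => //.
      move=> t; apply: (L0M P (F t) (sF t) (fun=> -1)); first exact: L0_cst.
      by case: Ab => ab _; exact: adapted_incr.
    by move=> t w; rewrite normrM normrN1 mul1r.
  have pN Y : Rinf Y -> pairing P Y nb = - pairing P Y b.
    move=> RY; rewrite (pairing_comb Y Y Y b b nb (-1) 0)// ?mulN1r ?mul0r ?addr0//.
    by apply: aeW => w t; rewrite incr_cumul; ring.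
  apply/eqP; rewrite eq_le -oppr_ge0 -pN//; apply/andP; split; apply: hX => // Y [RY _].
    by rewrite pN ?hb ?oppr0//; exact: Ron_Rinf.
  by rewrite hb.
apply/represents_acceptance; split => // a Qa; have Aa := density_A1 _ (QD _ Qa).
apply: (cpairing_geP (fun=> 0)) => //; first exact: Linf_cst.
move=> A GA; rewrite (_ : E _ = 0); last first.
  exact: E_mul0.
have [b Ab bE] := pairing_cumul_locf A a GA Aa.
rewrite -bE//; apply: hX => // Y /represents_acceptance [RY Y0].
have RY' := Ron_Rinf _ RY.
have [mc ic cE] := cpairing_spec Y a RY' Aa.
rewrite bE// -cE; [|exact: mw_indic|exact: bounded_indic].
apply: ae_Rintegral_ge0.
  apply: measurable_funM; last exact: mw_measurable mc.
  by apply: measurable_indic; exact: GM.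
move: (Y0 a Qa); move: (cpairing Y a) => c; apply: filterS => w c0.
by case: (indic01 R A w) => ->; rewrite ?mul0r ?mul1r.
Qed.

End representation.

(** * From closed acceptance sets to continuity *)

Lemma A1_incr_integrable a t : A1 a -> integrable (incr a t).
Proof.
move=> Aa; have := pairing_integrable _ a t (Rinf_cst 1) Aa.
by congr (P.-integrable _ _); apply/funext => w; rewrite /= mul1r.
Qed.

Lemma pairing_eseries X a : Rinf X -> A1 a ->
  (\sum_(0 <= t <oo) (E (fun w => X t w * incr a t w))%:E)%E = (pairing P X a)%:E.
Proof.
move=> RX Aa; apply: cvg_lim => //; under eq_fun do rewrite sumEFin.
by apply: cvg_EFin; [exact: nearW|exact: pairing_cvg].
Qed.

(** Dominated convergence, once in expectation and once in the series over time. *)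
Lemma pairing_dominated (Zn : nat -> process T R) X a (m : R) : (forall n, Rinf (Zn n)) -> Rinf X -> A1 a ->
  (forall n, \forall w \ae P, forall t, `|Zn n t w| <= m) ->
  (forall t, \forall w \ae P, Zn n t w @[n --> \oo] --> X t w) ->
  pairing P (Zn n) a @[n --> \oo] --> pairing P X a.
Proof.
move=> RZ RX Aa Zm ZX; have /ae_foralln Zm' := Zm.
have m0 : 0 <= m by have [w h] := ae_exists _ (Zm 0%N); exact: le_trans (h 0%N).
have iD t : integrable (fun w => `|incr a t w|) by apply: integrable_norm; exact: A1_incr_integrable.
have : ((pairing P (Zn n) a)%:E @[n --> \oo] --> (pairing P X a)%:E)%E.
  rewrite -pairing_eseries//; under eq_fun do rewrite -pairing_eseries//.
  apply: (@dominated_series _ _ _ (fun t => m * E (fun w => `|incr a t w|))).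
  - move=> n t; apply: le_trans (le_normr_Rintegral _ _) _ => //; first exact: pairing_integrable.
    rewrite -RintegralZl//; apply: ae_le_Rintegral.
    + by apply: integrable_norm; exact: pairing_integrable.
    + exact: integrable_scale.
    + by apply: filterS (Zm n) => w h; rewrite normrM; apply: ler_wpM2r.
  - under eq_eseriesr do rewrite EFinM.
    rewrite nneseriesZl; last by move=> t _; rewrite lee_fin; exact: Rintegral_ge0.
    apply: lte_mul_pinfty; rewrite ?lee_fin//.
    have mD t : measurable_fun [set: T] (fun w => (`|incr a t w|)%:E).
      exact: measurable_int (iD t).
    rewrite (eq_eseriesr (fun t _ => _ : _ = \int[P]_w (`|incr a t w|)%:E)%E); last first.
      by move=> t _; rewrite /Rintegral fineK//; exact: integrable_fin_num (iD t).
    by rewrite -integral_nneseries//; exact: Aa.2.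
  move=> t; apply: (Rintegral_dominated_convergence _ _ _ (fun w => m * `|incr a t w|)).
  - by move=> n; exact: integrable_measurable (pairing_integrable (Zn n) a t (RZ n) Aa).
  - exact: integrable_measurable (pairing_integrable X a t RX Aa).
  - exact: integrable_scale.
  - by apply: filterS Zm' => w h n; rewrite normrM; apply: ler_wpM2r.
  - by apply: filterS (ZX t) => w h; apply: cvgM => //; exact: cvg_cst.
by move=> /fine_cvgP[].
Qed.

(** The limit [z] of [phi (Xn n)] exists by monotonicity and is at least [phi X].
    The processes [Xn n - z] on the interval are accepted and converge weakly to
    [X - z], which is therefore accepted. *)
Lemma closed_continuous : coherent_utility P F tau theta phi ->
  Rinf_closed P F (acceptance P F tau theta phi) ->
  continuous_decreasing P F tau theta phi.
Proof.
move=> [[[Lphi _ phi_mono phi_trans] _] _] Ccl Xn X RXn RX Xdec Xcv.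
have /ae_foralln Xcv' := Xcv; have /ae_foralln Xdec' := Xdec.
have Xle n : le_process P X (Xn n).
  apply: filterS2 Xcv' Xdec' => w cv dec t.
  have nd : nonincreasing_seq (fun n => Xn n t w) by apply/nonincreasing_seqP => k; exact: dec.
  rewrite -(cvg_lim _ (cv t))//; apply: nonincreasing_cvgn_ge => //.
  by apply/cvg_ex; eexists; exact: cv.
have XleO n : le_process P (Xn n) (Xn 0%N).
  apply: filterS Xdec' => w dec t.
  have nd : nonincreasing_seq (fun n => Xn n t w) by apply/nonincreasing_seqP => k; exact: dec.
  exact: nd.
have [_ [m0 X0m]] := Ron_Rinf _ (RXn 0%N); have [_ [m1 X1m]] := Ron_Rinf _ RX.
have Xnm n : \forall w \ae P, forall t, `|Xn n t w| <= `|m0| + `|m1|.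
  apply: filterS2 (filterI X0m X1m) (filterI (Xle n) (XleO n)) => w [h0 h1] [h2 h3] t.
  have := h0 t; have := h1 t; have := h2 t; have := h3 t.
  have := ler_norm m0; have := ler_norm m1; have := normr_ge0 m0; have := normr_ge0 m1.
  move=> q1 q2 q3 q4 a1 a2; rewrite !ler_norml => /andP[a3 a4] /andP[a5 a6]; apply/andP; split; lra.
have [_ [k0 p0]] := Lphi _ (RXn 0%N); have [_ [k1 p1]] := Lphi _ RX.
have /ae_foralln phidec : forall n, \forall w \ae P, phi (Xn n.+1) w <= phi (Xn n) w.
  by move=> n; exact: phi_mono.
have /ae_foralln phile : forall n, \forall w \ae P, phi X w <= phi (Xn n) w.
  by move=> n; exact: phi_mono.
have /ae_foralln phile0 : forall n, \forall w \ae P, phi (Xn n) w <= phi (Xn 0%N) w.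
  by move=> n; exact: phi_mono.
have phim : \forall w \ae P, forall n, `|phi (Xn n) w| <= `|k0| + `|k1|.
  apply: filterS2 (filterI p0 p1) (filterI phile phile0) => w [h0 h1] [h2 h3] n.
  have := h2 n; have := h3 n.
  have := ler_norm k0; have := ler_norm k1; have := normr_ge0 k0; have := normr_ge0 k1.
  move: h0 h1; rewrite !ler_norml => /andP[a3 a4] /andP[a5 a6] q1 q2 q3 q4 a1 a2; apply/andP; split; lra.
have phicv : \forall w \ae P, cvgn (fun n => phi (Xn n) w).
  apply: filterS2 phidec phile => w h1 h2; apply: nonincreasing_is_cvgn.
    by apply/nonincreasing_seqP => n; exact: h1.
  by exists (phi X w) => _ [n _ <-].
have [||z [mz zm zcv]] := bounded_limit (fun n => phi (Xn n)) (`|k0| + `|k1|) _ _ phim phicv.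
- by rewrite addr_ge0.
- by move=> n; have [] := Lphi _ (RXn n).
have Lz : Linf P G (fun w => - z w).
  have := LinfB (fun=> 0) z (Linf_cst 0); under eq_fun do rewrite sub0r; apply.
  by apply: Linf_bounded_mw => //; eexists; exact: zm.
pose Yn n : process T R := fun t w => Xn n t w + - z w * (tau_le t w)%:R.
pose Y : process T R := fun t w => X t w + - z w * (tau_le t w)%:R.
have RonY Z : Ron Z -> Ron (fun t w => Z t w + - z w * (tau_le t w)%:R).
  by move=> RZ; exact: Ron_translation.
have CYn n : acceptance P F tau theta phi (Yn n).
  split; first exact: RonY.
  apply: filterS3 (phi_trans _ _ (RXn n) Lz) phidec zcv => w -> dec cv.
  rewrite subr_ge0 -(cvg_lim _ cv)//; apply: nonincreasing_cvgn_ge.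
    by apply/nonincreasing_seqP => k; exact: dec.
  by apply/cvg_ex; eexists; exact: cv.
have CY : acceptance P F tau theta phi Y.
  apply: (Rinf_closed_seq P F _ Yn Y Ccl) => //.
  - by move=> n; apply: Ron_Rinf; case: (CYn n).
  - by apply: Ron_Rinf; exact: RonY.
  move=> a Aa; apply: (pairing_dominated _ _ _ (`|m0| + `|m1| + (`|k0| + `|k1|))) => //.
  - by move=> n; apply: Ron_Rinf; case: (CYn n).
  - by apply: Ron_Rinf; exact: RonY.
  - move=> n; apply: filterS (Xnm n) => w h t; apply: le_trans (ler_normD _ _) _.
    apply: lerD => //; rewrite normrM normrN; apply: le_trans (zm w).
    by rewrite ler_piMr//; case: (tau_le t w); rewrite ?normr0 ?normr1.
  - by move=> t; apply: filterS (Xcv t) => w h; apply: cvgD => //; exact: cvg_cst.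
have zphi : \forall w \ae P, z w <= phi X w.
  case: CY => _; have := phi_trans _ _ RX Lz; apply: filterS2 => w ->.
  by rewrite subr_ge0.
apply: filterS3 zphi phile zcv => w h1 h2 cv.
have -> : phi X w = z w by apply/eqP; rewrite eq_le h1 andbT; exact: cvg_ge h2 cv.
exact: cv.
Qed.

(** * Pairings and mixtures of densities *)

Lemma pairing_locf x Y a : measurable_wrt G x -> (exists M : R, forall w, `|x w| <= M) ->
  Rinf Y -> Rinf (fun t w => x w * Y t w) -> A1 a ->
  (\forall w \ae P, forall t, 0 <= incr a t w /\ (~ St t w -> incr a t w = 0)) ->
  pairing P (locf x Y) a = pairing P (fun t w => x w * Y t w) a.
Proof.
move=> mx xM RY RxY Aa ha; have RL := locf_Rinf x Y mx xM RY.
apply: pairing_eq => //; apply: filterS ha => w h t; have [_ hz] := h t; rewrite /locf.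
have [wS|wS] := pselect (St t w); first by rewrite indicSt_in// mul1r.
by rewrite hz// !mulr0.
Qed.

Lemma pairing_cpairing Y a : D a -> Rinf Y -> pairing P Y a = E (cpairing Y a).
Proof.
move=> Da RY; have Aa := density_A1 _ Da.
have [mc ic cE] := cpairing_spec Y a RY Aa.
have m1 : measurable_wrt G (fun=> 1 : R) by exact: mw_cst.
have b1 : exists M : R, forall w : T, `|1 : R| <= M by exists 1 => w; rewrite normr1.
have e1 : (fun t w => 1 * Y t w) = Y by apply/funext => t; apply/funext => w; rewrite mul1r.
have R1 : Rinf (fun t w => 1 * Y t w) by rewrite e1.
have := cE _ m1 b1; rewrite (pairing_locf (fun=> 1) Y a)//; last exact: density_incr.
by rewrite e1 => <-; apply: eq_Rintegral => w _; rewrite mul1r.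
Qed.

Lemma pairing_unit a : D a -> pairing P unit_process a = 1.
Proof.
move=> Da; have Aa := density_A1 _ Da; have R1 := Rinf_cst 1.
have -> : pairing P unit_process a = pairing P (fun _ _ => 1) a.
  apply: pairing_eq => //; first exact: Ron_Rinf Ron_unit.
  apply: filterS (density_incr _ Da) => w h t; have [_ hz] := h t.
  by have [wS|wS] := pselect (St t w); [rewrite unit_St|rewrite hz// !mulr0].
have [mc ic cE] := cpairing_spec _ a R1 Aa.
rewrite pairing_cpairing// -[RHS](E_cst P); apply: ae_Rintegral_eq => //; last exact: density_one.
exact: mw_measurable mc.
Qed.

Lemma incr_mix (l : T -> R) (a b : process T R) t w : incr (mix l a b) t w = l w * incr a t w + (1 - l w) * incr b t w.
Proof. by rewrite /incr /mix; case: t => [|t]; ring. Qed.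

(** The weight [l] is known from [tau] on only, so the process is rebuilt from its
    increments, which vanish before [tau]. *)
Lemma mix_A1 l a b : D a -> D b -> weight P F tau l -> A1 (mix l a b).
Proof.
move=> Da Db [Ll l01]; have Aa := density_A1 _ Da; have Ab := density_A1 _ Db.
have ml := Linf_measurable _ Ll.
have [_ [g mg lg]] := Ll.1.
pose k w := Num.max 0 (Num.min 1 (g w)).
have mk : measurable_wrt G k.
  by apply: mw_max => //; [exact: mw_cst|apply: mw_min => //; exact: mw_cst].
have k01 w : 0 <= k w <= 1 by rewrite /k le_max lexx /= ge_max ler01 /= ge_min lexx.
have lk : \forall w \ae P, l w = k w.
  by apply: filterS2 lg l01 => w -> /andP[h1 h2]; rewrite /k min_r// max_r.
have part x c : A1 c -> measurable_wrt G x -> (forall w, 0 <= x w <= 1) ->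
    A1 (cumul (fun t w => x w * \1_(St t) w * incr c t w)).
  move=> Ac mx x01; apply: (cumul_dominated c) => //.
    move=> t; apply: (L0M P (F t) (sF t)); last by case: Ac => ac _; exact: adapted_incr.
    by apply: (L0_mw P (F t) (FM t)); exact: mw_mul_tau.
  move=> t w; rewrite !normrM ler_piMl// mulr_ile1//.
    by have /andP[h1 h2] := x01 w; rewrite ger0_norm.
  by case: (indic01 R (St t) w) => ->; rewrite ?normr0 ?normr1.
have A1k := part k a Aa mk k01.
have mk' : measurable_wrt G (fun w => 1 - k w) by apply: mwB => //; exact: mw_cst.
have A2k := part _ b Ab mk' (fun w => _).
have {}A2k : A1 (cumul (fun t w => (1 - k w) * \1_(St t) w * incr b t w)).
  by apply: A2k => w; have := k01 w; lra.
apply: (A1_eq _ _ (A1_add _ _ A1k A2k)).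
  move=> t; apply: measurable_funD; apply: measurable_funM => //.
  - by case: Aa => aa _; case: (aa t).
  - by apply: measurable_funB.
  - by case: Ab => ab _; case: (ab t).
apply: filterS3 lk (density_incr _ Da) (density_incr _ Db) => w e ha hb t.
rewrite /cumul /mix -(sum_incr a) -(sum_incr b) !mulr_sumr -!big_split /= e.
apply: eq_bigr => s _.
have [wS|wS] := pselect (St s w); first by rewrite indicSt_in//; ring.
by rewrite (proj2 (ha s) wS) (proj2 (hb s) wS) !mulr0.
Qed.

Lemma cpairing_mix l a b X : D a -> D b -> weight P F tau l -> Rinf X ->
  \forall w \ae P, cpairing X (mix l a b) w = l w * cpairing X a w + (1 - l w) * cpairing X b w.
Proof.
move=> Da Db lw RX; have Am := mix_A1 l a b Da Db lw.
have [Ll _] := lw.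
apply: cpairing_comb => //; [exact: density_A1|exact: density_A1| |].
  by apply: LinfB => //; exact: Linf_cst.
by apply: aeW => w t _; rewrite incr_mix; ring.
Qed.

Lemma density_mix l a b : D a -> D b -> weight P F tau l -> D (mix l a b).
Proof.
move=> Da Db lw; have Am := mix_A1 l a b Da Db lw; have [Ll l01] := lw.
apply: density_of_incr => //.
  apply: filterS3 l01 (density_incr _ Da) (density_incr _ Db) => w /andP[l0 l1] ha hb t.
  have [a0 az] := ha t; have [b0 bz] := hb t; rewrite incr_mix; split.
    by rewrite addr_ge0 ?mulr_ge0// subr_ge0.
  by move=> nS; rewrite az// bz// !mulr0 addr0.
move: (cpairing_mix l a b _ Da Db lw (Rinf_cst 1)) (density_one _ Da) (density_one _ Db).
move: (cpairing _ (mix l a b)) (cpairing _ a) (cpairing _ b) => c1 c2 c3.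
by apply: filterS3 => w -> -> ->; ring.
Qed.

(** Use [a] on the event where its conditional pairing is the smaller one, and
    [b] elsewhere: the indicator of this event is a weight. *)
Lemma finite_min_realized K X f : F_convex P F tau K -> K `<=` D -> Rinf X ->
  finite_min [set cpairing X a | a in K] f ->
  exists2 b, K b & \forall w \ae P, f w = cpairing X b w.
Proof.
move=> Kconv KD RX; elim => [_ [a Ka <-]|{}f g _ [a Ka fa] _ [b Kb gb]].
  by exists a => //; exact: aeW.
have Da := KD _ Ka; have Db := KD _ Kb.
have [ma _ _] := cpairing_spec X a RX (density_A1 _ Da).
have [mb _ _] := cpairing_spec X b RX (density_A1 _ Db).
pose A := [set w | cpairing X a w < cpairing X b w].
have GA : G A by exact: mw_lt.
have lw : weight P F tau (\1_A : T -> R).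
  by split; [exact: Linf_indic|apply: aeW => w; case: (indic01 R A w) => ->; rewrite lexx ler01].
exists (mix \1_A a b); first exact: Kconv.
have hmix := cpairing_mix _ a b X Da Db lw RX.
apply: filterS3 hmix fa gb => w -> -> ->.
rewrite /Num.min indicE /A; case: ifPn => h; first by rewrite mem_set// mul1r subrr mul0r addr0.
by rewrite memNset ?mul0r ?subr0 ?mul1r ?add0r//; exact/negP.
Qed.

Lemma Rinf_sum (I : Type) (s : seq I) (c : I -> R) (Xs : I -> process T R) : (forall i, Rinf (Xs i)) ->
  Rinf (fun t w => \sum_(i <- s) c i * Xs i t w) /\
  forall a, A1 a -> pairing P (fun t w => \sum_(i <- s) c i * Xs i t w) a = \sum_(i <- s) c i * pairing P (Xs i) a.
Proof.
move=> RX; elim: s => [|i s [RS pS]].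
  rewrite (_ : (fun t w => _) = fun _ _ => 0); last by apply/funext => t; apply/funext => w; rewrite big_nil.
  have R0 := Rinf_cst 0; split => // a Aa; rewrite (pairing_comb _ _ _ a a a 0 0 R0 R0 R0)//.
    by rewrite big_nil !mul0r addr0.
  by apply: aeW => w t; ring.
have e : (fun t w => \sum_(j <- i :: s) c j * Xs j t w) =
    fun t w => c i * Xs i t w + 1 * \sum_(j <- s) c j * Xs j t w.
  by apply/funext => t; apply/funext => w; rewrite big_cons mul1r.
have R2 : Rinf (fun t w => \sum_(j <- i :: s) c j * Xs j t w) by rewrite e; exact: Rinf_comb.
split => // a Aa; rewrite big_cons -pS// -[pairing P _ a in RHS]mul1r.
rewrite (pairing_comb (Xs i) (fun t w => \sum_(j <- s) c j * Xs j t w) _ a a a (c i) 1)//.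
  by rewrite !mul1r.
by apply: aeW => w t; rewrite big_cons; ring.
Qed.

(** * From continuity to a representation *)

Section coherent.
Hypothesis phi_coherent : coherent_utility P F tau theta phi.

Lemma phi_Linf X : Ron X -> Linf P G (phi X).
Proof. by case: phi_coherent => -[[h _ _ _] _] _; exact: h. Qed.

Lemma phi_measurable X : Ron X -> measurable_fun [set: T] (phi X).
Proof. by move=> /phi_Linf /Linf_measurable. Qed.

Lemma phi_eq X Y : Ron X -> Ron Y -> eq_process P X Y -> \forall w \ae P, phi X w = phi Y w.
Proof. by case: hphi => _ h; exact: h. Qed.

Lemma phi_mono X Y : Ron X -> Ron Y -> le_process P X Y -> \forall w \ae P, phi X w <= phi Y w.
Proof. by case: phi_coherent => -[[_ _ h _] _] _; exact: h. Qed.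

Lemma phi_homogeneous X x : Ron X -> Linf P G x -> (\forall w \ae P, 0 <= x w) ->
  \forall w \ae P, phi (fun t v => x v * X t v) w = x w * phi X w.
Proof. by case: phi_coherent => _; exact. Qed.

Lemma phi_translation X x : Ron X -> Linf P G x ->
  \forall w \ae P, phi (fun t v => X t v + x v * unit_process t v) w = phi X w + x w.
Proof. by case: phi_coherent => -[[_ _ _ h] _] _; exact: h. Qed.

(** Concavity at the midpoint of [2 * X] and [2 * Y]. *)
Lemma phi_superadditive X Y : Ron X -> Ron Y ->
  \forall w \ae P, phi X w + phi Y w <= phi (fun t v => X t v + Y t v) w.
Proof.
move=> RX RY; case: phi_coherent => -[_ conc] _.
have R2 Z : Ron Z -> Ron (fun t v => 2 * Z t v) by move=> RZ; apply: (Ron_mul Z (fun=> 2)) => //; exact: Linf_cst.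
have e2 Z : Ron Z -> \forall w \ae P, phi (fun t v => 2 * Z t v) w = 2 * phi Z w.
  move=> RZ; apply: (phi_homogeneous Z (fun=> 2)) => //; [exact: Linf_cst|exact: aeW].
have := conc _ _ (fun=> 2^-1) (R2 _ RX) (R2 _ RY).
have -> : mix (fun=> 2^-1) (fun t v => 2 * X t v) (fun t v => 2 * Y t v) = (fun t v => X t v + Y t v).
  by apply/funext => t; apply/funext => v; rewrite /mix; field.
have half : weight P F tau (fun=> 2^-1).
  split; first exact: Linf_cst.
  by apply: aeW => w; rewrite invr_ge0 invf_le1//; apply/andP; split; lra.
move=> /(_ half); apply: filterS3 (e2 _ RX) (e2 _ RY) => w -> ->.
by congr (_ <= _); field.
Qed.

Lemma Ron_unit_mul x : Linf P G x -> Ron (fun t v => x v * unit_process t v).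
Proof. by move=> Lx; apply: Ron_mul => //; exact: Ron_unit. Qed.

Lemma phi_unit x : Linf P G x -> \forall w \ae P, phi (fun t v => x v * unit_process t v) w = x w.
Proof.
move=> Lx; have R0 := Ron_unit_mul _ (Linf_cst 0).
have h0 := phi_homogeneous unit_process (fun=> 0) Ron_unit (Linf_cst 0) (aeW _ (fun=> lexx 0)).
have := phi_translation _ x R0 Lx.
rewrite (_ : (fun t v => 0 * unit_process t v + x v * unit_process t v) =
    fun t v => x v * unit_process t v); last first.
  by apply/funext => t; apply/funext => v; rewrite mul0r add0r.
by apply: filterS2 h0 => w ->; rewrite mul0r add0r.
Qed.

Lemma phi_bound X m : Ron X -> (\forall w \ae P, forall t, `|X t w| <= m) ->
  \forall w \ae P, `|phi X w| <= m.
Proof.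
move=> RX Xm.
have h1 : le_process P X (fun t v => m * unit_process t v).
  have /RonP[_ Xp] := RX; apply: filterS2 Xp Xm => w e h t; have := h t.
  rewrite e /proj_process /unit_process; case: (tau_le t w); rewrite ?mulr0 ?mulr1//.
  by move=> /(le_trans (ler_norm _)).
have h2 : le_process P (fun t v => (- m) * unit_process t v) X.
  have /RonP[_ Xp] := RX; apply: filterS2 Xp Xm => w e h t; have := h t.
  rewrite e /proj_process /unit_process; case: (tau_le t w); rewrite ?mulr0 ?mulr1//.
  by rewrite ler_norml => /andP[].
have k1 := phi_mono _ _ RX (Ron_unit_mul _ (Linf_cst m)) h1.
have k2 := phi_mono _ _ (Ron_unit_mul _ (Linf_cst (- m))) RX h2.
have e1 := phi_unit _ (Linf_cst m); have e2 := phi_unit _ (Linf_cst (- m)).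
apply: filterS2 (filterI k1 k2) (filterI e1 e2) => w [p q] [r s].
by rewrite ler_norml -{1}s q /= -[leRHS]r p.
Qed.

Lemma phi_integrable X : Ron X -> integrable (phi X).
Proof.
move=> RX; have [_ [m pm]] := phi_Linf X RX.
exact: (ae_bounded_integrable _ m (phi_measurable X RX) pm).
Qed.

Hypothesis phi_continuous : continuous_decreasing P F tau theta phi.
Local Notation TO := (g_sigma_algebraType (optional_sets F)).
Local Notation mu := (optional_measure P F sF FM).

Definition path_of (f : TO -> R) : process T R := fun t w => f (w, t).

Lemma path_Rinf f : bm f -> Rinf (path_of f).
Proof.
move=> [/(optional_measurable_fun F sF) mf [M fM]]; split; last by exists M; apply: aeW => w t; exact: fM.
by move=> t; apply: (L0_mw P (F t) (FM t)); exact: mf.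
Qed.

Let u (f : TO -> R) := E (phi (proj (path_of f))).

(** On bounded optional functions, [u] satisfies the hypotheses of
    [separating_density]. *)
Lemma optional_utility_density (x0 : TO -> R) : bm x0 -> u x0 < 0 ->
  exists h : TO -> R, [/\ measurable_fun [set: TO] h, forall z, 0 <= h z,
    mu.-integrable [set: TO] (EFin \o h),
    forall x, bm x -> u x <= Rintegral mu [set: TO] (fun z => x z * h z) &
    Rintegral mu [set: TO] (fun z => x0 z * h z) <= 0].
Proof.
have Rp f : bm f -> Ron (proj (path_of f)) by move=> bf; apply: proj_Ron; exact: path_Rinf.
apply: separating_density.
- move=> f g bf bg; rewrite /u -RintegralD//; [|exact: phi_integrable (Rp _ bf)|exact: phi_integrable (Rp _ bg)].
  apply: ae_le_Rintegral.
  + have LD := LinfD _ _ (phi_Linf _ (Rp _ bf)) (phi_Linf _ (Rp _ bg)).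
    have [_ [m hm]] := LD; exact: (ae_bounded_integrable _ m (Linf_measurable _ LD) hm).
  + by apply: phi_integrable; apply: Rp; exact: bmD.
  + rewrite (_ : proj (path_of (fun z => f z + g z)) = fun t v => proj (path_of f) t v + proj (path_of g) t v).
      exact: phi_superadditive (Rp _ bf) (Rp _ bg).
    by apply/funext => t; apply/funext => v; rewrite /proj_process; case: ifP; rewrite ?addr0.
- move=> c f c0 bf; rewrite /u -RintegralZl//; last exact: phi_integrable (Rp _ bf).
  apply: ae_Rintegral_eq.
  + by apply: phi_measurable; apply: Rp; exact: bmZ.
  + by apply: measurable_funM => //; exact: phi_measurable (Rp _ bf).
  + rewrite (_ : proj (path_of (fun z => c * f z)) = fun t v => c * proj (path_of f) t v).
      apply: (phi_homogeneous _ (fun=> c)) => //; [exact: Rp|exact: Linf_cst|exact: aeW].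
    by apply/funext => t; apply/funext => v; rewrite /proj_process; case: ifP; rewrite ?mulr0.
- move=> f g bf bg fg; apply: ae_le_Rintegral; [exact: phi_integrable (Rp _ bf)|exact: phi_integrable (Rp _ bg)|].
  apply: phi_mono; [exact: Rp|exact: Rp|].
  have /ae_foralln h : forall t, \forall w \ae P, f (w, t) <= g (w, t) by exact: (ae_slice P F sF FM _ fg).
  by apply: filterS h => w h t; rewrite /proj_process; case: ifP => // _; exact: h.
move=> zs z M mzs bz zsM zsdec zscv.
have bzs n : bm (zs n) by split => //; exists M.
apply: (ae_bounded_convergence _ _ M).
- by move=> n; apply: phi_measurable; exact: Rp.
- by apply: phi_measurable; exact: Rp.
- apply/ae_foralln => n; apply: phi_bound; first exact: Rp.
  by apply: aeW => w; apply: proj_bounded => t; exact: zsM.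
apply: phi_continuous.
- by move=> n; exact: Rp.
- exact: Rp.
- by move=> n; apply: aeW => w t; rewrite /proj_process; case: ifP => // _; exact: zsdec.
- move=> t; apply: aeW => w; rewrite /proj_process; case: ifP => _; last exact: cvg_cst.
  exact: zscv.
Qed.

(** An optional function is adapted and bounded everywhere, while a process in
    [Rinf] is so up to almost sure equality. *)
Lemma strict_version Y : Rinf Y -> exists (y : process T R) (M : R),
  [/\ forall t, measurable_wrt (F t) (y t), forall t w, `|y t w| <= M & eq_process P Y y].
Proof.
move=> [aY [m Ym]].
have /choice [y yP] : forall t, exists g,
    [/\ measurable_wrt (F t) g, forall w, `|g w| <= `|m| & \forall w \ae P, Y t w = g w].
  by move=> t; apply: L0_version => //; apply: filterS Ym.
exists y, `|m|; split; [by move=> t; case: (yP t)|by move=> t; case: (yP t)|].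
by apply/ae_foralln => t; case: (yP t).
Qed.

Let on_interval (y : process T R) : TO -> R := fun z => \1_(St z.2) z.1 * y z.2 z.1.

Lemma on_interval_bm y M : (forall t, measurable_wrt (F t) (y t)) -> (forall t w, `|y t w| <= M) ->
  bm (on_interval y).
Proof.
move=> my yM; split.
  apply/(optional_measurable_fun F sF) => t; apply: (mwM _ (sF t)); last exact: my.
  by apply: (mw_indic _ (sF t)); exact: F_St1.
exists M => -[w t]; rewrite /on_interval normrM /=.
by case: (indic01 R (St t) w) => ->; rewrite ?normr0 ?normr1 ?mul0r ?mul1r// (le_trans _ (yM t w)).
Qed.

(** Cutting to the interval does not change the projection, and makes the density
    vanish outside the interval. *)
Lemma on_interval_path Y y : Ron Y -> eq_process P Y y ->
  eq_process P Y (proj (path_of (on_interval y))).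
Proof.
move=> /RonP [_ Yp] Yy.
apply: filterS3 Yp Yy (filterI htau_fin htau_theta) => w hp hy [tfin tth] t.
rewrite hp /proj_process; case: ifPn => // tt; rewrite /path_of /on_interval /= hy.
rewrite indicSt_in ?mul1r// /St /=.
move: tth tt; case: (tau w) tfin => // n _; case: (theta w) => [k|] /=; last by move=> _ ->.
by rewrite leq_min => -> ->; rewrite geq_minr.
Qed.

(** The process [a] has increments [1_(St t) * 2^-(t+1) * h (_, t)].  For [y >= 0]
    the identity is a computation with nonnegative series; in general, [y] is the
    difference of [y + M] and [M]. *)
Lemma optional_integral_pairing (h : TO -> R) :
  measurable_fun [set: TO] h -> (forall z, 0 <= h z) -> mu.-integrable [set: TO] (EFin \o h) ->
  exists a, [/\ A1 a, \forall w \ae P, forall t, 0 <= incr a t w /\ (~ St t w -> incr a t w = 0) &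
   forall y M, (forall t, measurable_wrt (F t) (y t)) -> (forall t w, `|y t w| <= M) ->
     Rintegral mu [set: TO] (fun z => on_interval y z * h z) = pairing P y a].
Proof.
move=> mh h0 ih.
pose D0 : process T R := fun t w => \1_(St t) w * (time_weight t * h (w, t)).
have mht t : measurable_wrt (F t) (fun w => h (w, t)) by exact: (optional_measurable_fun F sF h).1.
have w0 := @time_weight_ge0 R.
have D00 t w : 0 <= D0 t w.
  by rewrite /D0 mulr_ge0 ?mulr_ge0//; case: (indic01 R (St t) w) => ->.
have aD : adapted P F D0.
  move=> t; apply: (L0_mw P (F t) (FM t)); apply: (mwM _ (sF t)).
    by apply: (mw_indic _ (sF t)); exact: F_St1.
  by apply: (mwM _ (sF t)) (mht t); exact: (mw_cst _ (sF t)).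
have mhT t : measurable_fun [set: T] (fun w => h (w, t)) by exact: (mw_measurable _ (FM t) _ (mht t)).
have Afin : (\int[P]_w \sum_(0 <= t <oo) `|D0 t w|%:E < +oo)%E.
  apply: (@le_lt_trans _ _ (\int[P]_w \sum_(0 <= t <oo) (time_weight t * h (w, t))%:E)%E).
    apply: ge0_le_integral => //.
    - by move=> w _; apply: nneseries_ge0 => t _ _; rewrite lee_fin.
    - apply: ge0_emeasurable_sum => [t w _ _|t _]; first by rewrite lee_fin.
      by apply/measurable_EFinP; apply: measurableT_comp => //; case: (aD t).
    - apply: ge0_emeasurable_sum => [t w _ _|t _]; first by rewrite lee_fin mulr_ge0.
      by apply/measurable_EFinP; apply: measurable_funM.
    - move=> w _; apply: lee_nneseries => t _ //; rewrite lee_fin ger0_norm// /D0.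
      by case: (indic01 R (St t) w) => ->; rewrite ?mul0r ?mul1r// mulr_ge0.
  rewrite -(optional_integral P F sF FM h mh h0).
  have /integrableP[_] := ih; apply: le_lt_trans.
  by under [leRHS]eq_integral do rewrite /= ger0_norm//.
have Aa : A1 (cumul D0) by exact: cumul_A1.
exists (cumul D0); split => //.
  apply: aeW => w t; rewrite incr_cumul; split => // nS.
  by rewrite /D0 indicSt_notin ?mul0r.
have nonneg y M : (forall t, measurable_wrt (F t) (y t)) -> (forall t w, `|y t w| <= M) ->
    (forall t w, 0 <= y t w) ->
    Rintegral mu [set: TO] (fun z => on_interval y z * h z) = pairing P y (cumul D0).
  move=> my yM y0; have [mo _] := on_interval_bm y M my yM.
  rewrite /Rintegral (optional_integral P F sF FM).
  - rewrite /pairing; congr fine; apply: eq_integral => w _; apply: eq_eseriesr => t _.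
    by rewrite incr_cumul /D0 /on_interval /=; congr EFin; ring.
  - exact: measurable_funM.
  - move=> -[w t]; rewrite /on_interval /= mulr_ge0// mulr_ge0//.
move=> y M my yM.
pose y1 : process T R := fun t w => y t w + M.
have M0 : 0 <= M by have [w _] := ae_exists _ htau_fin; exact: le_trans (yM 0%N w).
have my1 t : measurable_wrt (F t) (y1 t) by apply: (mwD _ (sF t)) => //; exact: (mw_cst _ (sF t)).
have y1M t w : `|y1 t w| <= M + M.
  by apply: le_trans (ler_normD _ _) _; rewrite lerD// ger0_norm.
have y10 t w : 0 <= y1 t w by have := yM t w; rewrite /y1 ler_norml => /andP[+ _]; lra.
have mc t : measurable_wrt (F t) ((fun _ _ => M) t : T -> R) by exact: (mw_cst _ (sF t)).
have cM (t : nat) (w : T) : `|(fun _ _ => M) t w : R| <= M by rewrite ger0_norm.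
have e1 := nonneg y1 (M + M) my1 y1M y10.
have e2 := nonneg (fun _ _ => M) M mc cM (fun _ _ => M0).
have b1 := on_interval_bm y1 _ my1 y1M; have b2 := on_interval_bm (fun _ _ => M) M mc cM.
have rinf (x : process T R) N : (forall t, measurable_wrt (F t) (x t)) -> (forall t w, `|x t w| <= N) -> Rinf x.
  move=> mx xN; split; last by exists N; apply: aeW => w t; exact: xN.
  by move=> t; apply: (L0_mw P (F t) (FM t)); exact: mx.
rewrite (pairing_comb y1 (fun _ _ => M) y (cumul D0) (cumul D0) (cumul D0) 1 (-1))//; last 4 first.
- exact: rinf my1 y1M.
- exact: rinf mc cM.
- exact: rinf my yM.
- by apply: aeW => w t; rewrite /y1; ring.
rewrite -e1 -e2 mul1r mulN1r -RintegralB//; [|exact: integrableMbm|exact: integrableMbm].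
by apply: eq_Rintegral => z _; rewrite /on_interval /y1; ring.
Qed.

Lemma density_exists Y0 : Ron Y0 -> E (phi Y0) < 0 -> exists a,
  [/\ A1 a, \forall w \ae P, forall t, 0 <= incr a t w /\ (~ St t w -> incr a t w = 0),
   forall Y, Ron Y -> E (phi Y) <= pairing P Y a & pairing P Y0 a <= 0].
Proof.
move=> RY0 Y00.
have key Y : Ron Y -> exists y M, [/\ forall t, measurable_wrt (F t) (y t), forall t w, `|y t w| <= M,
    eq_process P Y y & u (on_interval y) = E (phi Y)].
  move=> RY; have [y [M [my yM Yy]]] := strict_version Y (Ron_Rinf _ RY).
  exists y, M; split => //.
  have RY' : Ron (proj (path_of (on_interval y))).
    by apply: proj_Ron; apply: path_Rinf; exact: on_interval_bm my yM.
  apply: ae_Rintegral_eq; [exact: phi_measurable|exact: phi_measurable|].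
  apply: phi_eq => //; have := on_interval_path Y y RY Yy.
  by apply: filterS => w h t.
have pair_eq Y y a : Ron Y -> A1 a -> (forall t, measurable_wrt (F t) (y t)) ->
    eq_process P Y y -> pairing P y a = pairing P Y a.
  move=> RY Aa my Yy; have RY' := Ron_Rinf _ RY.
  have Ry : Rinf y.
    case: RY' => _ [m Ym]; split; first by move=> t; apply: (L0_mw P (F t) (FM t)); exact: my.
    by exists m; apply: filterS2 Ym Yy => w h e t; rewrite -e.
  by apply: pairing_eq => //; apply: filterS Yy => w e t; rewrite e.
have [y0 [M0 [my0 y0M Yy0 uy0]]] := key Y0 RY0.
have [|h [mh h0 ih hu hx0]] := optional_utility_density (on_interval y0) (on_interval_bm y0 M0 my0 y0M).
  by rewrite -/(u _) uy0.
have [a [Aa ha pa]] := optional_integral_pairing h mh h0 ih.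
exists a; split => //.
  move=> Y RY; have [y [M [my yM Yy uy]]] := key Y RY.
  rewrite -uy -(pair_eq Y y)// -(pa y M)//; apply: hu; exact: on_interval_bm my yM.
by rewrite -(pair_eq Y0 y0)// -(pa y0 M0).
Qed.

(** The densities that can be added to a set representing [phi] without changing
    the essential infimum. *)
Definition dominating_densities : set (process T R) :=
  [set a | D a /\ forall Y, Ron Y -> \forall w \ae P, phi Y w <= cpairing Y a w].

(** Apply the unconditional inequality to [1_A * Y], for [A] known at [tau], and
    homogeneity.  With [1_A] and [- 1_A] in place of [Y] this gives the
    normalisation of [a]. *)
Lemma dominating_density a : A1 a ->
  (\forall w \ae P, forall t, 0 <= incr a t w /\ (~ St t w -> incr a t w = 0)) ->
  (forall Y, Ron Y -> E (phi Y) <= pairing P Y a) -> dominating_densities a.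
Proof.
move=> Aa ha hY.
have Lind A : G A -> Linf P G (\1_A : T -> R) by exact: Linf_indic.
have mind A : G A -> measurable_wrt G (\1_A : T -> R) by move=> GA; exact: mw_indic.
have one : \forall w \ae P, cpairing (fun _ _ => 1) a w = 1.
  have R1 := Rinf_cst 1.
  have [mc ic cE] := cpairing_spec (fun _ _ => 1) a R1 Aa.
  have m1 : measurable_wrt G (fun=> 1 : R) by exact: mw_cst.
  have i1 : integrable (fun=> 1) by apply: bm_integrable; exact: bm_cst.
  have test A : G A -> E (fun w => \1_A w * cpairing (fun _ _ => 1) a w) = E (fun w => \1_A w * 1).
    move=> GA; rewrite cE; [|exact: mind|exact: bounded_indic].
    have RA := Ron_unit_mul _ (Lind A GA); have RA' := Ron_Rinf _ RA.
    have pE : pairing P (locf \1_A (fun _ _ => 1)) a = pairing P (fun t w => \1_A w * unit_process t w) a.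
      have RL : Rinf (locf \1_A (fun _ _ => 1)).
        by apply: locf_Rinf => //; [exact: mind|exact: bounded_indic].
      apply: pairing_eq => //; apply: filterS ha => w h t; have [_ hz] := h t; rewrite /locf.
      have [wS|wS] := pselect (St t w); first by rewrite indicSt_in// unit_St// mul1r.
      by rewrite hz// !mulr0.
    have bA : bm (\1_A : T -> R) by apply: bm_indic; exact: GM.
    rewrite pE; under [RHS]eq_Rintegral do rewrite mulr1.
    apply/eqP; rewrite eq_le; apply/andP; split.
      rewrite -lerN2.
      have LN : Linf P G (fun w => - 1 * \1_A w) by apply: LinfM; [exact: Linf_cst|exact: Lind].
      have RN := Ron_unit_mul _ LN.
      have := hY _ RN.
      pose U t w : R := \1_A w * unit_process t w.
      rewrite (pairing_comb U U (fun t v => -1 * \1_A v * unit_process t v) a a a (-1) 0)//; last 2 first.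
        exact: Ron_Rinf.
        by apply: aeW => w t; rewrite /U; ring.
      rewrite mulN1r mul0r addr0 [X in X <= _](_ : _ = - E (\1_A : T -> R))//.
      rewrite (ae_Rintegral_eq _ (fun w => -1 * \1_A w)).
      - by rewrite (bm_integralZ P)// mulN1r.
      - exact: phi_measurable.
      - exact: Linf_measurable.
      - exact: phi_unit.
    apply: le_trans (hY _ RA); rewrite le_eqVlt; apply/orP; left; apply/eqP/esym.
    apply: ae_Rintegral_eq; [exact: phi_measurable|by case: bA|exact: phi_unit (Lind A GA)].
  exact: (ae_eq_of_integrals P G sG GM).
split; first exact: density_of_incr.
move=> Y RY; apply: cpairing_geP => //; [exact: Ron_Rinf|exact: phi_Linf|].
move=> A GA; have RAY := Ron_mul Y _ RY (Lind A GA).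
rewrite pairing_locf//; [|exact: mind|exact: bounded_indic|exact: Ron_Rinf|exact: Ron_Rinf].
apply: le_trans (hY _ RAY); rewrite le_eqVlt; apply/orP; left; apply/eqP.
apply: ae_Rintegral_eq.
- by apply: measurable_funM; [apply: measurable_indic; exact: GM|exact: phi_measurable].
- exact: phi_measurable.
- have := phi_homogeneous Y _ RY (Lind A GA); move=> h.
  have {}h : \forall w \ae P, phi (fun t v => \1_A v * Y t v) w = \1_A w * phi Y w.
    by apply: h; apply: aeW => w; case: (indic01 R A w) => ->.
  by apply: filterS h => w ->.
Qed.

(** Separate the process [X - (E (phi X) + e)], whose utility has expectation [- e]. *)
Lemma dominating_density_approx X e : Ron X -> 0 < e ->
  exists2 a, dominating_densities a & pairing P X a <= E (phi X) + e.
Proof.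
move=> RX e0; pose c := E (phi X) + e.
have RY : Ron (fun t w => X t w + (- c) * unit_process t w).
  by apply: (Ron_translation _ (fun=> - c)) => //; exact: Linf_cst.
have EY : E (phi (fun t w => X t w + (- c) * unit_process t w)) = - e.
  rewrite (ae_Rintegral_eq _ (fun w => phi X w + - c)).
  - rewrite RintegralD//; [|exact: phi_integrable|by apply: bm_integrable; exact: bm_cst].
    rewrite E_cst /c; ring.
  - exact: phi_measurable.
  - by apply: measurable_funD => //; exact: phi_measurable.
  - by apply: phi_translation => //; exact: Linf_cst.
have [|a [Aa ha hY h0]] := density_exists _ RY; first by rewrite EY oppr_lt0.
have Qa := dominating_density a Aa ha hY.
exists a => //; rewrite -subr_le0; apply: le_trans h0.
have RU := Ron_Rinf _ Ron_unit; have RX' := Ron_Rinf _ RX.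
rewrite (pairing_comb X unit_process (fun t w => X t w + (- c) * unit_process t w) a a a 1 (- c))//; last 2 first.
- exact: Ron_Rinf.
- by apply: aeW => w t; ring.
rewrite pairing_unit; last by case: Qa.
by rewrite mul1r mulr1.
Qed.

(** The limit of finite minima [z] is at least [phi X], and its expectation is at
    most that of [phi X] by [dominating_density_approx]. *)
Lemma dominating_represents : represents P F tau theta dominating_densities phi.
Proof.
have [a0 Qa0 _] := dominating_density_approx unit_process 1 Ron_unit ltr01.
split; [by exists a0|by move=> a []|move=> X RX].
have RX' := Ron_Rinf _ RX.
have [_ [m Xm]] := RX'.
have Xm' : \forall w \ae P, forall t, `|X t w| <= `|m|.
  by apply: filterS Xm => w h t; apply: le_trans (h t) (ler_norm _).
pose B := [set cpairing X a | a in dominating_densities].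
have [||gs [z [gsB [mz zm] gsz zle]]] := finite_min_approx B `|m| _ (normr_ge0 m).
- by exists (cpairing X a0); exists a0.
- move=> _ [a [Da _] <-]; split; last exact: cpairing_bound.
  by case: (cpairing_spec X a RX' (density_A1 _ Da)).
have phig f : finite_min B f -> \forall w \ae P, phi X w <= f w.
  elim => [_ [a [Da ha] <-]|{}f g _ h1 _ h2]; first exact: ha.
  by apply: filterS2 h1 h2 => w p q; rewrite le_min p q.
have /ae_foralln phigs : forall n, \forall w \ae P, phi X w <= gs n w by move=> n; exact: phig.
have phiz : \forall w \ae P, phi X w <= z w.
  by apply: filterS2 phigs gsz => w h [_ cv]; exact: cvg_ge h cv.
have mphi := phi_measurable X RX; have mz' : measurable_fun [set: T] z by exact: mw_measurable mz.
have iz : integrable z by apply: bm_integrable; split=> //; exists `|m|.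
have iphi := phi_integrable X RX.
have Ez : E z <= E (phi X).
  apply/ler_addgt0Pr => e e0; have [a Qa ha] := dominating_density_approx X e RX e0.
  have Da : D a by case: Qa.
  apply: le_trans ha; rewrite pairing_cpairing//.
  have [mc ic _] := cpairing_spec X a RX' (density_A1 _ Da).
  by apply: ae_le_Rintegral => //; apply: zle; exists a.
have zE : \forall w \ae P, phi X w = z w by exact: ae_eq_of_Rintegral_le.
apply: (ess_infP B (EFin \o phi X)); split.
- exact/measurable_EFinP.
- by move=> f Bf; apply: filterS (phig f (finite_min1 _ _ Bf)) => w; rewrite /= lee_fin.
- move=> W mW hW.
  have Wg f : finite_min B f -> \forall w \ae P, (W w <= (f w)%:E)%E.
    elim => [{}f Bf|{}f g _ h1 _ h2]; first exact: hW.
    by apply: filterS2 h1 h2 => w p q; rewrite /Num.min; case: ifP.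
  have /ae_foralln Wgs : forall n, \forall w \ae P, (W w <= (gs n w)%:E)%E by move=> n; exact: Wg.
  apply: filterS3 Wgs gsz zE => w h [_ cv] e; rewrite /= e.
  have cvE : (gs n w)%:E @[n --> \oo] --> (z w)%:E by apply: cvg_EFin; [exact: nearW|exact: cv].
  rewrite -(cvg_lim _ cvE)//; apply: lime_ge; last exact: nearW.
  by apply/cvg_ex; eexists; exact: cvE.
Qed.

(** * Dominating densities form the smallest closed convex set *)

(** For any [Y], the process [Y - phi Y] on the interval is accepted; conversely the zero
    process is accepted, so that the infimum over accepted processes is zero. *)
Lemma null_densitiesE : null_densities P F tau theta phi = dominating_densities.
Proof.
have R0 := Ron_unit_mul _ (Linf_cst 0).
have C0 : acceptance P F tau theta phi (fun t v => 0 * unit_process t v).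
  by split => //; apply: filterS (phi_unit _ (Linf_cst 0)) => w ->.
apply/seteqP; split => a.
  move=> [Da conj0]; split => // Y RY.
  have : is_ess_inf P [set cpairing X a | X in acceptance P F tau theta phi] (EFin \o (fun=> 0)).
    apply: ess_inf_finite; first exact: measurable_cst.
    by apply: filterS conj0 => w /esym.
  move=> [_ h _].
  have LN : Linf P G (fun w => - phi Y w).
    have := LinfB (fun=> 0) (phi Y) (Linf_cst 0) (phi_Linf Y RY).
    by under eq_fun do rewrite sub0r.
  pose Z : process T R := fun t v => Y t v + - phi Y v * unit_process t v.
  have RZ : Ron Z by exact: Ron_translation.
  have CZ : acceptance P F tau theta phi Z.
    split => //; have := phi_translation Y _ RY LN.
    by apply: filterS => w ->; rewrite subrr.
  have hZ := h _ (ex_intro2 _ _ Z CZ erefl).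
  move: hZ (cpairing_translation Y a _ RY Da LN); rewrite -/Z.
  move: (cpairing Z a) (cpairing Y a) => cZ cY.
  by apply: filterS2 => w /= + e; rewrite lee_fin e subr_ge0.
move=> [Da ha]; split => //.
have : is_ess_inf P [set cpairing X a | X in acceptance P F tau theta phi] (fun=> 0%E).
  split; first exact: measurable_cst.
  - move=> _ [X [RX X0] <-]; move: (ha X RX); move: (cpairing X a) => c.
    by apply: filterS2 X0 => w p q; rewrite lee_fin; exact: le_trans p q.
  - move=> W mW hW; have := hW _ (ex_intro2 _ _ _ C0 erefl).
    have := cpairing_bound a _ 0 Da (Ron_Rinf _ R0).
    move: (cpairing _ a) => c h1 h2.
    have {}h1 : \forall w \ae P, `|c w| <= 0.
      by apply: h1; apply: aeW => w t; rewrite mul0r normr0.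
    by apply: filterS2 h1 h2 => w; rewrite normr_le0 => /eqP ->.
by move=> /ess_infP; apply: filterS => w /esym.
Qed.

(** Pairing with it reads the increment at time [t] ([pairing_at_time]). *)
Definition at_time t (x : T -> R) : process T R := fun s w => if s == t then x w else 0.

Lemma at_time_Rinf t x : measurable_wrt (F t) x -> (exists M : R, forall w, `|x w| <= M) ->
  Rinf (at_time t x).
Proof.
move=> mx [M xM]; split.
  move=> s; rewrite /at_time; case: eqP => [->|_]; last exact: L0_cst.
  by apply: (L0_mw P (F t) (FM t)).
exists `|M|; apply: aeW => w s; rewrite /at_time; case: eqP => _; last by rewrite normr0.
exact: le_trans (xM w) (ler_norm _).
Qed.

Lemma pairing_at_time t x b : measurable_wrt (F t) x -> (exists M : R, forall w, `|x w| <= M) ->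
  A1 b -> pairing P (at_time t x) b = E (fun w => x w * incr b t w).
Proof.
move=> mx xM Ab; have c := pairing_cvg _ _ (at_time_Rinf t x mx xM) Ab.
apply: (cvg_unique _ c) => //; apply: cvg_near_cst; exists t.+1 => // n /= tn.
rewrite -[RHS](sum_at _ _ _ _ tn); apply: eq_bigr => s _; rewrite /at_time.
by case: eqP => [->//|_]; under eq_Rintegral do rewrite mul0r; rewrite E_cst.
Qed.

(** Inequalities between pairings express that increments are nonnegative, that
    they vanish outside the interval, and that [E (phi Y) <= <Y, a>]; this is
    enough by [dominating_density]. *)
Lemma dominating_densities_closed : A1_closed P F dominating_densities.
Proof.
apply: A1_closed_polar => [a [Da _]|a Aa h]; first exact: density_A1.
have mi t : L0 P (F t) (incr a t) by case: Aa => aa _; exact: adapted_incr.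
have ii t : integrable (incr a t) by exact: A1_incr_integrable.
have mB t B : F t B -> measurable_wrt (F t) (\1_B : T -> R) by move=> FB; apply: (mw_indic _ (sF t)).
have pos t : \forall w \ae P, 0 <= incr a t w.
  have [_ [g mg ag]] := mi t.
  have ig : integrable g := ae_integrable _ _ (mw_measurable _ (FM t) _ mg) ag (ii t).
  have m0 : measurable_wrt (F t) (fun=> 0 : R) by apply: (mw_cst _ (sF t)).
  have i0 : integrable (fun=> 0) by apply: bm_integrable; exact: bm_cst.
  have : \forall w \ae P, 0 <= g w.
    apply: (ae_le_of_integrals P _ (sF t) (FM t) _ _ m0 mg i0 ig) => B FB.
    have mB' : measurable_fun [set: T] (\1_B : T -> R) by apply: measurable_indic; exact: FM FB.
    rewrite (ae_Rintegral_eq (fun w => \1_B w * g w) (fun w => \1_B w * incr a t w)); last 3 first.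
    - by apply: measurable_funM => //; exact: (mw_measurable _ (FM t) _ mg).
    - by apply: measurable_funM => //; case: (mi t).
    - by apply: filterS ag => w ->.
    under eq_Rintegral do rewrite mulr0.
    rewrite E_cst -pairing_at_time//; [|exact: mB|exact: bounded_indic].
    apply: h; first by apply: at_time_Rinf; [exact: mB|exact: bounded_indic].
    move=> b [Db _]; apply: pairing_ge0; [|exact: density_A1|].
      by apply: at_time_Rinf; [exact: mB|exact: bounded_indic].
    apply: filterS (density_incr _ Db) => w hb s; rewrite /at_time.
    by apply: mulr_ge0; [case: eqP => // _; case: (indic01 R B w) => ->|case: (hb s)].
  by apply: filterS2 ag => w ->.
have zero t : \forall w \ae P, ~ St t w -> incr a t w = 0.
  pose J w : R := 1 - \1_(St t) w.
  have mJ : measurable_wrt (F t) J.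
    by apply: (mwB _ (sF t)); [exact: (mw_cst _ (sF t))|apply: (mw_indic _ (sF t)); exact: F_St1].
  have J01 w : `|J w| <= 1.
    by rewrite /J; case: (indic01 R (St t) w) => ->; rewrite ?subrr ?subr0 ?normr0 ?normr1.
  have bJ : bm J by split; [exact: mw_measurable mJ|exists 1].
  have : \forall w \ae P, J w * incr a t w = 0.
    apply: (ae_zero_of_tests t).
    - by apply: (L0M P (F t) (sF t)) (mi t); exact: (L0_mw P (F t) (FM t)).
    - exact: integrableMbm.
    move=> B FB.
    have test (c : R) : 0 <= c * E (fun w => \1_B w * (J w * incr a t w)).
      have bB : bm (\1_B : T -> R) by apply: bm_indic; exact: FM FB.
      have mx : measurable_wrt (F t) (fun w => c * (\1_B w * J w)).
        apply: (mwM _ (sF t)); first exact: (mw_cst _ (sF t)).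
        by apply: (mwM _ (sF t)) => //; exact: mB.
      have [_ xM] : bm (fun w => c * (\1_B w * J w)) by apply: bmZ; exact: bmM.
      rewrite -RintegralZl//; last by apply: integrableMbm => //; exact: integrableMbm.
      rewrite (_ : (fun w => _) = fun w => (c * (\1_B w * J w)) * incr a t w); last by apply/funext => w; ring.
      rewrite -pairing_at_time//; apply: h; first exact: at_time_Rinf.
      move=> b [Db _]; have Ab := density_A1 _ Db.
      rewrite pairing_at_time// -[leLHS](E_cst P) le_eqVlt; apply/orP; left; apply/eqP.
      have mb : measurable_fun [set: T] (incr b t) by exact: A1_incr_measurable.
      apply: ae_Rintegral_eq.
      - exact: measurable_cst.
      - by apply: measurable_funM => //; exact: (mw_measurable _ (FM t) _ mx).
      - apply: filterS (density_incr _ Db) => w hb; rewrite /J.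
        have [wS|wS] := pselect (St t w); first by rewrite indicSt_in//; ring.
        by rewrite (proj2 (hb t) wS) mulr0.
    have := test 1; have := test (-1); lra.
  by apply: filterS => w + wS; rewrite /J indicSt_notin// subr0 mul1r.
apply: dominating_density => //.
  have /ae_foralln h1 := pos; have /ae_foralln h2 := zero.
  by apply: filterS2 h1 h2 => w p q t; split; [exact: p|exact: q].
move=> Y RY; apply: h; first exact: Ron_Rinf.
move=> b [Db hb]; have RY' := Ron_Rinf _ RY; rewrite pairing_cpairing//.
have [mc ic _] := cpairing_spec Y b RY' (density_A1 _ Db).
by apply: ae_le_Rintegral => //; [exact: phi_integrable|exact: hb].
Qed.

Lemma dominating_densities_convex : F_convex P F tau dominating_densities.
Proof.
move=> a b l [Da ha] [Db hb] lw; split; first exact: density_mix.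
move=> Y RY; have [_ l01] := lw.
move: (cpairing_mix l a b Y Da Db lw (Ron_Rinf _ RY)) (ha Y RY) (hb Y RY).
move: (cpairing Y (mix l a b)) (cpairing Y a) (cpairing Y b) => c1 c2 c3 e h1 h2.
apply: filterS3 (filterI e l01) h1 h2 => w [-> /andP[l0 l1]] p q.
have -> : phi Y w = l w * phi Y w + (1 - l w) * phi Y w by ring.
by apply: lerD; apply: ler_wpM2l => //; rewrite subr_ge0.
Qed.

Lemma nth_In (A : Type) (x0 : A) s (i : 'I_(size s)) : List.In (nth x0 s i) s.
Proof.
case: i => i; elim: s i => [|x s IH] [|i] //= si; first by left.
by right; exact: IH.
Qed.

Lemma In_nth (A : Type) (x0 x : A) s : List.In x s -> exists i : 'I_(size s), x = nth x0 s i.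
Proof.
elim: s => [//|y s IH] /= [<-|/IH [i ->]]; first by exists ord0.
by exists (lift ord0 i).
Qed.

(** Weak closedness reduces the claim to finitely many processes, where a point
    that is far from [K] is separated from it by a combination [Z] of them.  The minima that
    approximate [phi Z] are conditional pairings of [Z] with elements of [K],
    hence bounded below in expectation by the pairing of [Z] with [a0] plus [del]. *)
Lemma dominating_densities_least Q K : represents P F tau theta Q phi ->
  closed_convex_densities P F tau theta K -> Q `<=` K -> dominating_densities `<=` K.
Proof.
move=> hQ [KD Kcl Kconv] QK a0 [Da0 ha0].
have KA a : K a -> A1 a by move=> /KD /density_A1.
apply: (A1_closed_approx P F K a0 Kcl KA (density_A1 _ Da0)) => s e RXs e0.
apply: contrapT => far.
pose Xs (i : 'I_(size s)) := nth unit_process s i.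
have RX i : Rinf (Xs i) by apply: RXs; exact: nth_In.
pose v a i := pairing P (Xs i) a - pairing P (Xs i) a0.
have /choice [Ms MsP] : forall i, exists M : R, \forall w \ae P, forall t, `|Xs i t w| <= M.
  by move=> i; case: (RX i) => _ [M h]; exists M.
have p_bound i a : D a -> `|pairing P (Xs i) a| <= Ms i.
  move=> Da; rewrite pairing_cpairing//.
  have [mc ic _] := cpairing_spec (Xs i) a (RX i) (density_A1 _ Da).
  have hb := cpairing_bound a (Xs i) (Ms i) Da (RX i) (MsP i).
  have iM c : integrable (fun=> c) by apply: bm_integrable; exact: bm_cst.
  rewrite ler_norml; apply/andP; split.
    rewrite -[leLHS](E_cst P); apply: ae_le_Rintegral => //.
    by move: hb; move: (cpairing _ a) => c; apply: filterS => w; rewrite ler_norml => /andP[].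
  rewrite -[leRHS](E_cst P); apply: ae_le_Rintegral => //.
  by move: hb; move: (cpairing _ a) => c; apply: filterS => w; rewrite ler_norml => /andP[].
(* One bound for all coordinates, as [finite_separation] requires. *)
pose M := \sum_i (Ms i + Ms i).
have Ms0 i : 0 <= Ms i by apply: le_trans (p_bound i a0 Da0).
have vM a i : K a -> `|v a i| <= M.
  move=> Ka; apply: le_trans (ler_normB _ _) _.
  apply: le_trans (lerD (p_bound i a (KD _ Ka)) (p_bound i a0 Da0)) _.
  by rewrite /M (bigD1 i)//= lerDl; apply: sumr_ge0 => j _; rewrite addr_ge0.
have [[q Qq] _ _] := hQ.
have Kconv' a b l : K a -> K b -> 0 <= l <= 1 -> exists2 c, K c & forall i, v c i = (1 - l) * v a i + l * v b i.
  move=> Ka Kb /andP[l0 l1].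
  have lw : weight P F tau (fun=> l) by split; [exact: Linf_cst|apply: aeW => w; rewrite l0 l1].
  exists (mix (fun=> l) b a); first exact: Kconv.
  move=> i; rewrite /v (pairing_comb (Xs i) (Xs i) (Xs i) b a (mix (fun=> l) b a) l (1 - l))//.
  - ring.
  - exact: KA.
  - exact: KA.
  - exact: mix_A1 (KD _ Kb) (KD _ Ka) lw.
  - by apply: aeW => w t; rewrite incr_mix; ring.
have [||c [del [del0 sep]]] := finite_separation _ K _ v M e _ vM Kconv' e0.
- by exists q; exact: QK.
- move=> a Ka; apply: contrapT => nfar; apply: far; exists a => // X /(In_nth _ unit_process) [i ->].
  rewrite ltNge; apply/negP => h; apply: nfar; exists i.
  by rewrite /v distrC.
have [Z [RZ pZ]] : exists Z, Rinf Z /\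
    forall a, A1 a -> pairing P Z a = \sum_i c i * pairing P (Xs i) a.
  by eexists; exact: Rinf_sum _ _ c Xs RX.
have RZp := proj_Ron _ RZ; have RZp' := proj_Rinf _ RZ.
have pproj a : D a -> pairing P (proj Z) a = \sum_i c i * pairing P (Xs i) a.
  move=> Da; have Aa := density_A1 _ Da.
  rewrite -pZ//; apply: pairing_eq => //; apply: filterS (density_incr _ Da) => w h t.
  have [wS|wS] := pselect (St t w); last by rewrite (proj2 (h t) wS) !mulr0.
  move: wS; rewrite /St /proj_process /= => /andP[-> tth].
  rewrite (_ : min_etime t (theta w) = t)//.
  by move: tth; rewrite /min_etime; case: (theta w) => //= k /minn_idPl.
have sepZ a : K a -> pairing P (proj Z) a0 + del <= pairing P (proj Z) a.
  move=> Ka; rewrite (pproj a0 Da0) (pproj a (KD _ Ka)).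
  have := sep a Ka; rewrite /v; under eq_bigr do rewrite mulrBr; rewrite sumrB; lra.
have [gs [z [gsB [mz [m zm]] zE gscv]]] := represents_approx Q hQ (proj Z) RZp.
have phi_a0 : E (phi (proj Z)) <= pairing P (proj Z) a0.
  rewrite pairing_cpairing//.
  have [mc ic _] := cpairing_spec (proj Z) a0 RZp' (density_A1 _ Da0).
  by apply: ae_le_Rintegral => //; [exact: phi_integrable|exact: ha0].
have gsK n : finite_min [set cpairing (proj Z) a | a in K] (gs n).
  elim: (gsB n) => [_ [a Qa <-]|f g _ h1 _ h2]; last exact: finite_min2.
  by apply: finite_min1; exists a => //; exact: QK.
have [_ [mZ Zm]] := RZp'.
have Bm f : [set cpairing (proj Z) a | a in K] f -> measurable_wrt G f /\ \forall w \ae P, `|f w| <= mZ.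
  move=> [a Ka <-]; have Da := KD _ Ka; split; last exact: cpairing_bound.
  by case: (cpairing_spec (proj Z) a RZp' (density_A1 _ Da)).
have gsE n : pairing P (proj Z) a0 + del <= E (gs n).
  have [b Kb gb] := finite_min_realized K (proj Z) (gs n) Kconv KD RZp' (gsK n).
  have Db := KD _ Kb.
  have [mc ic _] := cpairing_spec (proj Z) b RZp' (density_A1 _ Db).
  have [mg _] := finite_min_bounded _ mZ Bm _ (gsK n).
  rewrite (ae_Rintegral_eq (gs n) (cpairing (proj Z) b)) -?pairing_cpairing//.
  - exact: sepZ.
  - exact: mw_measurable mg.
  - exact: mw_measurable mc.
have cvE : E (gs n) @[n --> \oo] --> E (phi (proj Z)).
  apply: (ae_bounded_convergence _ _ mZ) => //.
  - move=> n; have [mg _] := finite_min_bounded _ mZ Bm _ (gsK n).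
    exact: (mw_measurable G GM _ mg).
  - exact: phi_measurable.
  - by apply/ae_foralln => n; case: (finite_min_bounded _ mZ Bm _ (gsK n)).
have := cvg_ge _ _ _ gsE cvE; lra.
Qed.

End coherent.

End processes.

Theorem corollary3p16 (d : measure_display) (T : measurableType d)
    (R : realType) (P : probability T R) (F : nat -> set (set T))
    (hF : is_filtration F) (hF0 : F 0%N = [set set0; [set: T]])
    (tau theta : T -> etime)
    (htau : stopping_time F tau) (htheta : stopping_time F theta)
    (htau_fin : \forall w \ae P, tau w <> None)
    (htau_theta : \forall w \ae P, le_etime (tau w) (theta w))
    (phi : process T R -> T -> R)
    (hphi : functional_on P F tau theta phi) :
  ((exists Q : set (process T R), represents P F tau theta Q phi) <->
   (coherent_utility P F tau theta phi /\
    Rinf_closed P F (acceptance P F tau theta phi))) /\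
  ((coherent_utility P F tau theta phi /\
    Rinf_closed P F (acceptance P F tau theta phi)) <->
   (coherent_utility P F tau theta phi /\
    continuous_decreasing P F tau theta phi)) /\
  (forall Q : set (process T R), represents P F tau theta Q phi ->
     is_smallest (closed_convex_densities P F tau theta) Q
       (null_densities P F tau theta phi) /\
     represents P F tau theta (null_densities P F tau theta phi) phi).
Proof.
have rep_closed Q : represents P F tau theta Q phi -> coherent_utility P F tau theta phi /\
    Rinf_closed P F (acceptance P F tau theta phi).
  move=> hQ; split; first exact: (represents_coherent _ _ hF _ _ htau htheta htau_fin htau_theta _ hphi Q hQ).
  exact: (represents_closed _ _ hF _ _ htau htheta htau_fin htau_theta _ hphi Q hQ).
have closed_cont : coherent_utility P F tau theta phi ->
    Rinf_closed P F (acceptance P F tau theta phi) -> continuous_decreasing P F tau theta phi.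
  by move=> hc hcl; apply: closed_continuous => //.
have cont_rep : coherent_utility P F tau theta phi -> continuous_decreasing P F tau theta phi ->
    represents P F tau theta (null_densities P F tau theta phi) phi.
  move=> hc hd; rewrite (null_densitiesE _ _ hF _ _ htau htheta htau_fin htau_theta _ hc).
  exact: (dominating_represents _ _ hF _ _ htau htheta htau_fin htau_theta _ hphi hc hd).
split; [|split].
- split=> [[Q /rep_closed//]|[hc hcl]].
  by exists (null_densities P F tau theta phi); apply: cont_rep => //; exact: closed_cont.
- split=> [[hc hcl]|[hc hd]]; first by split => //; exact: closed_cont.
  exact: rep_closed (cont_rep hc hd).
move=> Q hQ; have [hc hcl] := rep_closed Q hQ; have hd := closed_cont hc hcl.
split; last exact: cont_rep.
have hN := null_densitiesE _ _ hF _ _ htau htheta htau_fin htau_theta _ hc.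
have [_ ND _] := cont_rep hc hd.
split.
- split; first exact: ND.
    by rewrite hN; exact: (dominating_densities_closed _ _ hF _ _ htau htheta htau_fin htau_theta _ hc).
  by rewrite hN; exact: (dominating_densities_convex _ _ hF _ _ htau htheta htau_fin htau_theta).
- rewrite hN => a Qa; case: (hQ) => _ QD _; split; first exact: QD.
  move=> Y RY.
  exact: (represents_le _ _ _ _ _ hphi Q hQ).
- move=> K hK QK; rewrite hN.
  exact: (dominating_densities_least _ _ hF _ _ htau htheta htau_fin htau_theta _ hphi hc Q).
Qed.
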